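(* Let $X$ be a connected $2$-dimensional manifold (possibly with boundary) and let $\Delta$ be a foliation on $X$ belonging to class $\mathcal{F}$. Suppose that the family $\Sigma$ of all special leaves of $\Delta$ is locally finite, and let $Q$ be a connected component of $X\setminus(\Sigma\cup\partial X)$. Then: (1) $Q$ (with the foliation by the leaves of $\Delta$ contained in it) is foliated homeomorphic either with the standard cylinder $C$, or with the standard Möbius band $M$, or with the open model strip $\mathbb{R}\times(-1,1)$ foliated by the lines $\mathbb{R}\times\{t\}$. Moreover, in the first two cases $Q=X$. (2) Suppose $Q$ is foliated homeomorphic with the open model strip. Fix any foliated homeomorphism $\phi:\mathbb{R}\times(-1,1)\to Q$ and put $Q_-=\phi(\mathbb{R}\times(-1,0])$ and $Q_+=\phi(\mathbb{R}\times[0,1))$. Then the closures $\overline{Q_-}$ and $\overline{Q_+}$ in $X$, each foliated by the leaves of $\Delta$ contained in it, are foliated homeomorphic to some model strips with their canonical foliations.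
   Context: A one-dimensional foliation $\Delta$ on a 2-dimensional manifold $X$ (possibly non-connected, possibly with boundary) belongs to class $\mathcal{F}$ if: (i) each leaf of $\Delta$ is a closed subset of $X$; (ii) every connected component of $\partial X$ is a leaf of $\Delta$; (iii) for each leaf $\omega$, with $J=[0,1)$ if $\omega\subset\partial X$ and $J=(-1,1)$ otherwise, there exist an open neighborhood $U$ of $\omega$ and a homeomorphism $\phi:\mathbb{R}\times J\to U$ with $\phi(\mathbb{R}\times 0)=\omega$ and $\phi(\mathbb{R}\times t)$ a leaf of $\Delta$ for all $t\in J$. A homeomorphism between foliated surfaces is foliated if it maps leaves onto leaves. Let $Y=X/\Delta$ be the space of leaves with the quotient topology and $p:X\to Y$ the quotient map. A point $y\in Y$ is special if $y\neq\bigcap_{V}\overline{V}$, where $V$ runs over all neighborhoods of $y$ (i.e. this intersection is not $\{y\}$); a leaf $\omega$ is special if $p(\omega)$ is a special point. A family of subsets is locally finite if every point of $X$ has a neighborhood meeting only finitely many of them. A model strip is a subset $S\subset\mathbb{R}^2$ such that for some $a<b$: $\mathbb{R}\times(a,b)\subset S\subset\mathbb{R}\times[a,b]$ and $S\cap(\mathbb{R}\times\{a,b\})$ is a disjoint union of open intervals. Its canonical foliation consists of the lines $\mathbb{R}\times\{t\}$, $a<t<b$, and the open intervals forming $S\cap(\mathbb{R}\times\{a,b\})$. The standard cylinder $C$ (resp. standard Möbius band $M$) is the quotient of $\mathbb{R}\times[-1,1]$ by identifying $(t,-1)$ with $(t,1)$ (resp. with $(-t,1)$) for all $t\in\mathbb{R}$,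 foliated by the images of the lines $\mathbb{R}\times\{s\}$, $s\in[-1,1]$. *)

(* Defs.v *)
From HB Require Import structures.
From mathcomp Require Import all_boot all_order all_algebra.
From mathcomp Require Import all_classical all_reals all_analysis.
From mathcomp Require Import Rstruct Rstruct_topology.
Set Implicit Arguments. Unset Strict Implicit. Unset Printing Implicit Defensive.
Import Order.TTheory GRing.Theory Num.Theory.
Local Open Scope classical_set_scope.
Local Open Scope ring_scope.

Notation R := Rdefinitions.R.
Definition R2 := (R * R)%type.

Definition hline (t : R) : set R2 := [set p | p.2 = t].

Definition open_in {T : topologicalType} (A U : set T) : Prop :=
  exists V : set T, open V /\ U = A `&` V.

(* f : T1 -> T2 induces a quotient map from the subspace D onto the subspace Q,
   which identifies exactly the points related by rel: f maps D onto Q, two points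
   of D have the same image iff they are related, and a subset U of Q is open in Q
   iff its preimage is open in D.  Equivalently, f induces a homeomorphism from
   the quotient space D/rel onto Q. *)
Definition quotient_onto {T1 T2 : topologicalType} (D : set T1)
  (rel : T1 -> T1 -> Prop) (f : T1 -> T2) (Q : set T2) : Prop :=
  f @` D = Q /\
  (forall a b, D a -> D b -> (f a = f b <-> rel a b)) /\
  (forall U, U `<=` Q -> (open_in Q U <-> open_in D (D `&` f @^-1` U))).

Definition homeo_onto {T1 T2 : topologicalType} (D : set T1) (f : T1 -> T2)
  (Q : set T2) : Prop := quotient_onto D (fun a b => a = b) f Q.

(* Foliated version: leaves LD of the source (given as subsets of D; in the
   quotient case, subsets whose images are the leaves) correspond to the leaves
   LQ of the target. *)
Definition foliated_quotient_onto {T1 T2 : topologicalType} (D : set T1)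
  (rel : T1 -> T1 -> Prop) (LD : set (set T1)) (f : T1 -> T2) (Q : set T2)
  (LQ : set (set T2)) : Prop :=
  quotient_onto D rel f Q /\
  (forall l, LD l -> LQ (f @` l)) /\
  (forall m, LQ m -> exists l, LD l /\ m = f @` l).

Definition foliated_homeo {T1 T2 : topologicalType} (D : set T1)
  (LD : set (set T1)) (f : T1 -> T2) (Q : set T2) (LQ : set (set T2)) : Prop :=
  foliated_quotient_onto D (fun a b => a = b) LD f Q LQ.

Definition half_plane : set R2 := [set p | 0 <= p.2].

Definition chart_at {X : topologicalType} (x : X) (D : set R2) (f : R2 -> X)
  (U : set X) : Prop :=
  open U /\ U x /\ D `<=` half_plane /\ open_in half_plane D /\ homeo_onto D f U.

Definition surface (X : topologicalType) : Prop :=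
  hausdorff_space X /\ @second_countable X /\
  forall x : X, exists D f U, chart_at x D f U.

Definition boundary (X : topologicalType) : set X :=
  [set x | exists D f U, chart_at x D f U /\
       exists p, D p /\ p.2 = 0 /\ f p = x].
Arguments boundary : clear implicits.

(* a one-dimensional foliation, given by its set of leaves: a partition of X;
   the local product structure is required by condition (iii) of class F *)
Definition leaf_partition {X : Type} (Delta : set (set X)) : Prop :=
  (forall w, Delta w -> w !=set0) /\
  (forall w1 w2, Delta w1 -> Delta w2 -> w1 `&` w2 !=set0 -> w1 = w2) /\
  (forall x : X, exists w, Delta w /\ w x).

Definition J_interval (onbd : Prop) : set R :=
  if pselect onbd then [set t | 0 <= t < 1] else [set t | -1 < t < 1].

Definition class_F {X : topologicalType} (Delta : set (set X)) : Prop :=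
  leaf_partition Delta /\
  (* (i) *) (forall w, Delta w -> closed w) /\
  (* (ii) *) (forall x, boundary X x -> Delta (connected_component (boundary X) x)) /\
  (* (iii) *) (forall w, Delta w ->
     let J := J_interval (w `<=` boundary X) in
     exists (U : set X) (phi : R2 -> X),
       open U /\ w `<=` U /\
       homeo_onto [set p : R2 | J p.2] phi U /\
       phi @` hline 0 = w /\
       (forall t, J t -> Delta (phi @` hline t))).

Definition induced_fol {X : Type} (Delta : set (set X)) (A : set X) : set (set X) :=
  [set w | Delta w /\ w `<=` A].

(* Points of Y are the leaves; p(x) is the leaf through x.  A set S of leaves
   is open in the quotient topology iff p^-1(S) (= union of S) is open in X. *)
Definition leafspace_open {X : topologicalType} (Delta : set (set X))
  (S : set (set X)) : Prop :=
  S `<=` Delta /\ open (\bigcup_(w in S) w).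

Definition leafspace_nbhd {X : topologicalType} (Delta : set (set X))
  (y : set X) (V : set (set X)) : Prop :=
  V `<=` Delta /\ exists S, leafspace_open Delta S /\ S y /\ S `<=` V.

Definition leafspace_closure {X : topologicalType} (Delta : set (set X))
  (V : set (set X)) : set (set X) :=
  [set z | Delta z /\ forall S, leafspace_open Delta S -> S z ->
                                  exists w, S w /\ V w].

Definition special_point {X : topologicalType} (Delta : set (set X))
  (y : set X) : Prop :=
  [set z | Delta z /\ forall V, leafspace_nbhd Delta y V ->
                                  leafspace_closure Delta V z] <> [set y].

Definition special_leaf {X : topologicalType} (Delta : set (set X))
  (w : set X) : Prop := Delta w /\ special_point Delta w.

Definition locally_finite {X : topologicalType} (F : set (set X)) : Prop :=
  forall x : X, exists N, nbhs x N /\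
    finite_set [set w | F w /\ w `&` N !=set0].

Definition open_interval (I : set R) : Prop :=
  exists x y : \bar R, (x < y)%E /\ I = [set t : R | (x < t%:E < y)%E].

Definition edge_decomposition (S : set R2) (c : R) (Ic : set (set R)) : Prop :=
  (forall I, Ic I -> open_interval I) /\
  (forall I1 I2, Ic I1 -> Ic I2 -> I1 `&` I2 !=set0 -> I1 = I2) /\
  [set t | S (t, c)] = \bigcup_(I in Ic) I.

Definition model_strip (a b : R) (Ia Ib : set (set R)) (S : set R2) : Prop :=
  a < b /\
  [set p : R2 | a < p.2 < b] `<=` S /\ S `<=` [set p : R2 | a <= p.2 <= b] /\
  edge_decomposition S a Ia /\ edge_decomposition S b Ib.

Definition canonical_foliation (a b : R) (Ia Ib : set (set R)) : set (set R2) :=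
  [set L | (exists t, a < t < b /\ L = hline t) \/
           (exists I, Ia I /\ L = [set p : R2 | p.2 = a /\ I p.1]) \/
           (exists I, Ib I /\ L = [set p : R2 | p.2 = b /\ I p.1])].

Definition open_strip : set R2 := [set p | -1 < p.2 < 1].
Definition open_strip_foliation : set (set R2) :=
  [set L | exists t, -1 < t < 1 /\ L = hline t].

Definition closed_band : set R2 := [set p | -1 <= p.2 <= 1].
Definition closed_band_foliation : set (set R2) :=
  [set L | exists s, -1 <= s <= 1 /\ L = hline s].

Definition cylinder_rel (p q : R2) : Prop :=
  p = q \/ (p.1 = q.1 /\ ((p.2 = -1 /\ q.2 = 1) \/ (p.2 = 1 /\ q.2 = -1))).
Definition moebius_rel (p q : R2) : Prop :=
  p = q \/ (q.1 = - p.1 /\ ((p.2 = -1 /\ q.2 = 1) \/ (p.2 = 1 /\ q.2 = -1))).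

(* Q is foliated homeomorphic to the standard cylinder C, resp. Moebius band M:
   there is a foliated homeomorphism C -> Q, i.e. (composing with the
   projection R x [-1,1] -> C) a foliated quotient map as below. *)
Definition foliated_cylinder {X : topologicalType} (Q : set X)
  (L : set (set X)) : Prop :=
  exists f : R2 -> X,
    foliated_quotient_onto closed_band cylinder_rel closed_band_foliation f Q L.
Definition foliated_moebius {X : topologicalType} (Q : set X)
  (L : set (set X)) : Prop :=
  exists f : R2 -> X,
    foliated_quotient_onto closed_band moebius_rel closed_band_foliation f Q L.

Definition foliated_model_strip {X : topologicalType} (A : set X)
  (L : set (set X)) : Prop :=
  exists (a b : R) (Ia Ib : set (set R)) (S : set R2) (f : R2 -> X),
    model_strip a b Ia Ib S /\
    foliated_homeo S (canonical_foliation a b Ia Ib) f A L.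

(* Main.v *)
(** An open saturated set with coordinates along and across the leaves is called a chart.
Leaves of Q are separated from each other, so the charts which start on a given side of
a fixed leaf w of Q are ordered by inclusion. Countably many of them exhaust their union,
and averaging their leaf coordinates with leafwise constant weights makes this union a
chart: a maximal ray. It is closed in the complement of w in Q, hence Q consists of w and
of the two rays issued from it. Disjoint rays glue to an open strip; otherwise the rays
coincide, and their union closes up along w to a cylinder or a Moebius band, depending on
the orientation. The latter are compact across the leaves, hence closed in X.

For (2), the leaves in the closure of Q_- outside Q are limits of Q_- as the transverse
coordinate tends to -1 and carry one-sided charts, countably many of which suffice. The
leaf coordinate of such a chart is continued to Q_- by freezing the transverse coordinate,
and it tends to 1 or -1 at every other boundary leaf. The weighted sum of these functions
is continuous, increasing along the leaves, and sends different boundary leaves onto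
disjoint open intervals; with the transverse coordinate it embeds the closure in the plane. *)
Require Import Defs.
From HB Require Import structures.
From mathcomp Require Import all_boot all_order all_algebra.
From mathcomp Require Import all_classical all_reals all_analysis.
From mathcomp Require Import Rstruct Rstruct_topology.
From mathcomp Require Import ring lra.
Import Order.TTheory GRing.Theory Num.Theory.
Import numFieldNormedType.Exports.
Local Open Scope classical_set_scope.
Local Open Scope ring_scope.
Set Implicit Arguments. Unset Strict Implicit. Unset Printing Implicit Defensive.

(** * Foliated charts *)

(* The cost of lra is driven by the number of inequalities in the context. Inside
   sections this is redefined: lra needs all section hypotheses to be kept. *)
Tactic Notation "lra" "from" hyp_list(hs) := clear - hs; lra.

(** The leaf space of Q is Hausdorff because a nonspecial leaf is separated from every other leaf.
    This is used in one form throughout: if a monotone transverse coordinate has a limit inside its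
    range, the leaf at the limit level and the limiting leaf are not separated, hence equal. A
    coordinate can therefore leave a chart only through its ends. The other difficulty is to match
    coordinates along the leaves, since two charts differ on a leaf by an arbitrary homeomorphism.
    Convexity replaces any extension of homeomorphisms: an average of increasing bijections of a
    leaf onto (-1, 1), with weights depending only on the leaf, is again one. It requires a common
    orientation, which is why orientation is part of the data everywhere. Leaf coordinates take
    values in (-1, 1), and not in the whole line, so that countable weighted sums of them are
    defined. For boundary leaves an average must also distinguish the leaves from each other: the
    coordinate belonging to one of them lies strictly inside (-1, 1) on it and has modulus 1 on all
    others. *)

Section real_limits.
Variables (T : Type) (G : set_system T) (FG : Filter G).
Implicit Types (f g : T -> R) (a b : R).

Lemma rlimD f g a b : f @ G --> a -> g @ G --> b -> (fun x => f x + g x) @ G --> a + b.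
Proof. exact: (@cvgD _ R^o T G FG f g a b). Qed.

Lemma rlimN f a : f @ G --> a -> (fun x => - f x) @ G --> - a.
Proof. exact: (@cvgN _ R^o T G FG f a). Qed.

Lemma rlimB f g a b : f @ G --> a -> g @ G --> b -> (fun x => f x - g x) @ G --> a - b.
Proof. by move=> fa gb; apply: rlimD => //; exact: rlimN. Qed.

Lemma rlimM f g a b : f @ G --> a -> g @ G --> b -> (fun x => f x * g x) @ G --> a * b.
Proof. exact: (@cvgM R T G FG f g a b). Qed.

Lemma rlimV f a : a != 0 -> f @ G --> a -> (fun x => (f x)^-1) @ G --> a^-1.
Proof. exact: (@cvgV R T G FG f a). Qed.

Lemma rlim_cst a : (fun _ : T => a) @ G --> a.
Proof. exact: cvg_cst. Qed.

Lemma rlim_itv f a : (forall e : R, 0 < e -> \forall x \near G, a - e < f x < a + e) ->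
  f @ G --> a.
Proof.
move=> H; apply/(@cvgrPdist_lt _ R^o T G FG f a) => e /H; apply: filterS => x /andP[h1 h2].
by rewrite distrC ltr_distl; apply/andP; split.
Qed.

Lemma rlim_near f a : f @ G --> a ->
  forall e : R, 0 < e -> \forall x \near G, a - e < f x < a + e.
Proof.
move/(@cvgrPdist_lt _ R^o T G FG f a) => H e /H; apply: filterS => x.
by rewrite distrC ltr_distl.
Qed.

Lemma rlim_max f g a b : f @ G --> a -> g @ G --> b ->
  (fun x => Num.max (f x) (g x)) @ G --> Num.max a b.
Proof.
move=> fa gb; apply: rlim_itv => e e0.
have := rlim_near fa e0; have := rlim_near gb e0; apply: filterS2 => x h1 h2.
by case: (leP (f x) (g x)) => ?; case: (leP a b) => ?; lra.
Qed.

Lemma rlim_min f g a b : f @ G --> a -> g @ G --> b ->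
  (fun x => Num.min (f x) (g x)) @ G --> Num.min a b.
Proof.
move=> fa gb; apply: rlim_itv => e e0.
have := rlim_near fa e0; have := rlim_near gb e0; apply: filterS2 => x h1 h2.
by case: (leP (f x) (g x)) => ?; case: (leP a b) => ?; lra.
Qed.

End real_limits.

Lemma pos_min (a b : R) : 0 < a -> 0 < b -> exists c : R, [/\ 0 < c, c <= a & c <= b].
Proof.
move=> a0 b0; exists (Num.min a b); split; first by rewrite lt_min a0.
  by rewrite ge_min lexx.
by rewrite ge_min lexx orbT.
Qed.

Lemma lt_between (a b c : R) : a < c -> b < c -> exists x : R, [/\ a < x, b < x & x < c].
Proof.
move=> ac bc; have [e [e0 e1 e2]] := @pos_min (c - a) (c - b) ltac:(lra) ltac:(lra).
by exists (c - e / 2); split; lra.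
Qed.

Lemma gt_between (a b c : R) : c < a -> c < b -> exists x : R, [/\ x < a, x < b & c < x].
Proof.
move=> ac bc; have [e [e0 e1 e2]] := @pos_min (a - c) (b - c) ltac:(lra) ltac:(lra).
by exists (c + e / 2); split; lra.
Qed.

Definition btw (a b c : R) : Prop := (a <= c <= b) \/ (b <= c <= a).

(* A foliated chart on a saturated open set P: F runs over (-1, 1) along the leaves and
   t over J across them. The homeomorphism onto (-1, 1) x J is stated pointwise
   (continuity and boxes around each point), and the leaves, the classes of E, are the
   fibres of t. *)
Record fchart (T : topologicalType) (E : T -> T -> Prop) (P : set T)
    (J : set R) (F t : T -> R) : Prop := Coord {
  fchart_open : open P;
  fchart_F : forall p, P p -> F x @[x --> p] --> F p;
  fchart_t : forall p, P p -> t x @[x --> p] --> t p;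
  fchart_Fb : forall p, P p -> -1 < F p < 1;
  fchart_J : forall p, P p -> J (t p);
  fchart_pt : forall x s : R, -1 < x < 1 -> J s -> exists p, [/\ P p, F p = x & t p = s];
  fchart_inv : forall p N, P p -> nbhs p N -> exists2 d : R, 0 < d &
    forall q, P q -> F p - d < F q < F p + d -> t p - d < t q < t p + d -> N q;
  fchart_inj : forall p q, P p -> P q -> F p = F q -> t p = t q -> p = q;
  fchart_E : forall p q, P p -> (E p q <-> P q /\ t q = t p) }.

Section fchart_theory.
Variables (T : topologicalType) (E : T -> T -> Prop).
Variables (P : set T) (J : set R) (F t : T -> R).
Hypothesis c : fchart E P J F t.
Hypothesis iJ : is_interval J.

(** By [fchart_inv] the inverse of (F, t) is continuous, so a curve (a, b) in the coordinate
    rectangle lifts to X. Connectedness and monotonicity inside a chart are all obtained from such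
    lifts. *)
Lemma fchart_section (D : set R) (a b : R -> R) p : P p ->
  {within D, continuous a} -> {within D, continuous b} ->
  (forall s, D s -> -1 < a s < 1 /\ J (b s)) ->
  exists g : R -> T, {within D, continuous g} /\
    forall s, D s -> [/\ P (g s), F (g s) = a s & t (g s) = b s].
Proof.
move=> Pp ca cb rg.
pose g s := xget p [set q | [/\ P q, F q = a s & t q = b s]].
have gP s : D s -> [/\ P (g s), F (g s) = a s & t (g s) = b s].
  move=> Ds; have [? ?] := rg _ Ds.
  by have [q qP] := fchart_pt c (x := a s) (s := b s) ltac:(done) ltac:(done);
    exact: (@xgetPex _ p [set q | [/\ P q, F q = a s & t q = b s]] (ex_intro _ q qP)).
exists g; split => //; apply/subspace_continuousP => s Ds N /= nN.
have [Pg Fg tg] := gP _ Ds.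
have [d d0 H] := fchart_inv c Pg nN.
have {}ca : a @ within D (nbhs s) --> a s by move/subspace_continuousP: ca; apply.
have {}cb : b @ within D (nbhs s) --> b s by move/subspace_continuousP: cb; apply.
have h1 : \forall r \near within D (nbhs s), a s - d < a r.
  by apply: (cvgr_gt (a s) ca); lra.
have h2 : \forall r \near within D (nbhs s), a r < a s + d.
  by apply: (cvgr_lt (a s) ca); lra.
have h3 : \forall r \near within D (nbhs s), b s - d < b r.
  by apply: (cvgr_gt (b s) cb); lra.
have h4 : \forall r \near within D (nbhs s), b r < b s + d.
  by apply: (cvgr_lt (b s) cb); lra.
have h5 : \forall r \near within D (nbhs s), D r by exact: withinT.
change (\forall r \near within D (nbhs s), N (g r)).
near=> r => /=; have Dr : D r by near: r.
have [Pr Fr tr] := gP _ Dr; apply: H => //.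
  rewrite Fr Fg; apply/andP; split; by near: r.
rewrite tr tg; apply/andP; split; by near: r.
Unshelve. all: by end_near. Qed.

(** C is the lift of the straight segment. Since both coordinates stay between their end values,
    intermediate values can later be found on a prescribed leaf or on a prescribed fibre of F. *)
Lemma fchart_connected p q : P p -> P q ->
  exists C : set T, [/\ connected C, C p, C q &
    forall r, C r -> [/\ P r, btw (F p) (F q) (F r) & btw (t p) (t q) (t r)]].
Proof.
move=> Pp Pq.
pose a (s : R) := F p + s * (F q - F p); pose b (s : R) := t p + s * (t q - t p).
have cc (u v : R) : {within `[0, 1], continuous (fun s : R => u + s * v)}.
  apply: continuous_subspaceT => s; apply: rlimD; first exact: rlim_cst.
  by apply: rlimM; [exact: cvg_id | exact: rlim_cst].
have bt (u v s : R) : 0 <= s <= 1 -> btw u v (u + s * (v - u)).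
  move=> s01; case: (lerP u v) => uv; [left|right]; nra.
have rg s : `[0, 1]%classic s -> -1 < a s < 1 /\ J (b s).
  rewrite /= in_itv /= => s01; have := fchart_Fb c Pp; have := fchart_Fb c Pq.
  move=> hq hp; split; first by have := bt (F p) (F q) s s01; rewrite /a /btw; lra.
  have := bt (t p) (t q) s s01; have := fchart_J c Pp; have := fchart_J c Pq.
  move=> Jq Jp [h|h]; first exact: (iJ Jp Jq).
  exact: (iJ Jq Jp).
have [g [gc gP]] := fchart_section Pp (cc _ _) (cc _ _) rg.
have i0 : `[0, 1]%classic (0 : R) by rewrite /= in_itv /= lexx ler01.
have i1 : `[0, 1]%classic (1 : R) by rewrite /= in_itv /= lexx ler01.
exists (g @` `[0, 1]); split.
- apply: connected_continuous_connected => //; exact: segment_connected.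
- exists 0 => //; have [? F0 t0] := gP _ i0.
  by apply: (fchart_inj c) => //; rewrite ?F0 ?t0 mul0r addr0.
- exists 1 => //; have [? F0 t0] := gP _ i1.
  by apply: (fchart_inj c) => //; rewrite ?F0 ?t0 mul1r; lra.
- move=> _ [s si <-]; have [? -> ->] := gP _ si.
  by move: si; rewrite /= in_itv /= => si; split => //; exact: bt.
Qed.

Lemma fchart_ivt (h : T -> R) v p q : (forall r, P r -> h x @[x --> r] --> h r) ->
  P p -> P q -> h p <= v <= h q ->
  exists r, [/\ P r, h r = v, btw (F p) (F q) (F r) & btw (t p) (t q) (t r)].
Proof.
move=> hc Pp Pq hv.
have [C [Cc Cp Cq CP]] := fchart_connected Pp Pq.
have : connected (h @` C).
  apply: connected_continuous_connected => //.
  apply: continuous_in_subspaceT => r; rewrite inE => /CP[Pr _ _]; exact: hc.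
move/connected_intervalP => /(_ (h p) (h q)).
move=> /(_ ltac:(by exists p) ltac:(by exists q) v hv) [r Cr <-].
by have [? ? ?] := CP _ Cr; exists r.
Qed.

(** Along the lifted curve F = 0 the function h is continuous and injective on an interval, hence
    strictly monotone. This compares the transverse coordinates of overlapping charts. *)
Lemma fchart_mono (h : T -> R) : (forall r, P r -> h x @[x --> r] --> h r) ->
  (forall p q, P p -> P q -> (h p = h q <-> t p = t q)) ->
  (forall p q, P p -> P q -> (h p < h q <-> t p < t q)) \/
  (forall p q, P p -> P q -> (h p < h q <-> t q < t p)).
Proof.
move=> hc hi.
have [[p0 Pp0]|P0] := pselect (exists p, P p); last first.
  by left => p ? Pp; exfalso; apply: P0; exists p.
(* [itv_continuous_inj_mono] speaks of a syntactic interval, so J is replaced by its hull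
   [Rhull J]. *)
have JE := iffLR (is_intervalP J) iJ.
have c0 : {within J, continuous (fun _ : R => 0 : R)}.
  by apply: continuous_subspaceT => s; exact: cvg_cst.
have c1 : {within J, continuous (fun s : R => s : R)}.
  by apply: continuous_subspaceT => s; exact: cvg_id.
have [//|g [gc gP]] := fchart_section Pp0 c0 c1.
  by move=> s Js; split => //; lra.
have hg p : P p -> h p = h (g (t p)).
  move=> Pp; have [Pg _ tg] := gP _ (fchart_J c Pp).
  by apply/hi.
have cg : {within J, continuous (h \o g)}.
  apply/subspace_continuousP => s Js; have [Pg _ _] := gP _ Js.
  apply: (@cvg_comp _ _ _ g h _ (nbhs (g s))); last exact: hc.
  by move/subspace_continuousP: gc; apply.
have inj : {in Rhull J &, injective (h \o g)}.
  move=> s r; rewrite !unfold_in => Js Jr /=.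
  have {}Js : J s by rewrite JE. have {}Jr : J r by rewrite JE.
  have [Ps _ ts] := gP _ Js; have [Pr _ tr] := gP _ Jr.
  by move=> /hi; rewrite ts tr; apply.
rewrite JE in cg; have [m|m] := itv_continuous_inj_mono cg inj; [left|right].
  have MM := leW_mono_in (le_mono_in m).
  move=> p q Pp Pq; rewrite hg// [X in _ < X]hg//.
  have Jp := fchart_J c Pp; have Jq := fchart_J c Pq; rewrite JE in Jp Jq.
  by rewrite (MM _ _ Jp Jq).
have MM := leW_nmono_in (le_nmono_in m).
move=> p q Pp Pq; rewrite hg// [X in _ < X]hg//.
have Jp := fchart_J c Pp; have Jq := fchart_J c Pq; rewrite JE in Jp Jq.
by rewrite (MM _ _ Jp Jq).
Qed.

Lemma fchart_mono_leaf (h : T -> R) p0 : P p0 -> (forall r, P r -> h x @[x --> r] --> h r) ->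
  (forall p q, P p -> P q -> t p = t p0 -> t q = t p0 -> h p = h q -> F p = F q) ->
  (forall p q, P p -> P q -> t p = t p0 -> t q = t p0 -> (h p < h q <-> F p < F q)) \/
  (forall p q, P p -> P q -> t p = t p0 -> t q = t p0 -> (h p < h q <-> F q < F p)).
Proof.
move=> Pp0 hc hi.
pose J1 : set R := `]-1, 1[%classic.
have c0 : {within J1, continuous (fun _ : R => t p0)}.
  by apply: continuous_subspaceT => s; exact: cvg_cst.
have c1 : {within J1, continuous (fun s : R => s : R)}.
  by apply: continuous_subspaceT => s; exact: cvg_id.
have [//|g [gc gP]] := fchart_section Pp0 c1 c0.
  by move=> s; rewrite /J1 /= in_itv /= => s1; split => //; exact: fchart_J c _ _.
have J1F p : P p -> F p \in `]-1, 1[ by move=> Pp; rewrite in_itv /=; exact: (fchart_Fb c).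
have hg p : P p -> t p = t p0 -> h p = h (g (F p)).
  move=> Pp tp; have [Pg Fg tg] := gP _ (J1F _ Pp).
  by congr h; apply: (fchart_inj c) => //; rewrite tg.
have cg : {within J1, continuous (h \o g)}.
  apply/subspace_continuousP => s Js; have [Pg _ _] := gP _ Js.
  apply: (@cvg_comp _ _ _ g h _ (nbhs (g s))); last exact: hc.
  by move/subspace_continuousP: gc; apply.
have inj : {in `]-1, 1[ &, injective (h \o g)}.
  move=> s r Js Jr /= hh.
  have [Ps Fs ts] := gP _ Js; have [Pr Fr tr] := gP _ Jr.
  by rewrite -Fs -Fr; apply: hi.
have [m|m] := itv_continuous_inj_mono cg inj; [left|right].
  have MM := leW_mono_in (le_mono_in m).
  move=> p q Pp Pq tp tq; rewrite hg// [X in _ < X]hg//.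
  by rewrite (MM _ _ (J1F _ Pp) (J1F _ Pq)).
have MM := leW_nmono_in (le_nmono_in m).
move=> p q Pp Pq tp tq; rewrite hg// [X in _ < X]hg//.
by rewrite (MM _ _ (J1F _ Pp) (J1F _ Pq)).
Qed.

End fchart_theory.

Section fchart_ops.
Variables (T : topologicalType) (E : T -> T -> Prop).
Implicit Types (P : set T) (J : set R) (F t h : T -> R).

Lemma fchart_leaf P J F t p q : fchart E P J F t -> P p -> P q ->
  (E p q <-> t p = t q).
Proof.
move=> c Pp Pq; have := fchart_E c q Pp; split; last by move=> e; apply/H; split.
by move/H => [_ ->].
Qed.

Lemma fchart_sat P J F t p q : fchart E P J F t -> P p -> E p q -> P q.
Proof. by move=> c Pp /(fchart_E c q Pp) []. Qed.

Lemma fchart_nbhs P J F t p : fchart E P J F t -> P p -> \forall q \near p, P q.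
Proof. by move=> c Pp; apply: open_nbhs_nbhs; split => //; exact: fchart_open c. Qed.

Lemma fchart_at P J F t (x s : R) : fchart E P J F t -> -1 < x < 1 -> J s ->
  exists p, [/\ P p, F p = x & t p = s].
Proof. by move=> c x1 Js; exact: (fchart_pt c x1 Js). Qed.

Lemma fchart_flipF P J F t : fchart E P J F t -> fchart E P J (fun x => - F x) t.
Proof.
move=> c; split.
- exact: (fchart_open c).
- by move=> p Pp; apply: rlimN; exact: (fchart_F c).
- exact: (fchart_t c).
- by move=> p /(fchart_Fb c); lra.
- exact: (fchart_J c).
- move=> x s x1 Js; have [||p [Pp Fp tp]] := @fchart_pt _ _ _ _ _ _ c (- x) s => //.
    by lra.
  by exists p; split => //; rewrite Fp opprK.
- move=> p N Pp nN; have [d d0 H] := fchart_inv c Pp nN; exists d => // q Pq h1 h2.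
  by apply: H => //; lra.
- by move=> p q Pp Pq /oppr_inj; exact: (fchart_inj c).
- exact: (fchart_E c).
Qed.

Lemma fchart_restr P J F t P' : fchart E P J F t -> open P' -> P' `<=` P ->
  (forall p q, P' p -> P q -> t q = t p -> P' q) ->
  fchart E P' (t @` P') F t.
Proof.
move=> c oP' sub sat; split => //.
- by move=> p /sub; exact: (fchart_F c).
- by move=> p /sub; exact: (fchart_t c).
- by move=> p /sub; exact: (fchart_Fb c).
- move=> x _ x1 [q P'q <-].
  have [||p [Pp Fp tp]] := @fchart_pt _ _ _ _ _ _ c x (t q) => //.
    by apply: (fchart_J c); exact: sub.
  by exists p; split => //; apply: (sat q).
- move=> p N /sub Pp nN; have [d d0 H] := fchart_inv c Pp nN; exists d => // q /sub Pq.
  exact: H.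
- by move=> p q /sub Pp /sub Pq; exact: (fchart_inj c).
- move=> p q P'p; have Pp := sub _ P'p; rewrite (fchart_E c)//; split.
    by move=> [Pq tq]; split => //; exact: (sat p).
  by move=> [/sub].
Qed.

(** Either t reaches t p + d, and a point at level t p + d / 2 yields the bound e, or there is
    nothing to bound. The two sides of p are treated separately because J may be half-open. *)
Lemma fchart_above P J F t h p d : fchart E P J F t -> is_interval J -> P p ->
  (forall p q, P p -> P q -> (h p < h q <-> t p < t q)) -> 0 < d ->
  exists2 e : R, 0 < e & forall q, P q -> h q < h p + e -> t q < t p + d.
Proof.
move=> c iJ Pp hm d0.
have [[q [Pq tq]]|no] := pselect (exists q, P q /\ t p + d <= t q).
  have Jd : J (t p + d / 2).
    by apply: (iJ _ _ (fchart_J c Pp) (fchart_J c Pq)); lra.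
  have [r [Pr Fr tr]] := fchart_pt c (fchart_Fb c Pp) Jd.
  exists (h r - h p); first by rewrite subr_gt0; apply/hm => //; lra.
  move=> r' Pr' hr'.
  have : h r' < h r by lra.
  by move/(hm _ _ Pr' Pr); lra.
exists 1 => // q Pq _; rewrite ltNge; apply/negP => hq; apply: no; by exists q.
Qed.

Lemma fchart_below P J F t h p d : fchart E P J F t -> is_interval J -> P p ->
  (forall p q, P p -> P q -> (h p < h q <-> t p < t q)) -> 0 < d ->
  exists2 e : R, 0 < e & forall q, P q -> h p - e < h q -> t p - d < t q.
Proof.
move=> c iJ Pp hm d0.
have [[q [Pq tq]]|no] := pselect (exists q, P q /\ t q <= t p - d).
  have Jd : J (t p - d / 2).
    by apply: (iJ _ _ (fchart_J c Pq) (fchart_J c Pp)); lra.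
  have [r [Pr Fr tr]] := fchart_pt c (fchart_Fb c Pp) Jd.
  exists (h p - h r); first by rewrite subr_gt0; apply/hm => //; lra.
  move=> r' Pr' hr'.
  have : h r < h r' by lra.
  by move/(hm _ _ Pr Pr'); lra.
exists 1 => // q Pq _; rewrite ltNge; apply/negP => hq; apply: no; by exists q.
Qed.

Lemma fchart_reparam P J F t h : fchart E P J F t -> is_interval J ->
  (forall r, P r -> h x @[x --> r] --> h r) ->
  (forall p q, P p -> P q -> (h p = h q <-> t p = t q)) ->
  fchart E P (h @` P) F h.
Proof.
move=> c iJ hc hi; split => //.
- exact: (fchart_open c).
- exact: (fchart_F c).
- exact: (fchart_Fb c).
- move=> x _ x1 [q Pq <-].
  have [p [Pp Fp tp]] := fchart_at c x1 (fchart_J c Pq).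
  by exists p; split => //; apply/hi.
- move=> p N Pp nN; have [d d0 H] := fchart_inv c Pp nN.
  have [m|m] := fchart_mono c iJ hc hi.
    have [e1 e10 H1] := fchart_above c iJ Pp m d0.
    have [e2 e20 H2] := fchart_below c iJ Pp m d0.
    have [e3 [e30 e31 e32]] := pos_min e10 e20.
    have [e [e0 e4 e5]] := pos_min d0 e30.
    exists e => // q Pq h1 h2.
    apply: H => //; first by lra.
    by apply/andP; split; [apply: H2 | apply: H1] => //; lra from e32 e5 h2 e31 e5 h2.
  have m' : forall p q, P p -> P q -> (- h p < - h q <-> t p < t q).
    by move=> p' q' Pp' Pq'; rewrite ltrN2; exact: m.
  have [e1 e10 H1] := fchart_above c iJ Pp m' d0.
  have [e2 e20 H2] := fchart_below c iJ Pp m' d0.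
  have [e3 [e30 e31 e32]] := pos_min e10 e20.
  have [e [e0 e4 e5]] := pos_min d0 e30.
  exists e => // q Pq h1 h2.
  apply: H => //; first by lra.
  by apply/andP; split; [apply: H2 | apply: H1] => //; lra from e32 e5 h2 e31 e5 h2.
- by move=> p q Pp Pq Fp /(hi _ _ Pp Pq); exact: (fchart_inj c Pp Pq Fp).
- move=> p q Pp; rewrite (fchart_E c)//; split=> -[Pq /hi e]; split => //; exact: e.
Qed.

Lemma fchart_sandwich P J F t (G : T -> R) : fchart E P J F t ->
  (forall r, P r -> G x @[x --> r] --> G r) ->
  (forall p q, P p -> P q -> t p = t q -> F p < F q -> G p < G q) ->
  forall p N, P p -> nbhs p N -> exists2 d : R, 0 < d &
    forall q, P q -> G p - d < G q < G p + d -> t p - d < t q < t p + d -> N q.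
Proof.
move=> c Gc Gm p N Pp nN; have [d d0 H] := fchart_inv c Pp nN.
have Fp := fchart_Fb c Pp.
have [xl [xl1 xl2 xl3]] := @lt_between (-1) (F p - d) (F p) ltac:(lra) ltac:(lra).
have [xr [xr1 xr2 xr3]] := @gt_between 1 (F p + d) (F p) ltac:(lra) ltac:(lra).
have bl : -1 < xl < 1 by lra.
have br : -1 < xr < 1 by lra.
have [pl [Pl Fl tl]] := fchart_pt c bl (fchart_J c Pp).
have [pr [Pr Fr tr]] := fchart_pt c br (fchart_J c Pp).
have Gl : G pl < G p by apply: Gm => //; lra.
have Gr : G p < G pr by apply: Gm => //; lra.
have nl : nbhs pl [set q | G q < (G pl + G p) / 2].
  by apply: (cvgr_lt (G pl) (Gc _ Pl)); lra.
have nr : nbhs pr [set q | (G pr + G p) / 2 < G q].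
  by apply: (cvgr_gt (G pr) (Gc _ Pr)); lra.
have [dl dl0 Hl] := fchart_inv c Pl nl; have [dr dr0 Hr] := fchart_inv c Pr nr.
have [m1 [m10 m11 m12]] := pos_min dl0 dr0.
have [m2 [m20 m21 m22]] :=
  @pos_min ((G p - G pl) / 2) ((G pr - G p) / 2) ltac:(lra from Gl) ltac:(lra from Gr).
have [m3 [m30 m31 m32]] := pos_min m10 m20.
have [m [m0 m1' m2']] := pos_min d0 m30.
exists m => // q Pq hG ht.
have [ql [Pql Fql tql]] := fchart_pt c bl (fchart_J c Pq).
have [qr [Pqr Fqr tqr]] := fchart_pt c br (fchart_J c Pq).
have hl : G ql < (G pl + G p) / 2 by apply: Hl => //; clear -Fql Fl tql tl ht dl0 m2' m31 m11; lra.
have hr : (G pr + G p) / 2 < G qr by apply: Hr => //; clear -Fqr Fr tqr tr ht dr0 m2' m31 m12; lra.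
have mono r r' : P r -> P r' -> t r = t r' -> G r < G r' -> F r < F r'.
  move=> Pr' Pr'' tt GG; case: (ltrgtP (F r) (F r')) => // h.
    by have := Gm _ _ Pr'' Pr' (esym tt) h; lra from GG.
  by move: GG; rewrite (fchart_inj c Pr' Pr'' h tt) ltxx.
have h1 : F ql < F q by apply: mono => //; clear -m22 m21 hG hl hr m1' m2' m31 m32; lra.
have h2 : F q < F qr by apply: mono => //; clear -m22 m21 hG hl hr m1' m2' m31 m32; lra.
by apply: H => //; clear -h1 h2 Fql Fqr xl2 xr2 ht m1'; lra.
Qed.

Lemma fchart_refiber P J F t (G : T -> R) : fchart E P J F t ->
  (forall r, P r -> G x @[x --> r] --> G r) ->
  (forall p q, P p -> P q -> t p = t q -> F p < F q -> G p < G q) ->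
  (forall p, P p -> -1 < G p < 1) ->
  (forall (x : R) p, -1 < x < 1 -> P p -> exists q, [/\ P q, G q = x & t q = t p]) ->
  fchart E P J G t.
Proof.
move=> c Gc Gm Gb Gs; split => //.
- exact: (fchart_open c).
- exact: (fchart_t c).
- exact: (fchart_J c).
- move=> x s x1 Js; have [||p [Pp Fp tp]] := @fchart_pt _ _ _ _ _ _ c 0 s => //.
    by lra.
  by have [q [Pq Gq tq]] := Gs x p x1 Pp; exists q; split => //; rewrite tq.
- exact: (fchart_sandwich c Gc Gm).
- move=> p q Pp Pq GG tt; apply: (fchart_inj c) => //.
  case: (ltrgtP (F p) (F q)) => // h.
    by have := Gm _ _ Pp Pq tt h; lra.
  by have := Gm _ _ Pq Pp (esym tt) h; lra.
- exact: (fchart_E c).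
Qed.

End fchart_ops.

(** * Weighted sums and gluing of charts *)

Section weighted_sum.
Implicit Types (u v : nat -> R).

Definition hw (n : nat) : R := 2^-1 ^+ n.

Definition psum u (N : nat) : R := \sum_(n < N) hw n.+1 * u n.

(* The sum of the u n / 2^(n+1), for u bounded by 1, as a supremum of lower bounds: no
   summability is involved. *)
Definition wsum u : R := sup [set psum u N - hw N | N in setT].

Definition bdd1 u : Prop := forall n, -1 <= u n <= 1.

Lemma hw0 n : 0 < hw n.
Proof. by rewrite /hw exprn_gt0// invr_gt0. Qed.

Lemma hwS n : hw n = hw n.+1 + hw n.+1.
Proof. by rewrite /hw exprS; field. Qed.

Lemma hw_small (e : R) : 0 < e -> exists N, hw N < e.
Proof.
move=> e0; have : (fun n => hw n) @ \oo --> (0 : R).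
  by apply: cvg_expr; rewrite ger0_norm ?invr_ge0// invf_lt1// ltr1n.
by move=> /(@cvgr_lt R nat _ _ _ 0) /(_ e e0) [N _ /(_ N (leqnn N))]; exists N.
Qed.

Lemma psumS u N : psum u N.+1 = psum u N + hw N.+1 * u N.
Proof. by rewrite /psum big_ord_recr. Qed.

Lemma psum_incr u N M : bdd1 u -> (N <= M)%N ->
  psum u N - hw N <= psum u M - hw M.
Proof.
move=> ub /subnK <-; elim: (M - N)%N => [|k IH]; first by rewrite add0n.
rewrite addSn psumS; apply: (le_trans IH); rewrite (hwS (k + N)).
by have := ub (k + N)%N; have := hw0 (k + N).+1; nra.
Qed.

Lemma psum_decr u N M : bdd1 u -> (N <= M)%N ->
  psum u M + hw M <= psum u N + hw N.
Proof.
move=> ub /subnK <-; elim: (M - N)%N => [|k IH]; first by rewrite add0n.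
rewrite addSn psumS; apply: le_trans IH; rewrite (hwS (k + N)).
by have := ub (k + N)%N; have := hw0 (k + N).+1; nra.
Qed.

Lemma wsum_near u N : bdd1 u ->
  psum u N - hw N <= wsum u <= psum u N + hw N.
Proof.
move=> ub.
have key M M' : psum u M - hw M <= psum u M' + hw M'.
  have h1 := psum_incr ub (leq_maxl M M'); have h2 := psum_decr ub (leq_maxr M M').
  by have := hw0 (maxn M M'); lra.
apply/andP; split.
  apply: ub_le_sup; last by exists N.
  by exists (psum u 0 + hw 0) => _ [M _ <-]; exact: key.
apply: ge_sup; first by exists (psum u 0 - hw 0); exists 0%N.
by move=> _ [M _ <-]; exact: key.
Qed.

Lemma psum_le u v e N : 0 <= e -> (forall n, (n < N)%N -> u n <= v n + e) ->
  psum u N <= psum v N + e * (1 - hw N).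
Proof.
move=> e0; elim: N => [|N IH] h.
  by rewrite /psum !big_ord0 /hw expr0; lra.
rewrite !psumS; have := IH (fun n nN => h n (ltnW nN)).
have := h N (leqnn _); have := hw0 N.+1; rewrite (hwS N); nra.
Qed.

(** N depends on e only, because the tails are bounded by [hw N] whatever u and v are. This
    uniformity gives the continuity of weighted sums and, later, the surjectivity of blends along
    leaves. *)
Lemma wsum_close (e : R) : 0 < e -> exists N, forall u v, bdd1 u -> bdd1 v ->
  (forall n, (n < N)%N -> u n <= v n + e) -> wsum u <= wsum v + 3 * e.
Proof.
move=> e0; have [N hN] := hw_small e0; exists N => u v ub vb h.
have := wsum_near N ub; have := wsum_near N vb.
have := psum_le (ltW e0) h; have := hw0 N; nra.
Qed.

Lemma wsum_le u v : bdd1 u -> bdd1 v -> (forall n, u n <= v n) -> wsum u <= wsum v.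
Proof.
move=> ub vb h; rewrite leNgt; apply/negP => lt.
have [N H] := @wsum_close ((wsum u - wsum v) / 4) ltac:(lra).
by have := H u v ub vb (fun n _ => ltac:(have := h n; lra)); lra.
Qed.

Lemma wsum_lt u v m : bdd1 u -> bdd1 v -> (forall n, u n <= v n) -> u m < v m ->
  wsum u < wsum v.
Proof.
move=> ub vb h hm.
have d0 : 0 < hw m.+1 * (v m - u m) by rewrite mulr_gt0 ?hw0//; lra.
(* The gain in the m-th term has to exceed the two errors [hw M] made by cutting both sums at M. *)
have [N hN] := @hw_small (hw m.+1 * (v m - u m) / 2) ltac:(lra).
pose M := maxn N m.+1.
have hM : hw M <= hw N.
  by rewrite /hw /M ler_wiXn2l ?leq_maxl// ?invr_ge0// invf_le1// ler1n.
have : psum u M + hw m.+1 * (v m - u m) <= psum v M.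
  rewrite /psum -lerBrDl -sumrB (bigD1 (Ordinal (leq_maxr N m.+1 : (m < M)%N)))//=.
  rewrite mulrBr lerDl sumr_ge0// => i _; rewrite -mulrBr mulr_ge0 ?subr_ge0//.
  exact/ltW/hw0.
by have := wsum_near M ub; have := wsum_near M vb; lra.
Qed.

Lemma wsumN u : bdd1 u -> wsum (fun n => - u n) = - wsum u.
Proof.
move=> ub; have ub' : bdd1 (fun n => - u n) by move=> n; have := ub n; lra.
have E N : psum (fun n => - u n) N = - psum u N.
  by rewrite /psum -sumrN; apply: eq_bigr => i _; rewrite mulrN.
apply/eqP; rewrite eq_le !leNgt; apply/andP; split; apply/negP => h.
  have [N hN] := @hw_small ((wsum (fun n => - u n) + wsum u) / 4) ltac:(lra).
  by have := wsum_near N ub; have := wsum_near N ub'; rewrite E; lra.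
have [N hN] := @hw_small (- (wsum (fun n => - u n) + wsum u) / 4) ltac:(lra).
by have := wsum_near N ub; have := wsum_near N ub'; rewrite E; lra.
Qed.

Lemma wsum1 : wsum (fun=> 1) = 1.
Proof.
have ub : bdd1 (fun=> 1) by move=> n; lra.
have E N : psum (fun=> 1) N = 1 - hw N.
  elim: N => [|N IH]; first by rewrite /psum big_ord0 /hw expr0 subrr.
  by rewrite psumS IH (hwS N); lra.
apply/eqP; rewrite eq_le; apply/andP; split.
  by have := wsum_near 0 ub; rewrite E /hw expr0; lra.
rewrite leNgt; apply/negP => h.
have [N hN] := @hw_small ((1 - wsum (fun=> 1)) / 4) ltac:(lra).
by have := wsum_near N ub; rewrite E; lra.
Qed.

Lemma wsum_lim (I : Type) (G : set_system I) (FG : Filter G)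
    (u : nat -> I -> R) (l : nat -> R) :
  (\forall q \near G, bdd1 (u^~ q)) -> bdd1 l ->
  (forall n, u n @ G --> l n) -> (fun q => wsum (u^~ q)) @ G --> wsum l.
Proof.
move=> ub lb ul; apply: rlim_itv => e e0.
have [N H] := @wsum_close (e / 4) ltac:(lra).
have near_l : \forall q \near G, forall n, (n < N)%N ->
    l n - e / 4 < u n q < l n + e / 4.
  elim: N {H} => [|N IH]; first by near=> q.
  have hN := rlim_near FG (ul N) (e := e / 4) ltac:(lra).
  near=> q => n; rewrite ltnS leq_eqVlt => /orP[/eqP ->|nN].
    by near: q.
  by move: n nN; near: q.
near=> q; have uq : bdd1 (u^~ q) by near: q.
have hq : forall n, (n < N)%N -> l n - e / 4 < u n q < l n + e / 4 by near: q.
have h1 := H _ _ uq lb (fun n nN => ltac:(have := hq n nN; lra)).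
have h2 := H _ _ lb uq (fun n nN => ltac:(have := hq n nN; lra)).
by move: h1 h2; lra.
Unshelve. all: by end_near. Qed.

End weighted_sum.

Lemma le_mul_near1 (c f e : R) : 0 <= c <= 1 -> 1 - e / 2 < f -> 0 < e -> c <= c * f + e.
Proof. by move=> c01 hf e0; nra. Qed.

(** Where c vanishes F may be discontinuous, but the product is squeezed by c since F is bounded by
    1 wherever c is positive. A chart coordinate can thus be used with arbitrary values outside its
    domain. *)
Lemma weighted_cvg (T : topologicalType) (P : set T) (c F : T -> R) p :
  open P -> P p -> (forall q, P q -> 0 <= c q) -> c x @[x --> p] --> c p ->
  (forall q, P q -> 0 < c q -> -1 < F q < 1 /\ F x @[x --> q] --> F q) ->
  c x * F x @[x --> p] --> c p * F p.
Proof.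
move=> oP Pp c_ge0 cp cF; have := c_ge0 p Pp; rewrite le_eqVlt => /orP[/eqP c0|cpos].
  have nP : \forall q \near p, P q by apply: open_nbhs_nbhs.
  apply: rlim_itv => e e0; have := rlim_near (nbhs_filter p) cp e0.
  rewrite -c0 mul0r => nc; near=> q.
  have Pq : P q by near: q.
  have cq : 0 - e < c q < 0 + e by near: q.
  have := c_ge0 q Pq; rewrite le_eqVlt => /orP[/eqP <-|cq0]; first by rewrite mul0r; lra.
  by have [Fq _] := cF q Pq cq0; nra.
by apply: rlimM => //; have [] := cF p Pp cpos.
Unshelve. all: by end_near. Qed.

Section gluing.
Variables (T : topologicalType) (E : T -> T -> Prop).

(** Since J is open, the fibre of F through p contains points on both sides of p; an intermediate
    value taken on the segment between them is attained on the same fibre. *)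
Lemma fchart_open_image P J F t (h : T -> R) p : fchart E P J F t ->
  open J -> is_interval J -> (forall r, P r -> h x @[x --> r] --> h r) ->
  (forall p q, P p -> P q -> (h p = h q <-> t p = t q)) -> P p ->
  exists2 d : R, 0 < d & forall s : R, h p - d < s < h p + d ->
    exists r, [/\ P r, h r = s & F r = F p].
Proof.
move=> c oJ iJ hc hi Pp.
have [e /= e0 He] : nbhs_ball (t p) J.
  by apply/nbhs_ballP; apply: oJ; exact: (fchart_J c).
have Jr : J (t p + e / 2).
  by apply: He; rewrite /ball /= ltr_norml; lra.
have Jl : J (t p - e / 2).
  by apply: He; rewrite /ball /= ltr_norml; lra.
have [pr [Pr Fr tr]] := fchart_at c (fchart_Fb c Pp) Jr.
have [pl [Pl Fl tl]] := fchart_at c (fchart_Fb c Pp) Jl.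
have Fbt x y r : F x = F p -> F y = F p -> btw (F x) (F y) (F r) -> F r = F p.
  by move=> -> ->; rewrite /btw; lra.
have [m|m] := fchart_mono c iJ hc hi.
  have h1 : h pl < h p by apply/m => //; lra.
  have h2 : h p < h pr by apply/m => //; lra.
  have [d [d0 d1 d2]] := @pos_min (h p - h pl) (h pr - h p) ltac:(lra) ltac:(lra).
  exists d => // s hs.
  have [|r [? ? fr _]] := @fchart_ivt _ _ _ _ _ _ c iJ h s pl pr hc Pl Pr.
    by lra.
  by exists r; split => //; exact: Fbt fr.
have h1 : h p < h pl by apply/m => //; lra.
have h2 : h pr < h p by apply/m => //; lra.
have [d [d0 d1 d2]] := @pos_min (h p - h pr) (h pl - h p) ltac:(lra) ltac:(lra).
exists d => // s hs.
have [|r [? ? fr _]] := @fchart_ivt _ _ _ _ _ _ c iJ h s pr pl hc Pr Pl.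
  by lra.
by exists r; split => //; exact: Fbt fr.
Qed.

(* The weights c n are constant along leaves, so a blend of leaf coordinates with the
   same orientation is again increasing along leaves. *)
Definition blend (c F : nat -> T -> R) (q : T) : R :=
  wsum (fun n => c n q * F n q) / wsum (c^~ q).

Section blend_facts.
Variables (P : set T) (t : T -> R) (c F : nat -> T -> R).
Hypothesis oP : open P.
Hypothesis ct : forall p, P p -> t x @[x --> p] --> t p.
Hypothesis Et : forall p q, P p -> (E p q <-> P q /\ t q = t p).
Hypothesis cb : forall n p, P p -> 0 <= c n p <= 1.
Hypothesis cE : forall n p q, P p -> E p q -> c n p = c n q.
Hypothesis c_c : forall n p, P p -> c n x @[x --> p] --> c n p.
Hypothesis cF_c : forall n p, P p -> c n x * F n x @[x --> p] --> c n p * F n p.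
Hypothesis c_pos : forall p, P p -> exists n, 0 < c n p.
Hypothesis charts : forall n p, P p -> 0 < c n p ->
  exists U J' t', fchart E U J' (F n) t' /\ U p.
Hypothesis ori : forall n m p q, P p -> E p q -> 0 < c n p -> 0 < c m p ->
  F n p < F n q -> F m p < F m q.

Let Erefl p : P p -> E p p. Proof. by move=> Pp; apply/Et. Qed.

Let bd_c p : P p -> bdd1 (c^~ p).
Proof. by move=> Pp n; have := cb n Pp; lra. Qed.

Let F_bd n p : P p -> 0 < c n p -> -1 < F n p < 1.
Proof. by move=> Pp /(charts Pp) [U [J' [t' [k Up]]]]; exact: (fchart_Fb k). Qed.

Let cF_bd n p : P p -> - c n p <= c n p * F n p <= c n p.
Proof.
move=> Pp; have := cb n Pp; have [->|] := eqVneq (c n p) 0; first by lra.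
move=> cn0 /andP[cn1 cn2]; have cn : 0 < c n p by rewrite lt_neqAle eq_sym cn0.
by have := F_bd Pp cn; nra.
Qed.

Let bd_cF p : P p -> bdd1 (fun n => c n p * F n p).
Proof. by move=> Pp n; have := cb n Pp; have := cF_bd n Pp; lra. Qed.

Let W_pos p : P p -> 0 < wsum (c^~ p).
Proof.
move=> Pp; have [n cn] := c_pos Pp; have b := bd_c Pp.
have b' : bdd1 (fun n => - c n p) by move=> m; have := b m; lra.
have : wsum (fun n => - c n p) < wsum (c^~ p).
  by apply: (@wsum_lt _ _ n) => // [m|]; [have := cb m Pp; lra | lra].
by rewrite wsumN//; lra.
Qed.

Let V_bd p : P p -> - wsum (c^~ p) < wsum (fun n => c n p * F n p) < wsum (c^~ p).
Proof.
move=> Pp; have [n cn] := c_pos Pp; have b := bd_c Pp.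
have b' : bdd1 (fun n => - c n p) by move=> m; have := b m; lra.
have := F_bd Pp cn; have := bd_cF Pp => bcF Fn; rewrite -wsumN//.
apply/andP; split.
  by apply: (@wsum_lt _ _ n) => // [m|]; [have := cF_bd m Pp; lra | nra].
by apply: (@wsum_lt _ _ n) => // [m|]; [have := cF_bd m Pp; lra | nra].
Qed.

Let P_E p q : P p -> E p q -> P q. Proof. by move=> Pp /(Et q Pp) []. Qed.

Let c_E p q : P p -> E p q -> c^~ p = c^~ q.
Proof. by move=> Pp Epq; apply: funext => n; exact: cE. Qed.

Lemma blend_cvg p : P p -> blend c F x @[x --> p] --> blend c F p.
Proof.
move=> Pp; have nP : \forall q \near p, P q by exact: (open_nbhs_nbhs (conj oP Pp)).
apply: rlimM; first by apply: wsum_lim => //; [near=> q; apply: bd_cF; near: q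
  | exact: bd_cF | move=> n; exact: cF_c].
apply: rlimV; first by have := W_pos Pp; rewrite lt_def => /andP[].
by apply: wsum_lim => //; [near=> q; apply: bd_c; near: q
  | exact: bd_c | move=> n; exact: c_c].
Unshelve. all: by end_near. Qed.

Lemma blend_bd p : P p -> -1 < blend c F p < 1.
Proof.
move=> Pp; have := V_bd Pp; have := W_pos Pp; rewrite /blend => W0 VW.
by rewrite ltr_pdivlMr// ltr_pdivrMr//; lra.
Qed.

Lemma blend_lt n p q : P p -> E p q -> 0 < c n p -> F n p < F n q ->
  blend c F p < blend c F q.
Proof.
move=> Pp Epq cn Fpq; have Pq := P_E Pp Epq.
rewrite /blend (c_E Pp Epq) ltr_pM2r ?invr_gt0 ?W_pos//.
apply: (@wsum_lt _ _ n); [exact: bd_cF | exact: bd_cF | move=> m |].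
  have := cb m Pp; rewrite -(cE m Pp Epq); have [->|cm0] := eqVneq (c m p) 0.
    by rewrite !mul0r.
  move=> /andP[cm1 _]; have cm : 0 < c m p by rewrite lt_neqAle eq_sym cm0.
  by rewrite ler_pM2l// ltW//; exact: (ori Pp Epq cn).
by rewrite -(cE n Pp Epq) ltr_pM2l.
Qed.

Tactic Notation "lra" "from" hyp_list(hs) :=
  clear - hs oP ct Et cb cE c_c cF_c c_pos charts ori Erefl bd_c F_bd cF_bd bd_cF W_pos V_bd P_E c_E; lra.

(** On a single leaf all coordinates of positive weight are increasing bijections onto (-1, 1) with
    the same orientation, so they tend to 1 simultaneously and their average does too. *)
Lemma blend_top p (x : R) : P p -> x < 1 -> exists q, E p q /\ x < blend c F q.
Proof.
move=> Pp x1; have W0 := W_pos Pp; have [n cn] := c_pos Pp.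
have [U [J' [t' [k Up]]]] := charts Pp cn.
(* The error 3e of [wsum_close] must stay below (1 - x) times the total weight; e <= 1 makes 1 - e /
   2 an admissible coordinate. *)
have [e [e0 e1 e2]] := @pos_min ((1 - x) * wsum (c^~ p) / 4) 1
  ltac:(by rewrite divr_gt0// mulr_gt0//; lra) ltac:(lra).
have [N HN] := wsum_close e0.
(* A threshold for the single coordinate [F n] serves the first N charts: the point r where the N-th
   coordinate equals 1 - e / 2 is read off in [F n], and [ori] transports the inequality beyond
   r. *)
have [y [y1 y2 Hy]] : exists y : R, [/\ -1 < y, y < 1 & forall m, (m < N)%N ->
    forall q, E p q -> y < F n q -> c m p <= c m p * F m q + e].
  elim: N {HN} => [|N [y [y1 y2 IH]]]; first by exists 0; split=> //; lra.
  have [c0|c0] := eqVneq (c N p) 0.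
    exists y; split => // m; rewrite ltnS leq_eqVlt => /orP[/eqP -> q _ _|mN]; last exact: IH.
    by rewrite c0; lra.
  have cN : 0 < c N p by rewrite lt_neqAle eq_sym c0; have := cb N Pp; lra.
  have [U1 [J1 [t1 [k1 U1p]]]] := charts Pp cN.
  have [r [U1r Fr tr]] := fchart_at k1 (x := 1 - e / 2) ltac:(lra) (fchart_J k1 U1p).
  have Epr : E p r by apply/(fchart_leaf k1 U1p U1r).
  have Er q : E p q -> E r q.
    move=> Epq; have U1q := fchart_sat k1 U1p Epq.
    by apply/(fchart_leaf k1 U1r U1q); rewrite tr; apply/(fchart_leaf k1 U1p U1q).
  have Pr := P_E Pp Epr.
  have Ur := fchart_sat k Up Epr.
  have Fnr := fchart_Fb k Ur.
  have [z [z1 z2 z3]] := @lt_between y (F n r) 1 ltac:(lra from y2) ltac:(lra from Fnr).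
  exists z; split => [||m] //; first by lra.
  rewrite ltnS leq_eqVlt => /orP[/eqP -> q Epq Fq|mN q Epq Fq]; last by apply: IH => //; lra from z1 Fq.
  have := @ori n N r q Pr (Er q Epq).
  rewrite -(cE n Pp Epr) -(cE N Pp Epr) => /(_ cn cN ltac:(lra from z2 Fq)); rewrite Fr => FN.
  exact: le_mul_near1 (cb N Pp) FN e0.
have [z [z1 z2 z3]] := @lt_between y y 1 ltac:(lra from y2) ltac:(lra from y2).
have [q [Uq Fq tq]] := fchart_at k (x := z) ltac:(lra from y1 z2 z3) (fchart_J k Up).
have Epq : E p q by apply/(fchart_leaf k Up Uq).
have Pq := P_E Pp Epq.
exists q; split => //; rewrite /blend ltr_pdivlMr ?W_pos//.
have := HN (c^~ p) (fun m => c m q * F m q) (bd_c Pp) (bd_cF Pq).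
move=> /(_ (fun m mN => ltac:(rewrite -(cE m Pp Epq); apply: Hy => //; lra from z2 Fq))).
rewrite (c_E Pp Epq) in e1 W0 *; move: e1 W0; set w := wsum _ => e1 W0; nra.
Qed.

End blend_facts.

(** Each chart may have its own transverse coordinate t'; only t, which separates the leaves of P,
    is common. Surjectivity along a leaf follows from [blend_top] at both ends and the intermediate
    value theorem, and the inverse is controlled by [fchart_sandwich] in any chart of positive
    weight at the point. *)
Lemma fchart_glue (P : set T) (t : T -> R) (c F : nat -> T -> R) :
  open P -> (forall p, P p -> t x @[x --> p] --> t p) ->
  (forall p q, P p -> (E p q <-> P q /\ t q = t p)) ->
  (forall n p, P p -> 0 <= c n p <= 1) ->
  (forall n p q, P p -> E p q -> c n p = c n q) ->
  (forall n p, P p -> c n x @[x --> p] --> c n p) ->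
  (forall p, P p -> exists n, 0 < c n p) ->
  (forall n p, P p -> 0 < c n p -> exists U J' t',
    [/\ fchart E U J' (F n) t', open J', is_interval J', U p & U `<=` P]) ->
  (forall n m p q, P p -> E p q -> 0 < c n p -> 0 < c m p ->
    F n p < F n q -> F m p < F m q) ->
  fchart E P (t @` P) (blend c F) t.
Proof.
move=> oP ct Et cb cE c_c c_pos charts ori.
have cF_c n p : P p -> c n x * F n x @[x --> p] --> c n p * F n p.
  move=> Pp; apply: (weighted_cvg oP) => // [q /(cb n) /andP[]|| q Pq cq] //; first exact: c_c.
  have [U [J' [t' [k _ _ Uq _]]]] := charts _ _ Pq cq.
  by split; [exact: (fchart_Fb k) | exact: (fchart_F k)].
have charts' n p : P p -> 0 < c n p -> exists U J' t', fchart E U J' (F n) t' /\ U p.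
  by move=> Pp cn; have [U [J' [t' [k _ _ Up _]]]] := charts _ _ Pp cn; exists U, J', t'.
have PE p q : P p -> E p q -> P q by move=> Pp /(Et _ _ Pp) [].
have Esym p q : P p -> E p q -> E q p.
  by move=> Pp /(Et _ _ Pp) [Pq tq]; apply/(Et _ _ Pq).
(* The lower end of a leaf is the upper end for the reversed coordinates. *)
have bE (q : T) : P q -> blend c (fun n x => - F n x) q = - blend c F q.
  move=> Pq; rewrite /blend -mulNr; congr (_ / _).
  have -> : (fun n => c n q * - F n q) = (fun n => - (c n q * F n q)).
    by apply: funext => n; rewrite mulrN.
  apply: wsumN => n; have := cb n q Pq; have [->|c0] := eqVneq (c n q) 0; first by lra.
  move=> cn; have cn' : 0 < c n q by rewrite lt_neqAle eq_sym c0; lra.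
  by have [U [J' [t' [k _ _ Up _]]]] := charts _ _ Pq cn'; have := fchart_Fb k Up; nra.
have botc (p : T) (x : R) : P p -> -1 < x -> exists q, E p q /\ blend c F q < x.
  move=> Pp x1.
  have [|||q [Epq hq]] := @blend_top P t c (fun n x => - F n x) Et cb cE c_pos _ _ p (- x) Pp.
  - move=> n r Pr cr; have [U [J' [t' [k oJ iJ Up sU]]]] := charts _ _ Pr cr.
    by exists U, J', t'; split => //; exact: fchart_flipF.
  - move=> n m r s Pr Ers cn cm; rewrite !ltrN2.
    by apply: ori; [exact: PE Ers | exact: Esym | rewrite -(cE _ _ _ Pr Ers) ..].
  - by lra.
  by exists q; split => //; move: hq; rewrite bE ?ltrN2//; exact: PE Epq.
split => //.
- by move=> p; apply: blend_cvg.
- by move=> p; apply: blend_bd.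
- move=> x _ x1 [p Pp <-].
  have [q1 [E1 h1]] := botc p x Pp ltac:(lra).
  have [q2 [E2 h2]] := @blend_top P t c F Et cb cE c_pos charts' ori p x Pp ltac:(lra).
  have [n cn] := c_pos _ Pp; have [U [J' [t' [k oJ iJ Up sU]]]] := charts _ _ Pp cn.
  have U1 := fchart_sat k Up E1; have U2 := fchart_sat k Up E2.
  have gc r : U r -> blend c F x @[x --> r] --> blend c F r.
    by move=> /sU; exact: blend_cvg.
  have [|r [Ur hr _ tr]] := @fchart_ivt _ _ _ _ _ _ k iJ (blend c F) x q1 q2 gc U1 U2.
    by lra.
  exists r; split => //; first exact: sU.
  have e1 := iffLR (fchart_leaf k Up U1) E1; have e2 := iffLR (fchart_leaf k Up U2) E2.
  have : E p r by apply/(fchart_leaf k Up Ur); move: tr; rewrite -e1 -e2 /btw; lra.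
  by move/(Et _ _ Pp) => [].
- move=> p N Pp nN.
  have [n cn] := c_pos _ Pp; have [U [J' [t' [k oJ iJ Up sU]]]] := charts _ _ Pp cn.
  have ct' r : U r -> t x @[x --> r] --> t r by move=> /sU; exact: ct.
  have ti r s : U r -> U s -> (t r = t s <-> t' r = t' s).
    move=> Ur Us; rewrite -(fchart_leaf k Ur Us) (Et _ _ (sU _ Ur)).
    by split=> [->|[]//]; split => //; exact: sU.
  have gc r : U r -> blend c F x @[x --> r] --> blend c F r.
    by move=> /sU; exact: blend_cvg.
  have k' := fchart_reparam k iJ ct' ti.
  have [d1 d10 H1] := fchart_open_image k oJ iJ ct' ti Up.
  (* weight positivity is only known on the leaf of p, so shrink to where c n > 0 *)
  have ncn : \forall q \near p, 0 < c n q by apply: (cvgr_gt (c n p)) => //; exact: c_c.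
  have [V [oV Vp VU Vc Vs]] : exists V : set T, [/\ open V, V p, V `<=` U,
      forall q, V q -> 0 < c n q & forall q r, V q -> U r -> t r = t q -> V r].
    exists (U `&` [set q | 0 < c n q]); split => //.
    - rewrite openE => q [Uq cq]; rewrite /interior.
      have nU : nbhs q U by apply: (fchart_nbhs k).
      apply: filterI => //.
      by apply: (cvgr_gt (c n q)) => //; apply: c_c; exact: sU.
    - by move=> q [].
    - move=> q r [Uq cq] Ur tr; split => //=; rewrite -(cE n q r)//; first exact: sU.
      by apply/Et; [exact: sU | split => //; exact: sU].
  have k2 := fchart_restr k' oV VU (fun q r Vq Ur e => Vs q r Vq Ur e).
  have gm q r : V q -> V r -> t q = t r -> F n q < F n r -> blend c F q < blend c F r.
    move=> Vq Vr tqr; apply: (blend_lt Et cb cE c_pos charts' ori (sU _ (VU _ Vq))) => //.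
      by apply/Et; [exact/sU/VU | split => //; exact/sU/VU].
    exact: Vc.
  have [d d0 H] := fchart_sandwich k2 (fun r Vr => gc r (VU r Vr)) gm Vp nN.
  have [e [e0 e1 e2]] := pos_min d0 d10.
  have nV : nbhs p V by apply: open_nbhs_nbhs.
  have [d3 d30 H3] := fchart_inv k' Up nV.
  have [e' [e'0 e3 e4]] := pos_min e0 d30.
  exists e' => // q Pq hq htq.
  (* It is not known that q lies in U. A point r of U with t r = t q is produced instead; then q is
     on the leaf of r, and U is saturated. *)
  have [r [Ur tr Fr]] := H1 (t q) ltac:(clear -htq e2 e4 e3; lra).
  have Vr : V r by apply: H3 => //; [rewrite Fr; lra from e4 htq | rewrite tr; clear -htq e4; lra from e4 htq].
  have Erq : E r q by apply/Et; [exact: sU | split].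
  have Uq := fchart_sat k Ur Erq.
  have Vq : V q by apply: (Vs r).
  by apply: H => //; [clear -hq e1 e3; lra | clear -htq e1 e3; lra].
- move=> p q Pp Pq gpq tpq.
  have Epq : E p q by apply/Et.
  have [n cn] := c_pos _ Pp; have [U [J' [t' [k oJ iJ Up sU]]]] := charts _ _ Pp cn.
  have Uq := fchart_sat k Up Epq.
  apply: (fchart_inj k) => //; last by apply/(fchart_leaf k Up Uq).
  have L a b := @blend_lt P t c F Et cb cE c_pos charts' ori n a b.
  case: (ltrgtP (F n p) (F n q)) => // h.
    by have := L p q Pp Epq cn h; rewrite gpq ltxx.
  have := L q p Pq (Esym _ _ Pp Epq); rewrite -(cE _ _ _ Pp Epq) => /(_ cn h).
  by rewrite gpq ltxx.
Qed.

End gluing.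

(** * Intervals, real induction, and restriction, rescaling and orientation of charts *)

Definition Iab (a b : R) : set R := [set s | a < s < b].

Lemma Iab_interval a b : is_interval (Iab a b).
Proof. by move=> x y; rewrite /Iab /= => hx hy z hz; lra. Qed.

Lemma Iab_open a b : open (Iab a b).
Proof.
rewrite (_ : Iab a b = `]a, b[%classic); first exact: interval_open.
by apply/seteqP; split => x; rewrite /Iab /= in_itv.
Qed.

Lemma open_interval_Iab (I : set R) (l u : R) : I !=set0 -> open I -> is_interval I ->
  (forall s, I s -> l <= s <= u) -> exists a b : R, a < b /\ I = Iab a b.
Proof.
move=> [x Ix] oI iI lu.
have hs : has_sup I by split; [exists x | exists u => s /lu /andP[]].
have hi : has_inf I by split; [exists x | exists l => s /lu /andP[]].
have nb s : I s -> exists e : R, 0 < e /\ forall r, s - e < r < s + e -> I r.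
  move=> Is; have [e /= e0 He] : nbhs_ball s I by apply/nbhs_ballP; exact: oI.
  by exists e; split => // r hr; apply: He; rewrite /ball /= ltr_norml; lra.
have lt_s s : I s -> inf I < s < sup I.
  move=> Is; have [e [e0 He]] := nb s Is.
  have Ip : I (s + e / 2) by apply: He; lra.
  have Im : I (s - e / 2) by apply: He; lra.
  have := ub_le_sup hs.2 Ip; have := ge_inf hi.2 Im; lra.
exists (inf I), (sup I); split; first by have := lt_s x Ix; lra.
apply/seteqP; split => s; first by move=> /lt_s.
rewrite /Iab /= => /andP[h1 h2].
have [a Ia ha] : exists2 a, I a & a < inf I + (s - inf I).
  by apply: inf_adherent => //; rewrite subr_gt0.
have [b Ib hb] : exists2 b, I b & sup I - (sup I - s) < b.
  by apply: sup_adherent => //; rewrite subr_gt0.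
by apply: (iI _ _ Ia Ib); lra.
Qed.

Lemma first_exit (S : R -> Prop) (a b : R) : a < b -> S a -> ~ S b ->
  (forall s, S s -> exists e : R, 0 < e /\ forall r : R, s - e < r < s + e -> S r) ->
  exists s : R, [/\ a < s <= b, ~ S s & forall r : R, a <= r < s -> S r].
Proof.
move=> ab Sa Sb oS.
pose A := [set s : R | a <= s <= b /\ forall r, a <= r <= s -> S r].
have Aa : A a by split=> [|r ra]; [lra | have -> : r = a by lra].
have hs : has_sup A by split; [exists a | exists b => s [/andP[]]].
have le_s : sup A <= b by apply: ge_sup; [exists a | move=> s [/andP[]]].
have below r : a <= r < sup A -> S r.
  move=> /andP[h1 h2].
  have [s [s1 s2] h] : exists2 s, A s & sup A - (sup A - r) < s.
    by apply: sup_adherent => //; rewrite subr_gt0.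
  by apply: s2; lra.
have aS : a < sup A.
  have [e [e0 He]] := oS a Sa.
  have [d [d0 d1 d2]] := @pos_min (e / 2) (b - a) ltac:(lra) ltac:(lra).
  have : A (a + d) by split=> [|r hr]; [lra | apply: He; lra].
  by move/(ub_le_sup hs.2); lra.
exists (sup A); split => //; first by lra.
move=> SA; have [e [e0 He]] := oS _ SA.
have [bA|bA] := eqVneq (sup A) b; first by apply: Sb; rewrite -bA.
have {}bA : sup A < b by rewrite lt_neqAle bA.
have [d [d0 d1 d2]] := @pos_min (e / 2) (b - sup A) ltac:(lra) ltac:(lra).
have : A (sup A + d).
  split=> [|r hr]; first by lra.
  have [h|h] := ltP r (sup A); first by apply: below; lra.
  by apply: He; lra.
by move/(ub_le_sup hs.2); lra.
Qed.

(** As S is closed downwards, the last hypothesis makes it open, so there is a first level at which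
    it fails; the limit step applies there. *)
Lemma real_ind (S : R -> Prop) (a b : R) :
  (exists s : R, a < s < b /\ S s) ->
  (forall s s' : R, a < s' < s -> S s -> S s') ->
  (forall s : R, a < s < b -> (forall s' : R, a < s' < s -> S s') -> S s) ->
  (forall s : R, a < s < b -> S s -> exists s' : R, s < s' /\ S s') ->
  forall s : R, a < s < b -> S s.
Proof.
move=> [s0 [s0ab S0]] dn lim step s sab; apply: contrapT => nS.
have s0s : s0 < s.
  rewrite ltNge; apply/negP; rewrite le_eqVlt => /orP[/eqP e|h]; first by apply: nS; rewrite e.
  by apply: nS; apply: (dn s0) => //; lra.
pose S' r := (a < r < b) /\ S r.
have [|||r [rs nr below]] := @first_exit S' s0 s s0s.
- by split.
- by case.
- move=> r [rab Sr]; have [r' [rr' Sr']] := step r rab Sr.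
  have [e [e0 e1 e2]] := @pos_min (r' - r) (r - a) ltac:(lra) ltac:(lra).
  have [d [d0 d1 d2]] := @pos_min e (b - r) ltac:(lra) ltac:(lra).
  by exists d; split => // x hx; split; [lra from e2 d1 d2 hx | apply: (dn r') => //; lra from e1 e2 d1 hx].
apply: nr; split; first by lra.
apply: lim; first by lra.
move=> r' hr'; have [h|h] := ltP r' s0; first by apply: (dn s0) => //; lra from hr' h.
by have [] := below r' ltac:(lra).
Qed.

Section fchart_more.
Variables (T : topologicalType) (E : T -> T -> Prop).

Lemma fchart_slab P J (a b : R) F t :
  fchart E P J F t -> open (P `&` [set x | a < t x < b]).
Proof.
move=> c; rewrite openE => x [Px /= /andP[h1 h2]]; rewrite /interior.
have nP : nbhs x P by apply: (fchart_nbhs c).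
have n1 : \forall y \near x, a < t y by apply: (cvgr_gt (t x)) => //; exact: (fchart_t c).
have n2 : \forall y \near x, t y < b by apply: (cvgr_lt (t x)) => //; exact: (fchart_t c).
near=> y; split; first by near: y.
by apply/andP; split; near: y.
Unshelve. all: by end_near. Qed.

Lemma fchart_strip P J (a b : R) F t :
  fchart E P J F t -> (forall s, a < s < b -> J s) ->
  fchart E (P `&` [set x | a < t x < b]) (Iab a b) F t.
Proof.
move=> c JJ; have oP' := fchart_slab a b c; set P' := P `&` _ in oP' *.
have -> : Iab a b = t @` P'.
  apply/seteqP; split=> [s hs|_ [x [Px hx] <-]]; last exact: hx.
  have [|p [Pp _ tp]] := fchart_at c (x := 0) _ (JJ s hs); first by lra.
  by exists p => //; split => //=; rewrite tp.
by apply: (fchart_restr c) => // [x []|x y [Px h] Py /= txy] //; split => //=; rewrite txy.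
Qed.

Lemma fchart_sub P (a b a' b' : R) F t : fchart E P (Iab a b) F t -> a <= a' -> b' <= b ->
  fchart E (P `&` [set x | a' < t x < b']) (Iab a' b') F t.
Proof. by move=> c aa bb; apply: (fchart_strip c) => s; rewrite /Iab /=; lra. Qed.

Lemma fchart_opp P J F t :
  fchart E P J F t -> fchart E P [set s | J (- s)] F (fun x => - t x).
Proof.
move=> c; split.
- exact: fchart_open c.
- exact: fchart_F c.
- by move=> x Px; apply: rlimN; exact: (fchart_t c).
- exact: fchart_Fb c.
- by move=> x Px /=; rewrite opprK; exact: (fchart_J c).
- move=> x s x1 Js; have [p [Pp Fp tp]] := fchart_at c x1 Js.
  by exists p; split => //; rewrite tp opprK.
- move=> x N Px nN; have [d d0 H] := fchart_inv c Px nN; exists d => // y Py h1 h2.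
  by apply: H => //; lra.
- by move=> x y Px Py Fxy /oppr_inj; exact: (fchart_inj c).
- move=> x y Px; rewrite (fchart_E c y Px).
  by split=> -[Py h]; split => //; [rewrite h | exact: oppr_inj].
Qed.

Lemma fchart_neg P (a b : R) F t :
  fchart E P (Iab a b) F t -> fchart E P (Iab (- b) (- a)) F (fun x => - t x).
Proof.
have -> : Iab (- b) (- a) = [set s | Iab a b (- s)].
  by apply/seteqP; split=> s; rewrite /Iab /=; lra.
exact: fchart_opp.
Qed.

Lemma fchart_affine P (a b : R) F t : a < b -> fchart E P (Iab a b) F t ->
  fchart E P (Iab 0 1) F (fun x => (t x - a) / (b - a)).
Proof.
move=> ab c; set h := fun x => _.
have ba : b - a != 0 by rewrite subr_eq0; lra.
have ba0 : 0 < b - a by lra.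
have -> : Iab 0 1 = h @` P.
  apply/seteqP; split => [s hs|_ [x Px <-]].
    have [||p [Pp _ tp]] := @fchart_at _ _ _ _ _ _ 0 (a + s * (b - a)) c; first by lra.
      by move: hs; rewrite /Iab /=; nra.
    by exists p => //; rewrite /h tp addrC addrA addNr add0r mulfK.
  have := fchart_J c Px; rewrite /Iab /= /h => /andP[h1 h2].
  by rewrite divr_gt0 ?ltr_pdivrMr//; lra.
apply: (fchart_reparam c); first exact: Iab_interval.
  move=> x Px; apply: rlimM; last exact: rlim_cst.
  by apply: rlimB; [exact: (fchart_t c) | exact: rlim_cst].
move=> x y Px Py; rewrite /h; split => [|->//].
by move/(mulIf (invr_neq0 ba)) => e; lra.
Qed.

Lemma fchart_conn P J F t : fchart E P J F t -> is_interval J -> connected P.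
Proof.
move=> c iJ; have [[p Pp]|P0] := pselect (exists p, P p); last first.
  rewrite (_ : P = set0); first exact: connected0.
  by apply/seteqP; split => x // Px; apply: P0; exists x.
have H q : exists C : set T, P q -> [/\ connected C, C p, C q & C `<=` P].
  have [Pq|nPq] := pselect (P q); last by exists set0 => /nPq.
  have [C [C1 C2 C3 C4]] := fchart_connected c iJ Pp Pq.
  by exists C => _; split => // r /C4 [].
have [C HC] := choice H.
rewrite (_ : P = \bigcup_(q in P) C q).
  by apply: bigcup_connected => [|q /HC[]//]; exists p => q /HC[].
by apply/seteqP; split=> [q Pq|q [r Pr]]; [exists q => //; have [] := HC q Pq
  | have [_ _ _] := HC r Pr; apply].
Qed.

(** D measures F2 between the curves F1 = -1/2 and F1 = 1/2. It never vanishes over the connected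
    J1, so its sign is constant; since F2 is monotone in F1 on each leaf, this sign decides the
    orientation on all leaves at once. *)
Lemma fchart_orient P1 J1 F1 t1 P2 J2 F2 t2 : fchart E P1 J1 F1 t1 -> is_interval J1 ->
  fchart E P2 J2 F2 t2 -> P1 `<=` P2 ->
  (forall x y, P1 x -> E x y -> (F1 x < F1 y <-> F2 x < F2 y)) \/
  (forall x y, P1 x -> E x y -> (F1 x < F1 y <-> F2 y < F2 x)).
Proof.
move=> c1 i1 c2 s12.
have [[p Pp]|P0] := pselect (exists p, P1 p); last first.
  by left => p ? Pp; exfalso; apply: P0; exists p.
have c0 x : {within J1, continuous (fun _ : R => x : R)}.
  by apply: continuous_subspaceT => s; exact: cvg_cst.
have cid : {within J1, continuous (fun s : R => s : R)}.
  by apply: continuous_subspaceT => s; exact: cvg_id.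
have [|al [alc alP]] := fchart_section c1 Pp (c0 (-1/2)) cid.
  by move=> s Js; split => //; lra.
have [|be [bec beP]] := fchart_section c1 Pp (c0 (1/2)) cid.
  by move=> s Js; split => //; lra.
have leafE x y : P1 x -> E x y -> P1 y /\ t1 y = t1 x by move=> Px /(fchart_E c1 _ Px).
have same s : J1 s -> E (al s) (be s).
  move=> Js; have [P1a _ ta] := alP s Js; have [P1b _ tb] := beP s Js.
  by apply/(fchart_leaf c1 P1a P1b); rewrite ta tb.
pose D s := F2 (be s) - F2 (al s).
have Dc : {within J1, continuous D}.
  apply/subspace_continuousP => s Js; have [P1a _ _] := alP s Js.
  have [P1b _ _] := beP s Js; apply: rlimB.
    apply: (@cvg_comp _ _ _ be F2 _ (nbhs (be s))); last exact/(fchart_F c2)/s12.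
    by move/subspace_continuousP: bec; apply.
  apply: (@cvg_comp _ _ _ al F2 _ (nbhs (al s))); last exact/(fchart_F c2)/s12.
  by move/subspace_continuousP: alc; apply.
have Dn s : J1 s -> D s != 0.
  move=> Js; rewrite subr_eq0; apply/eqP => e.
  have [P1a Fa ta] := alP s Js; have [P1b Fb tb] := beP s Js.
  have e' : be s = al s.
    apply: (fchart_inj c2) => //; [exact: s12 | exact: s12 |].
    by apply/esym/(fchart_leaf c2 (s12 _ P1a) (s12 _ P1b)); exact: same.
  by move: Fa; rewrite -e' Fb; lra.
have Di : is_interval (D @` J1).
  apply/connected_intervalP; apply: connected_continuous_connected => //.
  exact/connected_intervalP.
have sgn : (forall s, J1 s -> 0 < D s) \/ (forall s, J1 s -> D s < 0).
  have [[s [Js Ds]]|no] := pselect (exists s, J1 s /\ D s < 0); last first.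
    left => s Js; have := Dn s Js; case: (ltrgtP (D s) 0) => // h _.
    by exfalso; apply: no; exists s.
  right => r Jr; rewrite ltNge le_eqVlt eq_sym (negbTE (Dn r Jr)) /=; apply/negP => Dr.
  have [|x Jx] := Di (D s) (D r) ltac:(by exists s) ltac:(by exists r) 0.
    by rewrite !ltW.
  by apply/eqP; exact: Dn.
have leaf x : P1 x -> (forall y z, P1 y -> P1 z -> t1 y = t1 x -> t1 z = t1 x ->
      (F2 y < F2 z <-> F1 y < F1 z)) \/
    (forall y z, P1 y -> P1 z -> t1 y = t1 x -> t1 z = t1 x ->
      (F2 y < F2 z <-> F1 z < F1 y)).
  move=> Px; apply: (fchart_mono_leaf c1 Px).
    by move=> r /s12; exact: (fchart_F c2).
  move=> y z Py Pz ty tz e; have Eyz : E y z by apply/(fchart_leaf c1 Py Pz); rewrite ty.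
  congr F1; apply: (fchart_inj c2) => //; [exact: s12 | exact: s12 |].
  by apply/(fchart_leaf c2 (s12 _ Py) (s12 _ Pz)).
case: sgn => sgn; [left|right] => x y Px Exy; have [Py txy] := leafE x y Px Exy;
  have Jx := fchart_J c1 Px; have [P1a Fa ta] := alP _ Jx; have [P1b Fb tb] := beP _ Jx;
  have := sgn _ Jx; rewrite /D => sD; have [m|m] := leaf x Px.
- by split => /(m x y Px Py erefl txy).
- by have := m (be (t1 x)) (al (t1 x)) P1b P1a tb ta; rewrite Fa Fb; lra.
- by have := m (al (t1 x)) (be (t1 x)) P1a P1b ta tb; rewrite Fa Fb; lra.
- by split => /(m y x Py Px txy erefl).
Qed.

End fchart_more.

(** Lindelöf's argument: for each basic open set choose an index i such that [S i] contains its
    trace on A, if there is one. The sequence is indexed by an injective numbering of the basis,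
    with i0 as default. The relative form is needed for charts that are open only in a closure. *)
Lemma second_countable_cover (T : topologicalType) (A : set T) (I : Type) (S : I -> set T)
    (ok : I -> Prop) (i0 : I) : @second_countable T -> ok i0 ->
  (forall i x, ok i -> S i x -> \forall y \near x, A y -> S i y) ->
  exists f : nat -> I, (forall n, ok (f n)) /\
    forall i x, ok i -> A x -> S i x -> exists n, S (f n) x.
Proof.
move=> [B cB [oB bB]] ok0 nS.
pose good (U : set T) i := ok i /\ U `&` A `<=` S i.
have [g gP] : exists g : set T -> nat, forall U V, B U -> B V -> g U = g V -> U = V.
  by have /countable_injP[h hi] := cB; exists h => U V BU BV; apply: hi; exact: mem_set.
have ex n : exists i, ok i /\ forall U j, B U -> g U = n -> good U j -> U `&` A `<=` S i.
  have [[U [i [BU gU gd]]]|no] := pselect (exists U i, [/\ B U, g U = n & good U i]).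
    exists i; split; first exact: gd.1.
    by move=> V j BV gV _; rewrite (gP V U) ?gU//; exact: gd.2.
  by exists i0; split => // U i BU gU gd; exfalso; apply: no; exists U, i.
have [f fP] := choice ex; exists f; split=> [n|i x oki Ax Sx]; first exact: (fP n).1.
have [U [BU Ux] UP] := bB x _ (nS i x oki Sx).
have gd : good U i by split => // y [/UP h /h].
by exists (g U); exact: ((fP (g U)).2 U i BU erefl gd x (conj Ux Ax)).
Qed.

(** * Rays issued from a leaf *)

(** All that the proof of (1) uses of a component: E is the relation of lying on the same leaf, and
    [rg_sep] expresses that different leaves of Q are separated. *)
Record regular (T : topologicalType) (E : T -> T -> Prop) (Q : set T) : Prop := Regular {
  rg_refl : forall x, E x x;
  rg_sym : forall x y, E x y -> E y x;
  rg_trans : forall x y z, E x y -> E y z -> E x z;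
  rg_open : open Q;
  rg_sat : forall x y, Q x -> E x y -> Q y;
  rg_chart : forall p, Q p -> exists P F t,
    [/\ fchart E P (Iab (-1) 1) F t, P p, t p = 0 & P `<=` Q];
  rg_sep : forall x y, Q x -> Q y ->
    (forall A B, nbhs x A -> nbhs y B -> exists a b, [/\ A a, B b & E a b]) -> E x y }.

(* (A, al) is an initial segment of (P, t). *)
Definition init (T : Type) (A : set T) (al : T -> R) (P : set T) (t : T -> R) : Prop :=
  A `<=` P /\ forall x y, A x -> P y -> t y < t x -> A y /\ al y < al x.

Section initial_segments.
Variables (T : topologicalType) (E : T -> T -> Prop).
Implicit Types (A P : set T) (al F t : T -> R).

Lemma init_lt A al P t x y : init A al P t -> A x -> A y ->
  (t x = t y -> al x = al y) -> (al x < al y <-> t x < t y).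
Proof.
move=> [sub h] Ax Ay e; split => H; last by have [] := h y x Ay (sub _ Ax) H.
case: (ltrgtP (t x) (t y)) => // [H'|/e e']; last by move: H; rewrite e' ltxx.
by have [_] := h x y Ax (sub _ Ay) H'; lra.
Qed.

Lemma fchart_pt_leaf P J F t y (x : R) : fchart E P J F t -> P y -> -1 < x < 1 ->
  exists z, [/\ P z, F z = x, t z = t y & E y z].
Proof.
move=> c Py x1; have [z [Pz Fz tz]] := fchart_at c x1 (fchart_J c Py).
by exists z; split => //; apply/(fchart_leaf c Py Pz).
Qed.

(** On every leaf near that of z, the point on the fibre F = F z is close to z. So the saturation of
    a neighbourhood of z contains a slab around its leaf. *)
Lemma fchart_near P J F t z N : fchart E P J F t -> P z -> nbhs z N ->
  exists d : R, 0 < d /\ forall u, P u -> t z - d < t u < t z + d ->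
    exists v, [/\ P v, N v, t v = t u & E u v].
Proof.
move=> c Pz nN; have [d d0 H] := fchart_inv c Pz nN.
exists d; split => // u Pu hu.
have [v [Pv Fv tv Euv]] := fchart_pt_leaf c Pu (fchart_Fb c Pz).
by exists v; split => //; apply: H => //; rewrite ?Fv ?tv//; lra.
Qed.

End initial_segments.

Section rays.
Variables (T : topologicalType) (E : T -> T -> Prop) (Q : set T).
Hypothesis rg : regular E Q.
Implicit Types (A P : set T) (al F t : T -> R).

Let Esym := rg_sym rg.
Let Etrans := rg_trans rg.

Tactic Notation "lra" "from" hyp_list(hs) :=
  clear - hs rg Esym Etrans; lra.

(** Real induction on s, the claim being that the part t1 <= s of P1 is an initial segment of P2. At
    a limit, the leaf t1 = s and the leaf of P2 at the supremum of the levels reached are not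
    separated, hence equal. Beyond a common leaf both charts contain a slab around it, where t2
    continues to increase with t1. The induction can only stop when P2 is exhausted. *)
Lemma nested P1 F1 t1 P2 F2 t2 A al :
  fchart E P1 (Iab 0 1) F1 t1 -> P1 `<=` Q ->
  fchart E P2 (Iab 0 1) F2 t2 -> P2 `<=` Q ->
  A !=set0 -> (forall x y, A x -> E x y -> A y) ->
  (forall x y, A x -> E x y -> al x = al y) ->
  init A al P1 t1 -> init A al P2 t2 ->
  init P1 t1 P2 t2 \/ init P2 t2 P1 t1.
Proof.
move=> c1 s1 c2 s2 [x0 Ax0] satA alE i1 i2.
have [|no] := pselect (init P2 t2 P1 t1); [by right|left].
have lt1 x y : A x -> A y -> (al x < al y <-> t1 x < t1 y).
  move=> Ax Ay; apply: (init_lt i1) => // e; apply: alE => //.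
  by apply/(fchart_leaf c1) => //; exact: i1.1.
have [sA1 iA1] := i1; have [sA2 iA2] := i2.
pose I (s : R) := init (P1 `&` [set x | t1 x <= s]) t1 P2 t2.
have tI s x y : I s -> P1 x -> P1 y -> t1 x <= s -> t1 y <= s ->
    (t1 x < t1 y <-> t2 x < t2 y).
  move=> Is Px Py hx hy; apply: (init_lt Is) => // e.
  by apply/(fchart_leaf c1) => //; apply/(fchart_leaf c2) => //; apply: Is.1.
suff key (s : R) : 0 < s < 1 -> I s.
  split=> [x Px|x y Px Py txy].
    by apply: (key _ (fchart_J c1 Px)).1; split => //=.
  have [|[P1y _] h] := (key _ (fchart_J c1 Px)).2 x y _ Py txy; first by split => //=.
  by split.
apply: real_ind s.
- exists (t1 x0); split; first by apply: (fchart_J c1); exact: sA1.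
  have Px0 := sA1 _ Ax0.
  have inA x : P1 x -> t1 x <= t1 x0 -> A x.
    rewrite le_eqVlt => Px /orP[/eqP e|h]; last by have [] := iA1 x0 x Ax0 Px h.
    by apply: (satA x0) => //; apply/(fchart_leaf c1).
  split=> [x [Px /= hx]|x y [Px /= hx] Py txy]; first exact/sA2/inA.
  have Ax := inA x Px hx; have [Ay aly] := iA2 x y Ax Py txy.
  have h := iffLR (lt1 y x Ay Ax) aly.
  by split => //; split; [exact: sA1 | rewrite /=; lra].
- move=> s s' ss' Is; split=> [x [Px /= hx]|x y [Px /= hx] Py txy].
    by apply: Is.1; split => //=; lra.
  have [|[P1y _] h] := Is.2 x y _ Py txy; first by split => //=; lra.
  by split => //; split => //=; lra.
- move=> s s01 IH.
  pose U := P1 `&` [set x | t1 x < s].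
  have UI x : U x -> exists r, [/\ t1 x <= r, r < s & I r].
    move=> [Px /= hx]; have := fchart_J c1 Px; rewrite /Iab /= => tx.
    by exists ((t1 x + s) / 2); split; [lra | lra | apply: IH; lra].
  have iU : init U t1 P2 t2.
    split=> [x Ux|x y Ux Py txy].
      by have [r [h1 h2 Ir]] := UI x Ux; apply: Ir.1; split => //; case: Ux.
    have [r [h1 h2 Ir]] := UI x Ux.
    have [|[P1y /= h3] h4] := Ir.2 x y _ Py txy; first by split => //; case: Ux.
    by split => //; split => //=; lra.
  have tU x y : U x -> U y -> (t1 x < t1 y <-> t2 x < t2 y).
    move=> Ux Uy; apply: (init_lt iU) => // e.
    by apply/(fchart_leaf c1); [case: Ux | case: Uy | apply/(fchart_leaf c2) => //; exact: iU.1].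
  have [x1 [P1x1 Fx1 tx1]] := fchart_at c1 (x := 0) (s := s) ltac:(lra) s01.
  (* If no level of P2 bounds those of U from above, then P2 lies in U and is an initial segment of
     P1, which [no] excludes. *)
  have [[y0 [P2y0 hy0]]|unb] := pselect (exists y0, P2 y0 /\ forall x, U x -> t2 x <= t2 y0); last first.
    exfalso; apply: no; have sU y : P2 y -> U y.
      move=> Py; apply: contrapT => nU; apply: unb; exists y; split => // x Ux.
      by rewrite leNgt; apply/negP => h; apply: nU; have [] := iU.2 x y Ux Py h.
    split=> [y /sU[]//|y z P2y P1z tzy].
    have [_ /= hy] := sU y P2y.
    have Uz : U z by split => //=; lra.
    by split; [exact: iU.1 | apply/(tU z y) => //; exact: sU].
  have [x2 [P1x2 _ tx2]] := fchart_at c1 (x := 0) (s := s / 2) ltac:(lra) ltac:(rewrite /Iab /=; lra).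
  have U2 : U x2 by split => //=; lra.
  have hs : has_sup (t2 @` U).
    by split; [exists (t2 x2), x2 | exists (t2 y0) => _ [x Ux <-]; exact: hy0].
  pose r := sup (t2 @` U).
  have ler x : U x -> t2 x <= r by move=> Ux; apply: (ub_le_sup hs.2); exists x.
  have r01 : Iab 0 1 r.
    have h1 := fchart_J c2 (iU.1 _ U2); have h2 := fchart_J c2 P2y0.
    have h3 : r <= t2 y0.
      by apply: ge_sup; [exists (t2 x2), x2 | move=> _ [x Ux <-]; exact: hy0].
    have := ler _ U2; move: h1 h2; rewrite /Iab /=; lra.
  have [z [P2z Fz tz]] := fchart_at c2 (x := 0) (s := r) ltac:(lra) r01.
  (* Leaves of U that are high enough for both coordinates pass near z, at level r of t2, and near
     x1, at level s of t1; the two leaves are therefore not separated. *)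
  have Ezx : E z x1.
    apply: (rg_sep rg); [exact: s2 | exact: s1 | move=> B1 B2 n1 n2].
    have [d2 [d20 H2]] := fchart_near c2 P2z n1.
    have [d1 [d10 H1]] := fchart_near c1 P1x1 n2.
    have [u [Uu hu]] : exists u, U u /\ r - d2 < t2 u.
      by have [_ [u Uu <-] hu] := sup_adherent d20 hs; exists u.
    have [v [Uv hv]] : exists v, U v /\ s - d1 < t1 v.
      have [d [d0 e1 e2]] := pos_min d10 (b := s) ltac:(lra).
      have [v [Pv _ tv]] := fchart_at c1 (x := 0) (s := s - d / 2) ltac:(lra from) ltac:(rewrite /Iab /=; lra from s01 d0 e2).
      by exists v; split; [split => //=; lra from d0 tv | lra from d0 e1 tv].
    have [w [Uw w1 w2]] : exists w, [/\ U w, r - d2 < t2 w & s - d1 < t1 w].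
      have [h|h] := ltP (t1 u) (t1 v).
        by exists v; split => //; move/(tU u v Uu Uv): h; lra from hu.
      by exists u; split => //; lra from hv h.
    have [a [P2a Na ta Ea]] := H2 w (iU.1 _ Uw) ltac:(have := ler w Uw; lra from tz w1).
    have [b [P1b Nb tb Eb]] := H1 w (proj1 Uw) ltac:(have := proj2 Uw; rewrite /= tx1; lra from w2).
    by exists a, b; split => //; apply: Etrans Eb; exact: Esym.
  have P2x1 := fchart_sat c2 P2z Ezx.
  have t2x1 : t2 x1 = r by rewrite -tz; apply/esym/(fchart_leaf c2).
  have case_x x : P1 x -> t1 x <= s -> U x \/ [/\ P2 x, t2 x = r & t1 x = s].
    move=> Px; rewrite le_eqVlt => /orP[/eqP e|h]; [right|by left].
    have Ex : E x1 x by apply/(fchart_leaf c1) => //; rewrite tx1.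
    have P2x := fchart_sat c2 P2x1 Ex.
    by split => //; rewrite -t2x1; apply/esym/(fchart_leaf c2).
  split=> [x [Px /= hx]|x y [Px /= hx] Py txy].
    by case: (case_x x Px hx) => [/iU.1|[]].
  case: (case_x x Px hx) => [Ux|[P2x t2x t1x]].
    by have [[P1y /= h1] h2] := iU.2 x y Ux Py txy; split => //; split => //=; lra from h1.
  have [u [Uu hu]] : exists u, U u /\ t2 y < t2 u.
    have [|_ [u Uu <-] hu] := @sup_adherent _ (t2 @` U) (r - t2 y) _ hs.
      by rewrite subr_gt0 -t2x.
    by exists u; split => //; move: hu; rewrite -/r; lra from.
  have [[P1y /= h1] h2] := iU.2 u y Uu Py hu.
  by split; [split => //=; lra from h1 | lra from t1x h1].
- move=> s s01 Is.
  have [x1 [P1x1 Fx1 tx1]] := fchart_at c1 (x := 0) (s := s) ltac:(lra) s01.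
  have P2x1 : P2 x1 by apply: Is.1; split => //=; rewrite tx1.
  have nP2 : nbhs x1 P2 by apply: (fchart_nbhs c2).
  have [d' [d'0 H]] := fchart_near c1 P1x1 nP2.
  have [d'' [d''0 e1 e2]] := pos_min d'0 (b := s) ltac:(lra).
  have [d [d0 e3 e4]] := pos_min d''0 (b := 1 - s) ltac:(lra).
  have cV := fchart_sub c1 (a' := s - d) (b' := s + d) ltac:(lra from e2 e3) ltac:(lra from e4).
  set V := P1 `&` _ in cV.
  have sV : V `<=` P2.
    move=> x [Px /= hx]; have [v [P1v P2v tv Ev]] := H x Px ltac:(rewrite tx1; lra from e1 e3 hx).
    by apply: fchart_sat c2 P2v (Esym Ev).
  have V1 : V x1 by split => //=; rewrite tx1; lra from d0.
  have hc x : V x -> t2 y @[y --> x] --> t2 x by move=> /sV; exact: (fchart_t c2).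
  have hi x y : V x -> V y -> (t2 x = t2 y <-> t1 x = t1 y).
    move=> Vx Vy; rewrite -(fchart_leaf c2)//; [|exact: sV|exact: sV].
    by rewrite (fchart_leaf cV).
  (* On the slab V around the leaf t1 = s, t2 cannot decrease in t1, since it increases below s. *)
  have [m|m] := fchart_mono cV (@Iab_interval _ _) hc hi; last first.
    have [x2 [P1x2 _ tx2]] := fchart_at c1 (x := 0) (s := s - d / 2) ltac:(lra from) ltac:(rewrite /Iab /=; lra from e2 d0 e3 e4).
    have V2 : V x2 by split => //=; lra from d0 tx2.
    have h1 : t1 x2 < t1 x1 by lra from tx1 d0 tx2.
    have := iffLR (tI s x2 x1 Is P1x2 P1x1 ltac:(lra from d0 tx2) ltac:(lra from tx1)) h1.
    by move/(m x2 x1 V2 V1); lra.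
  exists (s + d / 2); split; first by lra.
  have cs x : P1 x -> t1 x <= s + d / 2 -> (t1 x <= s) \/ V x.
    move=> Px hx; have [h|h] := lerP (t1 x) s; [by left|right].
    by split => //=; lra from hx h.
  split=> [x [Px /= hx]|x y [Px /= hx] Py txy].
    by case: (cs x Px hx) => [h|/sV//]; apply: Is.1; split.
  case: (cs x Px hx) => [h|Vx].
    have [|[P1y /= h1] h2] := Is.2 x y _ Py txy; first by split.
    by split => //; split => //=; lra from hx h2.
  have [xs|sx] := lerP (t1 x) s.
    have [|[P1y /= h1] h2] := Is.2 x y _ Py txy; first by split.
    by split => //; split => //=; lra from hx h2.
  have [h|h] := ltP (t2 y) (t2 x1).
    have [|[P1y /= h1] h2] := Is.2 x1 y _ Py h; first by split => //=; rewrite tx1.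
    by split; [split => //=; lra from hx sx h1 | lra from sx h1].
  have [|z [Vz t2z _ tz]] := @fchart_ivt _ _ _ _ _ _ cV (@Iab_interval _ _) t2 (t2 y) x1 x hc V1 Vx.
    by rewrite h ltW.
  have Ezy : E z y by apply/(fchart_leaf c2) => //; exact: sV.
  have P1z := proj1 Vz; have P1y := fchart_sat c1 P1z Ezy.
  have tzy : t1 z = t1 y by apply/(fchart_leaf c1).
  have zx : t1 z < t1 x by apply/m => //; rewrite t2z.
  by split; [split => //=; lra from hx tzy zx | lra from tzy zx].
Qed.

End rays.

Section base_leaf.
Variables (T : topologicalType) (E : T -> T -> Prop) (Q : set T).
Variables (P0 : set T) (F0 t0 : T -> R).
Implicit Types (P : set T) (F t : T -> R).

Definition germ (d : R) : set T := P0 `&` [set x | 0 < t0 x < d].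

(* A chart on one side of the base leaf t0 = 0: near it, it agrees with the part 0 < t0
   of the chart (P0, F0, t0), orientation included. *)
Definition ray P F t : Prop :=
  [/\ fchart E P (Iab 0 1) F t, P `<=` Q, forall x, P x -> ~ (P0 x /\ t0 x = 0) &
    exists d : R, [/\ 0 < d <= 1, init (germ d) t0 P t &
      forall x y, germ d x -> E x y -> F0 x < F0 y -> F x < F y]].

Hypothesis rg : regular E Q.
Hypothesis c0 : fchart E P0 (Iab (-1) 1) F0 t0.
Hypothesis s0 : P0 `<=` Q.

Let Esym := rg_sym rg.
Let Etrans := rg_trans rg.

Lemma germ_chart d : d <= 1 -> fchart E (germ d) (Iab 0 d) F0 t0.
Proof. by move=> d1; apply: (fchart_sub c0) => //; lra. Qed.

Lemma germ_le d d' P t : 0 < d' -> d' <= d -> init (germ d) t0 P t -> init (germ d') t0 P t.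
Proof.
move=> d'0 dd [sub h]; split=> [x [Px /= hx]|x y [Px /= hx] Py txy].
  by apply: sub; split => //=; lra.
have [|[P0y /= h1] h2] := h x y _ Py txy; first by split => //=; lra.
by split => //; split => //=; lra.
Qed.

Lemma germ_sat d x y : germ d x -> E x y -> germ d y.
Proof.
move=> [Px /= hx] Exy; have [Py ty] := iffLR (fchart_E c0 y Px) Exy.
by split => //=; rewrite ty.
Qed.

Lemma germ_E d x y : germ d x -> E x y -> t0 x = t0 y.
Proof. by move=> [Px _] /(fchart_E c0 y Px) []. Qed.

Lemma germ_pt d (s : R) : d <= 1 -> 0 < s < d -> exists x, germ d x /\ t0 x = s.
Proof.
move=> d1 hs; have [||x [gx _ tx]] := @fchart_at _ _ _ _ _ _ 0 s (germ_chart d1) => //.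
  by lra.
by exists x.
Qed.

Lemma base_ray : ray (germ 1) F0 t0.
Proof.
split; first exact: germ_chart.
- by move=> x [/s0].
- by move=> x [_ /= h] [_ e]; lra.
exists 1; split => //; first by lra.
by split => // x y [P0x /= hx] [P0y /= hy] txy; split => //; split.
Qed.

Lemma ray_nested P1 F1 t1 P2 F2 t2 : ray P1 F1 t1 -> ray P2 F2 t2 ->
  init P1 t1 P2 t2 \/ init P2 t2 P1 t1.
Proof.
move=> [c1 s1 _ [d1 [h1 i1 _]]] [c2 s2 _ [d2 [h2 i2 _]]].
have [d [d0 e1 e2]] := @pos_min d1 d2 ltac:(lra) ltac:(lra).
apply: (nested rg c1 s1 c2 s2 (A := germ d) (al := t0)).
- by have [x [gx _]] := @germ_pt d (d / 2) ltac:(lra) ltac:(lra); exists x.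
- by move=> x y; exact: germ_sat.
- by move=> x y; exact: germ_E.
- exact: germ_le i1.
- exact: germ_le i2.
Qed.

Tactic Notation "lra" "from" hyp_list(hs) :=
  clear - hs rg c0 s0 Esym Etrans; lra.

(** The two orientations agree on all of P1 or are opposite on all of it, and near the base leaf
    both continue the orientation of F0. *)
Lemma ray_orient_sub P1 F1 t1 P2 F2 t2 : ray P1 F1 t1 -> ray P2 F2 t2 -> P1 `<=` P2 ->
  forall x y, P1 x -> E x y -> (F1 x < F1 y <-> F2 x < F2 y).
Proof.
move=> [c1 s1 _ [d1 [h1 i1 o1]]] [c2 s2 _ [d2 [h2 i2 o2]]] s12.
have [//|m] := fchart_orient c1 (@Iab_interval _ _) c2 s12.
have [d [d0 e1 e2]] := @pos_min d1 d2 ltac:(lra) ltac:(lra).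
have [x [[P0x /= hx] tx]] := @germ_pt d (d / 2) ltac:(lra) ltac:(lra).
have Fx := fchart_Fb c0 P0x.
have [y [P0y Fy ty Exy]] := fchart_pt_leaf c0 P0x (x := (F0 x + 1) / 2) ltac:(lra).
have a1 := o1 x y ltac:(split => //=; lra from e1 hx) Exy ltac:(lra from Fx Fy).
have a2 := o2 x y ltac:(split => //=; lra from e2 hx) Exy ltac:(lra from Fx Fy).
by move/(m x y (i1.1 x ltac:(split => //=; lra from e1 hx)) Exy): a1; lra from a2.
Qed.

Lemma ray_orient P1 F1 t1 P2 F2 t2 x y : ray P1 F1 t1 -> ray P2 F2 t2 ->
  P1 x -> P2 x -> E x y -> F1 x < F1 y -> F2 x < F2 y.
Proof.
move=> r1 r2 P1x P2x Exy h; case: (ray_nested r1 r2) => -[sub _].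
  by apply/(ray_orient_sub r1 r2 sub).
by apply/(ray_orient_sub r2 r1 sub).
Qed.

(** Together with [ray_small_germ]: t tends to 0 on a ray exactly when t0 tends to 0 from above. The
    lower end of every ray is thus the base leaf. *)
Lemma ray_germ_small P F t : ray P F t -> forall e : R, 0 < e -> exists d : R,
  [/\ 0 < d <= 1, germ d `<=` P & forall x, germ d x -> t x < e].
Proof.
move=> [c s _ [d [hd i _]]] e e0.
have [x [gx tx]] := @germ_pt d (d / 2) ltac:(lra) ltac:(lra).
have h1 := fchart_J c (i.1 x gx).
have [e' [e'0 e1 e2]] := @pos_min e (t x) e0 ltac:(move: h1; rewrite /Iab /=; lra).
have [y [Py _ ty]] := fchart_at c (x := 0) (s := e' / 2) ltac:(lra)
  ltac:(move: h1; rewrite /Iab /=; lra).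
have [gy h2] := i.2 x y gx Py ltac:(lra).
have hy := proj2 gy; rewrite /= in hy.
exists (t0 y); split; first by lra.
  by move=> z [P0z /= hz]; apply: i.1; split => //=; lra.
move=> z [P0z /= hz]; have gz : germ d z by split => //=; lra.
have := init_lt i gz gy; move=> /(_ _) [|h3 _]; last by have := h3 ltac:(lra from hz); lra from e'0 e1 ty.
move=> e3; apply: (germ_E gz).
by apply/(fchart_leaf c) => //; exact: i.1.
Qed.

Lemma ray_small_germ P F t (d : R) : ray P F t -> 0 < d -> exists2 e : R, 0 < e &
  forall x, P x -> t x < e -> germ d x.
Proof.
move=> [c s _ [d' [hd i _]]] d0.
have [d1 [d10 e1 e2]] := @pos_min d d' d0 ltac:(lra).
have [x [gx tx]] := @germ_pt d1 (d1 / 2) ltac:(lra) ltac:(lra).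
have i1 := germ_le d10 e2 i.
exists (t x); first by have := fchart_J c (i1.1 x gx); rewrite /Iab /=; lra.
move=> y Py hy; have [[P0y /= h1] h2] := i1.2 x y gx Py hy.
by split => //=; lra.
Qed.

Lemma ray_leaf P F t x y : ray P F t -> P x -> P y -> (E x y <-> t x = t y).
Proof. by move=> [c _ _ _]; exact: (fchart_leaf c). Qed.

Section union_of_rays.
Variables (Pn : nat -> set T) (Fn tn : nat -> T -> R).
Hypothesis rn : forall n, ray (Pn n) (Fn n) (tn n).
Hypothesis cover : forall P F t, ray P F t -> P `<=` \bigcup_n Pn n.

Let M : set T := \bigcup_n Pn n.

(** Continued by 1, the supremum of [tn n], the coordinate remains continuous and nondecreasing
    along every longer ray. *)
Let text n x : R := if pselect (Pn n x) then tn n x else 1.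

Let text_in n x : Pn n x -> text n x = tn n x.
Proof. by rewrite /text; case: pselect. Qed.

Let text_out n x : ~ Pn n x -> text n x = 1.
Proof. by rewrite /text; case: pselect. Qed.

Let tn_bd n x : Pn n x -> 0 < tn n x < 1.
Proof. by move=> Px; have [c _ _ _] := rn n; have := fchart_J c Px. Qed.

Let text_bd n x : 0 < text n x <= 1.
Proof.
have [Px|nPx] := pselect (Pn n x); first by rewrite text_in//; have := tn_bd Px; lra.
by rewrite text_out//; lra.
Qed.

Let text_le P F t n x y : ray P F t -> P x -> P y -> t x < t y ->
  text n x <= text n y /\ (Pn n x -> text n x < text n y).
Proof.
move=> r Px Py txy; have [Pnx|nPnx] := pselect (Pn n x); last first.
  suff nPny : ~ Pn n y by rewrite !text_out//.
  move=> Pny; apply: nPnx; case: (ray_nested r (rn n)) => -[sub h]; first exact: sub.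
  by have [] := h y x Pny Px txy.
suff lt : text n x < text n y by split; [exact: ltW|].
rewrite (text_in Pnx); have [Pny|nPny] := pselect (Pn n y); last first.
  by rewrite text_out//; have := tn_bd Pnx; lra.
rewrite text_in//; have e : E x y <-> t x = t y by exact: ray_leaf r Px Py.
have e' : E x y <-> tn n x = tn n y by exact: ray_leaf (rn n) Pnx Pny.
case: (ray_nested r (rn n)) => i.
  by apply/(init_lt i) => //; move/e'/e.
by apply/(init_lt i) => //; move/e/e'.
Qed.

Let common x y : M x -> M y -> exists n, Pn n x /\ Pn n y.
Proof.
move=> [n _ Px] [m _ Py]; case: (ray_nested (rn n) (rn m)) => -[sub _].
  by exists m; split => //; exact: sub.
by exists n; split => //; exact: sub.
Qed.

Let oM : open M.
Proof. by apply: bigcup_open => n _; have [c _ _ _] := rn n; exact: fchart_open c. Qed.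

Let text_cvg n x : M x -> text n y @[y --> x] --> text n x.
Proof.
move=> [m _ Pmx]; apply: rlim_itv => e e0.
have [Pnx|nPnx] := pselect (Pn n x).
  have [c _ _ _] := rn n.
  have nP : \forall y \near x, Pn n y by apply: (fchart_nbhs c).
  have := rlim_near (nbhs_filter x) (fchart_t c Pnx) e0; rewrite (text_in Pnx) => h.
  near=> y; rewrite text_in; near: y => //.
have [cm _ _ _] := rn m; have [cn _ _ _] := rn n.
have [i|i] := ray_nested (rn m) (rn n); first by have := nPnx (i.1 x Pmx).
(* Here x lies beyond [Pn n] in the longer ray m. Past the leaf where [tn n] is 1 - e' / 2, which is
   below x, [text n] is at least 1 - e' / 2. *)
have [e' [e'0 e1 e2]] := @pos_min e 1 e0 ltac:(lra).
have [z [Pz _ tz]] := fchart_at cn (x := 0) (s := 1 - e' / 2) ltac:(lra)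
  ltac:(rewrite /Iab /=; lra).
have Pmz := i.1 z Pz.
have tzx : tn m z < tn m x.
  case: (ltrgtP (tn m z) (tn m x)) => // [h|h]; exfalso; apply: nPnx.
    by have [] := i.2 z x Pz Pmx h.
  by apply: (fchart_sat cn Pz); apply/(fchart_leaf cm).
have nP : \forall y \near x, Pn m y by apply: (fchart_nbhs cm).
have nt : \forall y \near x, tn m z < tn m y by apply: (cvgr_gt (tn m x)) => //; exact: (fchart_t cm).
near=> y.
have Pmy : Pn m y by near: y.
have tzy : tn m z < tn m y by near: y.
have [h _] := text_le n (rn m) Pmz Pmy tzy.
rewrite (text_out nPnx); move: h; rewrite (text_in Pz) tz; have := text_bd n y; lra.
Unshelve. all: by end_near. Qed.

Let tM x : R := wsum (text^~ x).

Let bd_text x : bdd1 (text^~ x).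
Proof. by move=> n; have := text_bd n x; lra. Qed.

(** Every [text n] is nondecreasing along a ray, and the one whose domain contains x increases
    strictly there; [cover] provides it. *)
Let tM_lt P F t x y : ray P F t -> P x -> P y -> t x < t y -> tM x < tM y.
Proof.
move=> r Px Py txy; have [n _ Pnx] := cover r Px.
apply: (@wsum_lt _ _ n) => // [m|]; first by have [] := text_le m r Px Py txy.
by have [_] := text_le n r Px Py txy; apply.
Qed.

Let tM_bd x : 0 <= tM x <= 1.
Proof.
have b0 : bdd1 (fun=> 0) by move=> n; lra.
have b1 : bdd1 (fun=> 1) by move=> n; lra.
have := @wsum_le _ _ (@bd_text x) b1 (fun n => ltac:(have := text_bd n x; lra)).
have := @wsum_le _ _ b0 (@bd_text x) (fun n => ltac:(have := text_bd n x; lra)).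
rewrite wsum1 => h1 h2; apply/andP; split => //.
apply: le_trans h1; have := wsumN b0.
have -> : (fun n : nat => - (0 : R)) = (fun=> 0) by apply: funext => n; rewrite oppr0.
by lra.
Qed.

Let tM_cvg x : M x -> tM y @[y --> x] --> tM x.
Proof.
move=> Mx; apply: wsum_lim; [exact: nearW | exact: bd_text | move=> n].
exact: text_cvg.
Qed.

Let EM x y : M x -> (E x y <-> M y /\ tM y = tM x).
Proof.
move=> Mx; split=> [Exy|[My e]].
  have [n _ Px] := Mx; have [c _ _ _] := rn n; have Py := fchart_sat c Px Exy.
  split; first by exists n.
  congr wsum; apply: funext => m; have [c' _ _ _] := rn m.
  have [Pmx|nPmx] := pselect (Pn m x).
    have Pmy := fchart_sat c' Pmx Exy; rewrite !text_in//.
    by apply/(fchart_leaf c') => //; exact: Esym.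
  rewrite !text_out// => Pmy; apply: nPmx; apply: (fchart_sat c' Pmy); exact: Esym.
have [n [Px Py]] := common Mx My; apply/(ray_leaf (rn n)) => //.
case: (ltrgtP (tn n x) (tn n y)) => // h.
  by have := tM_lt (rn n) Px Py h; rewrite e ltxx.
by have := tM_lt (rn n) Py Px h; rewrite e ltxx.
Qed.

Let iM n : init (Pn n) (tn n) M tM.
Proof.
split=> [x Px|x y Px My h]; first by exists n.
have [m [Pmx Pmy]] := common (ex_intro2 _ _ n I Px) My.
have hm : tn m y < tn m x.
  case: (ltrgtP (tn m y) (tn m x)) => // h'.
    by have := tM_lt (rn m) Pmx Pmy h'; lra.
  suff : tM y = tM x by lra.
  have Mx : M x by exists n.
  by have [_ ->] := iffLR (EM y Mx) (iffRL (ray_leaf (rn m) Pmx Pmy) (esym h')).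
case: (ray_nested (rn n) (rn m)) => i; first exact: i.2 Px Pmy hm.
have Pny := i.1 y Pmy; split => //.
have Pnx := i.1 x Pmx; apply/(init_lt i) => // e.
by apply/(ray_leaf (rn m) Pmy Pmx)/(ray_leaf (rn n) Pny Pnx).
Qed.

(** A weight that is positive exactly on [Pn n]: this is an initial segment of M on which tM has no
    maximum. Being a function of tM, it is continuous and constant along leaves. *)
Let w n x : R := Num.max 0 (sup (tM @` Pn n) - tM x).

Let sup_w n : has_sup (tM @` Pn n).
Proof.
split; last by exists 1 => _ [x _ <-]; have := tM_bd x; lra.
have [c _ _ _] := rn n.
have [x [Px _ _]] := fchart_at c (x := 0) (s := 1 / 2) ltac:(lra) ltac:(rewrite /Iab /=; lra).
by exists (tM x), x.
Qed.

Let sup_le1 n : sup (tM @` Pn n) <= 1.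
Proof.
by apply: ge_sup; [exact: (sup_w n).1 | move=> _ [x _ <-]; have := tM_bd x; lra].
Qed.

Let w_bd n x : 0 <= w n x <= 1.
Proof.
rewrite /w le_max lexx /= ge_max; have := sup_le1 n; have := tM_bd x; lra.
Qed.

Let w_pos n x : M x -> (0 < w n x <-> Pn n x).
Proof.
move=> Mx; rewrite /w lt_max ltxx /= subr_gt0; split.
  rewrite -subr_gt0 => h; have [_ [y Py <-] hy] := sup_adherent h (sup_w n).
  have {}hy : tM x < tM y by move: hy; rewrite subKr.
  by have [] := (iM n).2 y x Py Mx hy.
move=> Px; have [c _ _ _] := rn n; have hx := tn_bd Px.
have [y [Py _ ty]] := fchart_at c (x := 0) (s := (tn n x + 1) / 2) ltac:(lra)
  ltac:(rewrite /Iab /=; lra).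
have := tM_lt (rn n) Px Py ltac:(lra).
have : tM y <= sup (tM @` Pn n) by apply: (ub_le_sup (sup_w n).2); exists y.
by lra.
Qed.

Let w_cvg n x : M x -> w n y @[y --> x] --> w n x.
Proof.
move=> Mx; apply: rlim_max; first exact: rlim_cst.
by apply: rlimB; [exact: rlim_cst | exact: tM_cvg].
Qed.

Lemma union_ray : exists F t, ray (\bigcup_n Pn n) F t.
Proof.
have ex0 : exists x, Pn 0 x.
  by have [_ [x Px _]] := (sup_w 0).1; exists x.
have [x0 Px0] := ex0.
have Mx0 : M x0 by exists 0%N.
have charts n p : M p -> Pn n p -> exists U J' t',
    [/\ fchart E U J' (Fn n) t', open J', is_interval J', U p & U `<=` M].
  move=> Mp Pp; have [c _ _ _] := rn n; exists (Pn n), (Iab 0 1), (tn n); split => //.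
  - exact: Iab_open.
  - exact: Iab_interval.
  - by move=> x Px; exists n.
have wE n x y : M x -> E x y -> w n x = w n y.
  by move=> Mx Exy; have [_ e] := iffLR (EM y Mx) Exy; rewrite /w e.
have cM : fchart E M (tM @` M) (blend w Fn) tM.
  apply: fchart_glue => //.
  - by move=> x [n _ Px]; exists n; apply/w_pos => //; exists n.
  - by move=> n x Mx /(w_pos n Mx); exact: charts.
  - move=> n m x y Mx Exy /(w_pos n Mx) Pnx /(w_pos m Mx) Pmx.
    exact: ray_orient (rn n) (rn m) Pnx Pmx Exy.
(* The image of tM is open by [fchart_open_image], and connected because any two points of M share a
   ray. Its ends are unknown, so tM is rescaled to (0, 1) afterwards. *)
have [a [b [ab Jab]]] : exists a b : R, a < b /\ tM @` M = Iab a b.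
  apply: (@open_interval_Iab _ 0 1).
  - by exists (tM x0), x0.
  - rewrite openE => _ [x [n _ Px] <-]; rewrite /interior.
    have [c _ _ _] := rn n.
    have Mn y : Pn n y -> M y by move=> Py; exists n.
    have [||d d0 H] := @fchart_open_image _ _ _ _ _ _ tM x c (@Iab_open _ _) (@Iab_interval _ _) _ _ Px.
    + by move=> y /Mn; exact: tM_cvg.
    + move=> y z Py Pz; rewrite -(ray_leaf (rn n) Py Pz) (EM _ (Mn _ Py)).
      by split=> [->|[]//]; split => //; exact: Mn.
    apply/nbhs_ballP; exists d => //= s; rewrite /ball /= ltr_norml => hs.
    by have [y [Py <- _]] := H s ltac:(lra); exists y => //; exact: Mn.
  - move=> _ _ [x Mx <-] [y My <-] s hs.
    have [n [Px Py]] := common Mx My; have [c _ _ _] := rn n.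
    have Mn z : Pn n z -> M z by move=> Pz; exists n.
    have [||z [Pz <- _ _]] := @fchart_ivt _ _ _ _ _ _ c (@Iab_interval _ _) tM s x y _ Px Py => //.
      by move=> z /Mn; exact: tM_cvg.
    by exists z => //; exact: Mn.
  - by move=> _ [x _ <-]; exact: tM_bd.
rewrite Jab in cM.
exists (blend w Fn), (fun x => (tM x - a) / (b - a)).
have [c _ _ [d [hd i o]]] := rn 0.
split; first exact: fchart_affine.
- by move=> x [n _ Px]; have [_ s _ _] := rn n; exact: s.
- by move=> x [n _ Px]; have [_ _ s _] := rn n; exact: s.
exists d; split => //.
  split=> [x gx|x y gx My]; first by exists 0%N => //; exact: i.1.
  rewrite ltr_pM2r ?invr_gt0; last by lra.
  move=> h; have P0x := i.1 x gx; have [P0y h'] := (iM 0).2 x y P0x My ltac:(lra).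
  exact: i.2.
move=> x y gx Exy F0xy; have P0x := i.1 x gx.
have Mx : M x by exists 0%N.
apply: (@blend_lt _ E M tM w Fn _ _ _ _ _ _ 0 x y) => //.
- by move=> z [n _ Pz]; exists n; apply/w_pos => //; exists n.
- by move=> n z Mz /(w_pos n Mz)/(charts n z Mz)[U [J [t' [k _ _ Uz _]]]]; exists U, J, t'.
- move=> n m z z' Mz Ezz' /(w_pos n Mz) Pnz /(w_pos m Mz) Pmz.
  exact: ray_orient (rn n) (rn m) Pnz Pmz Ezz'.
- exact/w_pos.
- exact: o.
Qed.

End union_of_rays.

(* Rays are nested, so a countable cover of their union by rays can be blended. *)
Lemma max_ray : @second_countable T -> exists M F t, ray M F t /\
  forall P' F' t', ray P' F' t' -> P' `<=` M.
Proof.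
move=> sc.
have [|f [fok fcov]] := @second_countable_cover T setT (set T * ((T -> R) * (T -> R)))%type
    (fun r => r.1) (fun r => ray r.1 r.2.1 r.2.2) (germ 1, (F0, t0)) sc base_ray.
  by move=> r x [c _ _ _] Px; apply: filterS (fchart_nbhs c Px).
have cover P F t : ray P F t -> P `<=` \bigcup_n (f n).1.
  by move=> r x Px; have [n Pn] := fcov (P, (F, t)) x r I Px; exists n.
have [F [t r]] := @union_ray (fun n => (f n).1) (fun n => (f n).2.1) (fun n => (f n).2.2) fok cover.
by exists (\bigcup_n (f n).1), F, t.
Qed.

End base_leaf.

(** * Maximal rays are closed away from the base leaf *)

Definition clamp (y : R) : R := Num.max 0 (Num.min 1 y).

Lemma clamp_bd y : 0 <= clamp y <= 1.
Proof. by rewrite /clamp; case: (leP 1 y) => ?; [case: (@leP _ R 0 1)|case: (@leP _ R 0 y)] => ?; lra. Qed.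

Lemma clamp_gt0 y : (0 < clamp y) <-> 0 < y.
Proof. by rewrite /clamp; case: (leP 1 y) => ?; [case: (@leP _ R 0 1)|case: (@leP _ R 0 y)] => ?; split; lra. Qed.

Lemma clamp_cvg (T : topologicalType) (f : T -> R) p : f x @[x --> p] --> f p ->
  clamp (f x) @[x --> p] --> clamp (f p).
Proof.
by move=> fp; apply: rlim_max; [exact: rlim_cst | apply: rlim_min => //; exact: rlim_cst].
Qed.

Section extension.
Variables (T : topologicalType) (E : T -> T -> Prop) (Q : set T).
Implicit Types (P : set T) (F t : T -> R).
Hypothesis rg : regular E Q.

Let Esym := rg_sym rg.
Let Etrans := rg_trans rg.

Tactic Notation "lra" "from" hyp_list(hs) :=
  clear - hs rg Esym Etrans; lra.

(* The fibre of M at the supremum of t over the strip u < t' < v is not separated from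
   the leaf of z. *)
Lemma limit_leaf M (a b : R) F t V J' F' t' (u v c : R) z :
  fchart E M (Iab a b) F t -> (forall y, M y ->
    (forall A B, nbhs y A -> nbhs z B -> exists a b, [/\ A a, B b & E a b]) -> E y z) ->
  fchart E V J' F' t' -> (forall s, u < s < v -> J' s) -> u < v ->
  (forall x, V x -> u < t' x < v -> M x) ->
  (forall x y, V x -> u < t' x < v -> V y -> u < t' y < v -> t' x < t' y -> t x < t y) ->
  V z -> t' z = v -> c < b -> (forall x, V x -> u < t' x < v -> t x <= c) -> M z.
Proof.
move=> cM sM cV Juv uv WM inc Vz tz cb tc.
have [x1 [Vx1 _ tx1]] := fchart_at cV (x := 0) (s := (u + v) / 2) ltac:(lra)
  ltac:(apply: Juv; lra).
pose W := V `&` [set x | u < t' x < v].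
have W1 : W x1 by split => //=; lra.
have hs : has_sup (t @` W).
  by split; [exists (t x1), x1 | exists c => _ [x [Vx hx] <-]; exact: tc].
pose r := sup (t @` W).
have ler x : W x -> t x <= r by move=> Wx; apply: (ub_le_sup hs.2); exists x.
have rc : r <= c.
  by apply: ge_sup; [exact: hs.1 | move=> _ [x [Vx hx] <-]; exact: tc].
have rJ : Iab a b r.
  by have := fchart_J cM (WM _ Vx1 W1.2); have := ler _ W1; rewrite /Iab /=; lra.
have [y [My Fy ty]] := fchart_at cM (x := 0) (s := r) ltac:(lra) rJ.
suff Eyz : E y z by exact: fchart_sat cM My Eyz.
apply: sM => // B1 B2 n1 n2.
have [d2 [d20 H2]] := fchart_near cM My n1.
have [d1 [d10 H1]] := fchart_near cV Vz n2.
have [_ [x2 W2 <-] hx2] := sup_adherent d20 hs.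
have [d [d0 e1 e2]] := pos_min d10 (b := v - u) ltac:(lra).
have [x3 [Vx3 _ tx3]] := fchart_at cV (x := 0) (s := v - d / 2) ltac:(lra from) ltac:(apply: Juv; lra from d0 e2).
have W3 : W x3 by split => //=; lra.
have [w [Ww w1 w2]] : exists w, [/\ W w, r - d2 < t w & v - d1 < t' w].
  have [h|h] := ltP (t' x2) (t' x3).
    by exists x3; split => //; [have := inc _ _ W2.1 W2.2 W3.1 W3.2 h; rewrite -/r in hx2; lra from hx2 | lra from d0 e1 tx3].
  by exists x2; split => //; lra from d0 e1 tx3 h.
have [p [Mp Np tp Ep]] := H2 w (WM _ Ww.1 Ww.2) ltac:(have := ler w Ww; lra from ty w1).
have [q [Vq Nq tq Eq]] := H1 w Ww.1 ltac:(have := Ww.2; rewrite /= tz; lra from w2).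
by exists p, q; split => //; apply: Etrans Eq; exact: Esym.
Qed.

Variables (P0 : set T) (F0 t0 : T -> R).
Hypothesis c0 : fchart E P0 (Iab (-1) 1) F0 t0.
Hypothesis s0 : P0 `<=` Q.

Lemma ray_end M F t V (u0 v0 : R) F' t' (u v d0 : R) z : ray E Q P0 F0 t0 M F t ->
  fchart E V (Iab u0 v0) F' t' -> V `<=` Q -> u0 <= u -> u < v ->
  (forall x, V x -> u < t' x < v -> M x) ->
  0 < d0 -> (forall x, V x -> ~ germ P0 t0 d0 x) ->
  V z -> t' z = v -> ~ M z ->
  (forall x y, V x -> u < t' x < v -> V y -> u < t' y < v -> (t x < t y <-> t' x < t' y)) /\
  (forall c : R, c < 1 -> exists x, [/\ V x, u < t' x < v & c < t x]).
Proof.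
move=> r cV sV u0u uv WM d00 avoid Vz tz nMz.
have [cM sM _ _] := r.
have zv := fchart_J cV Vz; rewrite /Iab /= tz in zv.
have cW := fchart_sub cV u0u (ltW (proj2 (andP zv))).
set W := V `&` _ in cW.
have Juv s : u < s < v -> Iab u0 v0 s by rewrite /Iab /=; lra.
have sz y : M y -> (forall A B, nbhs y A -> nbhs z B -> exists a b, [/\ A a, B b & E a b]) -> E y z.
  by move=> /sM Qy; apply: (rg_sep rg Qy); exact: sV.
have WM' x : W x -> M x by move=> [Vx hx]; exact: WM.
have [||m|m] := @fchart_mono _ _ _ _ _ _ cW (@Iab_interval _ _) t.
- by move=> x /WM'; exact: (fchart_t cM).
- move=> x y Wx Wy; rewrite -(fchart_leaf cM (WM' _ Wx) (WM' _ Wy)).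
  by rewrite (fchart_leaf cW Wx Wy).
- split=> [x y Vx hx Vy hy|c c1]; first exact: m.
  apply: contrapT => no; apply: nMz.
  apply: (limit_leaf cM sz cV Juv uv WM _ Vz tz c1).
    by move=> x y Vx hx Vy hy /m; apply; split.
  by move=> x Vx hx; rewrite leNgt; apply/negP => h; apply: no; exists x.
have [e e0 He] := ray_small_germ c0 r d00.
exfalso; apply: nMz.
apply: (limit_leaf (fchart_neg cM) sz cV Juv uv WM _ Vz tz (c := - e)).
- by move=> x y Vx hx Vy hy h; rewrite ltrN2; apply/m.
- by rewrite oppr0; lra.
move=> x Vx hx; rewrite lerN2 leNgt; apply/negP => h.
by apply: (avoid x Vx); apply: He => //; exact: WM.
Qed.

Tactic Notation "lra" "from" hyp_list(hs) :=
  clear - hs rg Esym Etrans c0 s0; lra.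

(* Otherwise M runs out of the chart V at a first leaf outside M, and the part of M below
   x1 extended by the part of V above x1 is a ray not contained in M. *)
Lemma no_extension M F t V (dl d0 : R) F' t' w x1 : ray E Q P0 F0 t0 M F t ->
  (forall P' F' t', ray E Q P0 F0 t0 P' F' t' -> P' `<=` M) ->
  fchart E V (Iab (- dl) dl) F' t' -> V `<=` Q ->
  0 < d0 -> (forall x, V x -> ~ germ P0 t0 d0 x) ->
  (forall x, V x -> ~ (P0 x /\ t0 x = 0)) ->
  V w -> t' w = 0 -> ~ M w -> V x1 -> M x1 -> ~ t' x1 < 0.
Proof.
move=> r maxM cV sV d00 avoid avoid0 Vw tw nMw Vx1 Mx1 tx1.
have [cM sM nM0 [dg [hdg ig og]]] := r.
pose S s := exists x, [/\ V x, t' x = s & M x].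
have SM x : V x -> (S (t' x) <-> M x).
  move=> Vx; split=> [[y [Vy ty My]]|Mx]; last by exists x.
  by apply: (fchart_sat cM My); apply/(fchart_leaf cV).
have Spt s : - dl < s < dl -> exists x, [/\ V x & t' x = s].
  move=> hs; have [x [Vx _ tx]] := fchart_at cV (x := 0) (s := s) ltac:(lra) hs.
  by exists x.
have oS s : S s -> exists e : R, 0 < e /\ forall r : R, s - e < r < s + e -> S r.
  move=> [x [Vx <- Mx]]; have Jx := fchart_J cV Vx; rewrite /Iab /= in Jx.
  have nM : nbhs x M by apply: (fchart_nbhs cM).
  have [e [e0 He]] := fchart_near cV Vx nM.
  have [e' [e'0 e1 e2]] := @pos_min e (t' x + dl) e0 ltac:(lra).
  have [e3 [e30 e4 e5]] := @pos_min e' (dl - t' x) e'0 ltac:(lra).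
  exists e3; split => // s' hs'.
  have [y [Vy ty]] := Spt s' ltac:(lra from e2 e4 e5 hs').
  have [v [Vv Mv tv Ev]] := He y Vy ltac:(lra from e1 e4 hs' ty).
  by exists v; split => //; rewrite tv.
have S1 : S (t' x1) by exists x1.
have nS0 : ~ S 0 by rewrite -tw => /(SM w Vw).
have [ss [hss nSs below]] := first_exit tx1 S1 nS0 oS.
have J1 := fchart_J cV Vx1; rewrite /Iab /= in J1.
have Jw := fchart_J cV Vw; rewrite /Iab /= in Jw.
have [xs [Vxs txs]] := Spt ss ltac:(lra).
have nMxs : ~ M xs by move=> /(SM _ Vxs); rewrite txs.
have [e [e0 He]] := oS _ S1.
have [eta [eta0 eta1 eta2]] := @pos_min e (t' x1 + dl) e0 ltac:(lra).
pose u := t' x1 - eta.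
have WM x : V x -> u < t' x < ss -> M x.
  move=> Vx; rewrite /u => hx; apply/(SM x Vx).
  by have [h|h] := ltP (t' x) (t' x1); [apply: He; lra from eta1 hx h | apply: below; lra from hx h].
have [inc sup1] := ray_end r cV sV (u := u) (v := ss) ltac:(rewrite /u; lra from eta2) ltac:(rewrite /u; lra from hss eta0)
  WM d00 avoid Vxs txs nMxs.
have W1 : u < t' x1 < ss by rewrite /u; lra from hss eta0.
have cW := fchart_sub cV (a' := u) (b' := ss) ltac:(rewrite /u; lra from eta2) ltac:(lra from hss eta0 eta2).
(* Since t tends to 1 along the strip, the intermediate value theorem places every leaf of M above
   x1 in it. *)
have F1 y : M y -> t x1 < t y -> V y /\ t' x1 < t' y < ss.
  move=> My txy; have hy := fchart_J cM My; rewrite /Iab /= in hy.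
  have [x [Vx hx tyx]] := sup1 (t y) ltac:(lra from hy).
  have [|z [[Vz /= hz] tzy _ _]] := @fchart_ivt _ _ _ _ _ _ cW (@Iab_interval _ _) t (t y) x1 x
      _ (conj Vx1 W1) (conj Vx hx) ltac:(lra from txy tyx).
    by move=> z [Vz hz]; apply: (fchart_t cM); exact: WM.
  have Ezy : E z y by apply/(fchart_leaf cM) => //; exact: WM.
  have [Vy ty] := iffLR (fchart_E cV y Vz) Ezy.
  split => //; rewrite ty; have := iffLR (inc x1 z Vx1 W1 Vz hz) ltac:(lra from txy tzy); lra from hz.
(* M cannot come back into V beyond ss. Going down from such a return, M would be left a second time
   at a level not below ss, and t would tend to 1 there as well, giving leaves above x1 outside the
   strip of [F1]. *)
have F2 y : V y -> ss <= t' y -> ~ M y.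
  move=> Vy hy My; have Jy := fchart_J cV Vy; rewrite /Iab /= in Jy.
  have ssy : ss < t' y.
    rewrite lt_neqAle hy andbT; apply/eqP => e'; apply: nSs; rewrite e'; exact/(SM y Vy).
  have [||||s2 [hs2 nS2 above]] := @first_exit (fun s => S (- s)) (- t' y) (- ss).
  - by lra from ssy.
  - by rewrite opprK; exact/(SM y Vy).
  - by rewrite opprK.
  - move=> s /oS [e' [e'0 H]]; exists e'; split => // r' hr'; apply: H; lra from hr'.
  have [x2 [Vx2 tx2]] := Spt (- s2) ltac:(lra from eta0 eta2 W1 Jy hs2).
  have nMx2 : ~ M x2 by move=> /(SM _ Vx2); rewrite tx2.
  have WM2 x : V x -> - t' y < - t' x < s2 -> M x.
    by move=> Vx hx; apply/(SM x Vx); rewrite -[t' x]opprK; apply: above; lra from hx.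
  have e2 : - t' x2 = s2 by rewrite tx2 opprK.
  have [_ sup2] := ray_end r (fchart_neg cV) sV (u := - t' y) (v := s2)
     ltac:(lra from Jy) ltac:(lra from hs2) WM2 d00 avoid Vx2 e2 nMx2.
  have hx1 := fchart_J cM Mx1; rewrite /Iab /= in hx1.
  have [x [Vx hx tx]] := sup2 (t x1) ltac:(lra from hx1).
  have Mx := WM2 x Vx hx.
  by have [_ h] := F1 x Mx tx; lra from hs2 hx h.
(* G is the coordinate of V up to sign, oriented like F on the strip. *)
have [G [cG oG]] : exists G, fchart E V (Iab (- dl) dl) G t' /\
    forall x y, V x -> u < t' x < ss -> E x y -> F x < F y -> G x < G y.
  have [or1|or1] := fchart_orient cW (@Iab_interval _ _) cM (fun x h => WM x h.1 h.2).
    by exists F'; split => // x y Vx hx Exy h; apply/(or1 x y (conj Vx hx) Exy).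
  exists (fun x => - F' x); split; first exact: fchart_flipF.
  move=> x y Vx hx Exy h; rewrite ltrN2.
  have [Vy ty] := iffLR (fchart_E cV y Vx) Exy.
  by apply/(or1 y x); [split => //=; rewrite ty | exact: Esym | ].
pose A := M `&` [set x | t x <= t x1].
pose V2 := V `&` [set x | t' x1 < t' x < dl].
have cV2 : fchart E V2 (Iab (t' x1) dl) G t' by apply: (fchart_sub cG); lra from eta0 eta2.
pose N := M `|` V2.
have V2M x : V2 x -> M x -> t' x < ss /\ t x1 < t x.
  move=> [Vx /= hx] Mx; have h : t' x < ss by rewrite ltNge; apply/negP => h; exact: F2 h Mx.
  by split => //; apply/inc => //; rewrite /u; lra from eta0 hx h hx.
have V2A x : V2 x -> ~ A x by move=> V2x [Mx /= h]; have [_] := V2M x V2x Mx; lra from h.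
have MA x : M x -> ~ A x -> V2 x.
  move=> Mx nA; have [|Vx hx] := F1 x Mx; last by split => //=; lra from hss eta0 eta2 hx.
  by rewrite ltNge; apply/negP => h; apply: nA.
(* Transverse coordinate of the enlarged set: t below the leaf of x1 and t' above it, both shifted
   so as to vanish on that leaf. *)
pose tau x := if pselect (A x) then t x - t x1 else t' x - t' x1.
have tauA x : A x -> tau x = t x - t x1 by rewrite /tau; case: pselect.
have tauV x : ~ A x -> tau x = t' x - t' x1 by rewrite /tau; case: pselect.
have NP x : N x -> (A x /\ tau x <= 0) \/ (V2 x /\ 0 < tau x).
  move=> Nx; have [Ax|nAx] := pselect (A x).
    by left; split => //; rewrite tauA//; have := Ax.2; rewrite /=; lra from.
  have V2x : V2 x by case: Nx => // Mx; exact: MA.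
  by right; split => //; rewrite tauV//; have := V2x.2; rewrite /=; lra from.
have EN x y : N x -> (E x y <-> N y /\ tau y = tau x).
  move=> Nx; split=> [Exy|[Ny e']].
    have [[Ax _]|[V2x _]] := NP x Nx.
      have [My ty] := iffLR (fchart_E cM y Ax.1) Exy.
      have Ay : A y by split => //=; rewrite ty; exact: Ax.2.
      by split; [left | rewrite !tauA// ty].
    have [V2y ty] := iffLR (fchart_E cV2 y V2x) Exy.
    by split; [right | rewrite !tauV ?ty//; exact: V2A].
  have [[Ax hx]|[V2x hx]] := NP x Nx; have [[Ay hy]|[V2y hy]] := NP y Ny; try lra from e' hx hy.
    apply/(fchart_leaf cM Ax.1 Ay.1); move: e'; rewrite !tauA//; lra from.
  by apply/(fchart_leaf cV2 V2x V2y); move: e'; rewrite !tauV; [lra from | exact: V2A ..].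
have oM := fchart_open cM; have oV2 := fchart_open cV2.
have oN : open N by exact: openU.
have tauc x : N x -> tau y @[y --> x] --> tau x.
  move=> Nx; apply: rlim_itv => e' e'0; have [[Ax hx]|[V2x hx]] := NP x Nx; last first.
    have nV : \forall y \near x, V2 y by apply: open_nbhs_nbhs.
    have := rlim_near (nbhs_filter x) (fchart_t cV2 V2x) e'0 => nt.
    near=> y; have V2y : V2 y by near: y.
    by rewrite !tauV; [ | exact: V2A ..]; have : t' x - e' < t' y < t' x + e' by [near: y]; lra from.
  have nM : \forall y \near x, M y by apply: open_nbhs_nbhs; split => //; exact: Ax.1.
  have nt := rlim_near (nbhs_filter x) (fchart_t cM Ax.1) e'0.
  have := Ax.2; rewrite /= le_eqVlt => /orP[/eqP txx|txx].
    have Ex : E x1 x by apply/(fchart_leaf cM) => //; exact: Ax.1.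
    have [Vx tx] := iffLR (fchart_E cV x Vx1) Ex.
    have nt' := rlim_near (nbhs_filter x) (fchart_t cV Vx) e'0.
    near=> y; have My : M y by near: y.
    rewrite (tauA x Ax) txx subrr.
    have h1 : t x - e' < t y < t x + e' by near: y.
    have h2 : t' x - e' < t' y < t' x + e' by near: y.
    have [Ay|nAy] := pselect (A y); first by rewrite tauA//; lra from txx h1.
    by rewrite tauV//; lra from tx h2.
  have nl : \forall y \near x, t y < t x1 by apply: (cvgr_lt (t x)) => //; exact: (fchart_t cM Ax.1).
  near=> y; have My : M y by near: y.
  have hy : t y < t x1 by near: y.
  rewrite !tauA//; last by split => //=; exact: ltW.
  by have : t x - e' < t y < t x + e' by [near: y]; lra from.
have J1M := fchart_J cM Mx1; rewrite /Iab /= in J1M.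
have imN : tau @` N = Iab (- t x1) (dl - t' x1).
  apply/seteqP; split=> [_ [x Nx <-]|s hs].
    have [[Ax hx]|[V2x hx]] := NP x Nx.
      by have := fchart_J cM Ax.1; rewrite tauA// /Iab /=; move: hx; rewrite tauA//; lra from J1.
    have := V2A x V2x => nAx; have := fchart_J cV2 V2x; rewrite tauV// /Iab /=.
    by move: hx; rewrite tauV//; lra from J1M.
  rewrite /Iab /= in hs; have [s0'|s0'] := lerP s 0.
    have [x [Mx _ tx]] := fchart_at cM (x := 0) (s := s + t x1) ltac:(lra from) ltac:(rewrite /Iab /=; lra from J1M hs s0').
    exists x; first by left.
    by rewrite tauA; [rewrite tx; lra from | split => //=; lra from s0' tx].
  have [x [Vx _ tx]] := fchart_at cV2 (x := 0) (s := s + t' x1) ltac:(lra from) ltac:(rewrite /Iab /=; lra from hs s0').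
  by exists x; [right | rewrite tauV; [rewrite tx; lra from | exact: V2A]].
(* On the overlap 0 < tau < kap, the strip between x1 and the exit level ss, both F and G are
   defined and equally oriented. The first weight vanishes from kap on, the second up to 0. *)
pose kap := ss - t' x1.
have kap0 : 0 < kap by rewrite /kap; lra from W1.
pose c n x := if n is 0%N then clamp (1 - tau x / kap)
              else if n is 1%N then clamp (tau x / kap) else 0.
pose Fn (n : nat) := if n is 0%N then F else G.
have c0_pos x : 0 < c 0%N x <-> tau x < kap.
  by rewrite /c clamp_gt0 subr_gt0 ltr_pdivrMr// mul1r.
have c1_pos x : 0 < c 1%N x <-> 0 < tau x.
  by rewrite /c clamp_gt0 pmulr_lgt0// invr_gt0.
have NM x : N x -> tau x < kap -> M x.
  move=> Nx; have [[[Mx _] _]//|[V2x _]] := NP x Nx.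
  have [Vx hx] := V2x; rewrite (tauV _ (V2A x V2x)) /kap /= in hx * => h.
  by apply: WM => //; rewrite /u; lra from eta0 hx h.
have NV x : N x -> 0 < tau x -> V2 x.
  by move=> Nx h; have [[Ax hx]|[]//] := NP x Nx; lra.
have cb n x : N x -> 0 <= c n x <= 1.
  by move=> _; case: n => [|[|n]]; rewrite /c; [exact: clamp_bd | exact: clamp_bd | lra from].
have cc n x : N x -> c n y @[y --> x] --> c n x.
  move=> Nx; have tc : tau y / kap @[y --> x] --> tau x / kap.
    by apply: rlimM; [exact: tauc | exact: rlim_cst].
  case: n => [|[|n]]; rewrite /c; last exact: rlim_cst.
    by apply: (@clamp_cvg _ (fun y => 1 - tau y / kap)); apply: rlimB => //; exact: rlim_cst.
  exact: (@clamp_cvg _ (fun y => tau y / kap)).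
have cE n x y : N x -> E x y -> c n x = c n y.
  move=> Nx /(EN x y Nx) [_ e']; rewrite /c; case: n => [|[|n]]; by rewrite ?e'.
have cpos x : N x -> exists n, 0 < c n x.
  move=> Nx; have [h|h] := ltP (tau x) kap; first by exists 0%N; apply/c0_pos.
  by exists 1%N; apply/c1_pos; lra from kap0 h.
have charts n x : N x -> 0 < c n x -> exists U J' t'',
    [/\ fchart E U J' (Fn n) t'', open J', is_interval J', U x & U `<=` N].
  move=> Nx; case: n => [|[|n]] h.
  - exists M, (Iab 0 1), t; split => //; [exact: Iab_open | exact: Iab_interval
      | exact/NM/c0_pos | by move=> y My; left].
  - exists V2, (Iab (t' x1) dl), t'; split => //; [exact: Iab_open | exact: Iab_interval
      | exact/NV/c1_pos | by move=> y Vy; right].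
  by move: h; rewrite /c ltxx.
have ori01 x y : N x -> E x y -> 0 < c 0%N x -> 0 < c 1%N x -> F x < F y -> G x < G y.
  move=> Nx Exy /c0_pos h1 /c1_pos h2; have V2x := NV x Nx h2; have [Vx hx] := V2x.
  apply: oG => //; rewrite (tauV _ (V2A x V2x)) /kap /= in h1 h2 hx *; rewrite /u; lra from eta0 h1 hx.
have ori n m x y : N x -> E x y -> 0 < c n x -> 0 < c m x -> Fn n x < Fn n y -> Fn m x < Fn m y.
  move=> Nx Exy; case: n => [|[|n]]; case: m => [|[|m]] //; rewrite ?[c _.+2 x]/c ?ltxx//.
    exact: ori01.
  move=> h1 h0 h; have Mx := NM x Nx (iffLR (c0_pos x) h0).
  have My := fchart_sat cM Mx Exy; case: (ltrgtP (F x) (F y)) => // [h2|h2]; exfalso.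
    have [Ny ey] := iffLR (EN x y Nx) Exy.
    have := ori01 y x Ny (Esym Exy); rewrite -!(cE _ _ _ Nx Exy) => /(_ h0 h1 h2).
    by move: h; rewrite /Fn; lra from.
  suff exy : x = y by move: h; rewrite exy ltxx.
  by apply: (fchart_inj cM) => //; apply/(fchart_leaf cM).
have cN : fchart E N (tau @` N) (blend c Fn) tau by apply: fchart_glue.
rewrite imN in cN.
have kl : - t x1 < dl - t' x1 by lra from J1 J1M.
suff rN : ray E Q P0 F0 t0 N (blend c Fn) (fun x => (tau x - - t x1) / (dl - t' x1 - - t x1)).
  by apply: nMxs; apply: (maxM _ _ _ rN); right; split => //=; lra from hss txs eta0 eta2.
split; first exact: fchart_affine.
- by move=> x [/sM//|[Vx _]]; exact: sV.
- by move=> x [Mx|[Vx _]]; [exact: nM0 | exact: avoid0].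
have [d [d00' d1 d2]] := @pos_min dg d0 ltac:(lra from hdg) d00.
have igd := germ_le d00' d1 ig.
have gA x : germ P0 t0 d x -> A x.
  move=> gx; have Mx := igd.1 x gx; split => //=; rewrite leNgt; apply/negP => h.
  have [[P0x1 /= g1] _] := igd.2 x x1 gx Mx1 h.
  by apply: (avoid x1 Vx1); split => //=; lra from d2 g1.
exists d; split; first lra from hdg d00' d1.
  split=> [x /gA Ax|x y gx Ny]; first by left; exact: Ax.1.
  rewrite ltr_pM2r; last by rewrite invr_gt0; lra from kl.
  have Ax := gA x gx; rewrite (tauA x Ax) => h.
  have := Ax.2; rewrite /= => hx.
  have [[Ay hy]|[V2y hy]] := NP y Ny; last by lra from h hx hy.
  by apply: igd.2 => //; [exact: Ay.1 | move: h; rewrite tauA//; lra from].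
move=> x y gx Exy hF; have Ax := gA x gx.
have Nx : N x by left; exact: Ax.1.
have charts' n z : N z -> 0 < c n z -> exists U J' t'', fchart E U J' (Fn n) t'' /\ U z.
  by move=> Nz /(charts n z Nz)[U [J' [t'' [k _ _ Uz _]]]]; exists U, J', t''.
apply: (@blend_lt _ E N tau c Fn EN cb cE cpos charts' ori 0%N x y Nx Exy).
  by apply/c0_pos; rewrite tauA//; have := Ax.2; rewrite /=; lra from kap0.
by apply: og => //; move: gx => [? /= gx]; split => //=; lra from d1 gx.
Unshelve. all: by end_near. Qed.

(** If w is neither in M nor on the base leaf, its leaf is separated from the base leaf, so a chart
    V around w avoids a slab around the latter. A point of M in V lies below or above w, and
    [no_extension] excludes both, the second after reversing t'. *)
Lemma max_ray_closure M F t w : ray E Q P0 F0 t0 M F t ->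
  (forall P' F' t', ray E Q P0 F0 t0 P' F' t' -> P' `<=` M) ->
  Q w -> closure M w -> M w \/ (P0 w /\ t0 w = 0).
Proof.
move=> r maxM Qw clw; apply: contrapT => /not_orP[nMw n0w].
have [p0 [Pp0 _ tp0]] := fchart_at c0 (x := 0) (s := 0) ltac:(lra) ltac:(rewrite /Iab /=; lra).
have nE : ~ E w p0.
  by move=> /Esym /(fchart_E c0 w Pp0) [Pw tw]; apply: n0w; rewrite tw.
have [A [B [nA nB AB]]] : exists A B, [/\ nbhs w A, nbhs p0 B &
    forall a b, A a -> B b -> ~ E a b].
  apply: contrapT => no; apply: nE; apply: (rg_sep rg) => //; first exact: s0.
  move=> A B nA nB; apply: contrapT => no'; apply: no; exists A, B; split => // a b Aa Bb Eab.
  by apply: no'; exists a, b.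
have [V0 [F' [t' [cV0 V0w tw sV0]]]] := rg_chart rg Qw.
have [d1 [d10 H1]] := fchart_near cV0 V0w nA.
have [d0 [d00 H0]] := fchart_near c0 Pp0 nB.
have [dl [dl0 dl1 dl2]] := @pos_min d1 1 d10 ltac:(lra).
have cV := fchart_sub cV0 (a' := - dl) (b' := dl) ltac:(lra) ltac:(lra).
set V := V0 `&` _ in cV.
have avoid x : V x -> P0 x -> - d0 < t0 x < d0 -> False.
  move=> [Vx /= hx] P0x ht.
  have [a [_ Aa _ Ea]] := H1 x Vx ltac:(rewrite tw; lra).
  have [b [_ Bb _ Eb]] := H0 x P0x ltac:(rewrite tp0; lra).
  by apply: (AB a b Aa Bb); apply: Etrans Eb; exact: Esym.
have Vw : V w by split => //=; rewrite tw; lra.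
have nV : nbhs w V by apply: (fchart_nbhs cV).
have [x1 [Mx1 Vx1]] := clw V nV.
have sV : V `<=` Q by move=> x [/sV0].
have av1 x : V x -> ~ germ P0 t0 d0 x by move=> Vx [P0x /= h]; apply: (avoid x) => //; lra.
have av2 x : V x -> ~ (P0 x /\ t0 x = 0) by move=> Vx [P0x h]; apply: (avoid x) => //; lra.
case: (ltrgtP (t' x1) 0) => h.
- exact: (no_extension r maxM cV sV d00 av1 av2 Vw tw nMw Vx1 Mx1 h).
- have cV' := fchart_neg cV; rewrite opprK in cV'.
  by apply: (no_extension r maxM cV' sV d00 av1 av2 Vw _ nMw Vx1 Mx1); rewrite ?tw ?oppr0//; lra.
- have [cM _ _ _] := r; apply: nMw; apply: (fchart_sat cM Mx1).
  by apply/(fchart_leaf cV) => //; rewrite tw.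
Qed.

End extension.

(** * Structure of a component *)

Lemma wsumZ (a : R) (u : nat -> R) : -1 <= a <= 1 -> bdd1 u ->
  wsum (fun n => a * u n) = a * wsum u.
Proof.
move=> a1 ub; have ub' : bdd1 (fun n => a * u n) by move=> n; have := ub n; nra.
have E N : psum (fun n => a * u n) N = a * psum u N.
  by rewrite /psum mulr_sumr; apply: eq_bigr => i _; rewrite mulrCA.
have key N : - (2 * hw N) <= wsum (fun n => a * u n) - a * wsum u <= 2 * hw N.
  have := wsum_near N ub; have := wsum_near N ub'; rewrite E; have := hw0 N.
  set x := hw N; set y := psum u N; set z := wsum _; set v := wsum _ => h1 h2 h3.
  have : - x <= a * (v - y) <= x by nra.
  by lra.
apply/eqP; rewrite eq_le !leNgt; apply/andP; split; apply/negP => h.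
  have [N hN] := @hw_small ((wsum (fun n => a * u n) - a * wsum u) / 4) ltac:(lra).
  by have := key N; lra.
have [N hN] := @hw_small ((a * wsum u - wsum (fun n => a * u n)) / 4) ltac:(lra).
by have := key N; lra.
Qed.

(** Closing up along the base leaf requires a coordinate which is literally equal to a given one
    near each end, and not merely equally oriented. *)
Lemma blend_single (T : topologicalType) (c F : nat -> T -> R) (n : nat) (q : T) :
  (forall m, 0 <= c m q <= 1) -> -1 <= F n q <= 1 -> 0 < c n q ->
  (forall m, m != n -> c m q = 0) -> blend c F q = F n q.
Proof.
move=> cb Fb cn c0; have bc : bdd1 (c^~ q) by move=> m; have := cb m; lra.
have bc' : bdd1 (fun m => - c m q) by move=> m; have := cb m; lra.
have W0 : 0 < wsum (c^~ q).
  have : wsum (fun m => - c m q) < wsum (c^~ q).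
    by apply: (@wsum_lt _ _ n) => // [m|]; [have := cb m; lra | lra].
  by rewrite wsumN//; lra.
rewrite /blend (_ : (fun m => _) = (fun m => F n q * c m q)).
  by rewrite wsumZ// mulfK// gt_eqF.
apply: funext => m; have [->|mn] := eqVneq m n; first by rewrite mulrC.
by rewrite c0// mul0r mulr0.
Qed.

(** The band M is the complement of the base leaf, and its two ends approach the base leaf from the
    two sides. Near them G is exactly F0 and [eps * F0], so that eps = 1 yields the cylinder and eps
    = -1 the Möbius band. The last four fields state that t tends to 0 or 1 exactly as t0 tends to 0
    from above or from below. *)
Record circle_data (T : topologicalType) (E : T -> T -> Prop) (Q P0 M : set T)
    (F0 t0 G t : T -> R) (eps : R) : Prop := CircleData {
  cd_base : fchart E P0 (Iab (-1) 1) F0 t0;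
  cd_base_sub : P0 `<=` Q;
  cd_band : fchart E M (Iab 0 1) G t;
  cd_cover : forall x, Q x <-> M x \/ (P0 x /\ t0 x = 0);
  cd_disj : forall x, M x -> ~ (P0 x /\ t0 x = 0);
  cd_eps : eps = 1 \/ eps = -1;
  cd_low : forall d : R, 0 < d -> exists2 e : R, 0 < e & forall x, M x -> t x < e ->
    [/\ P0 x, 0 < t0 x < d & G x = F0 x];
  cd_high : forall d : R, 0 < d -> exists2 e : R, 0 < e & forall x, M x -> 1 - e < t x ->
    [/\ P0 x, - d < t0 x < 0 & G x = eps * F0 x];
  cd_right : forall e : R, 0 < e -> exists2 d : R, 0 < d &
    forall x, P0 x -> 0 < t0 x < d -> M x /\ t x < e;
  cd_left : forall e : R, 0 < e -> exists2 d : R, 0 < d &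
    forall x, P0 x -> - d < t0 x < 0 -> M x /\ 1 - e < t x }.

Section structure.
Variables (T : topologicalType) (E : T -> T -> Prop) (Q : set T).
Implicit Types (P : set T) (F t : T -> R).
Hypothesis rg : regular E Q.
Hypothesis cQ : connected Q.

Let Esym := rg_sym rg.
Let Etrans := rg_trans rg.

Lemma leaf_closed p x : Q p -> Q x -> closure [set y | E p y] x -> E p x.
Proof.
move=> Qp Qx clx; apply: Esym; apply: (rg_sep rg) => // A B nA nB.
have [y [/= Epy Ay]] := clx A nA; exists y, p; split => //; last exact: Esym.
exact: nbhs_singleton.
Qed.

Variables (P0 : set T) (F0 t0 : T -> R) (p0 : T).
Hypothesis c0 : fchart E P0 (Iab (-1) 1) F0 t0.
Hypothesis s0 : P0 `<=` Q.
Hypothesis P0p0 : P0 p0.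
Hypothesis tp0 : t0 p0 = 0.

Let c0' : fchart E P0 (Iab (-1) 1) F0 (fun x => - t0 x).
Proof. by have := fchart_neg c0; rewrite opprK. Qed.

Variables (M1 M2 : set T) (F1 t1 F2 t2 : T -> R).
Hypothesis r1 : ray E Q P0 F0 t0 M1 F1 t1.
Hypothesis max1 : forall P' F' t', ray E Q P0 F0 t0 P' F' t' -> P' `<=` M1.
Hypothesis r2 : ray E Q P0 F0 (fun x => - t0 x) M2 F2 t2.
Hypothesis max2 : forall P' F' t', ray E Q P0 F0 (fun x => - t0 x) P' F' t' -> P' `<=` M2.

Let w0 : set T := P0 `&` [set x | t0 x = 0].

Let w0E x : w0 x <-> E p0 x.
Proof. by rewrite (fchart_E c0 x P0p0) tp0. Qed.

Let M1w x : M1 x -> ~ w0 x.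
Proof. by have [_ _ h _] := r1; exact: h. Qed.

Let M2w x : M2 x -> ~ w0 x.
Proof. by have [_ _ h _] := r2 => M2x [P0x /= e]; apply: (h x M2x); rewrite e oppr0. Qed.

Let cl1 x : Q x -> closure M1 x -> M1 x \/ w0 x.
Proof. exact: (max_ray_closure rg c0 s0 r1 max1). Qed.

Let cl2 x : Q x -> closure M2 x -> M2 x \/ w0 x.
Proof.
move=> Qx h; case: (max_ray_closure rg c0' s0 r2 max2 Qx h) => [|[P0x e]]; first by left.
by right; split => //=; lra.
Qed.

Let oM1 : open M1. Proof. by have [c _ _ _] := r1; exact: fchart_open c. Qed.
Let oM2 : open M2. Proof. by have [c _ _ _] := r2; exact: fchart_open c. Qed.

Let g1 (e : R) : 0 < e -> exists2 d : R, 0 < d & forall x, P0 x -> 0 < t0 x < d -> M1 x /\ t1 x < e.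
Proof.
move=> e0; have [d [d1 sub h]] := ray_germ_small c0 r1 e0; exists d; first lra.
by move=> x P0x hx; split; [apply: sub; split | apply: h; split].
Qed.

Let g2 (e : R) : 0 < e -> exists2 d : R, 0 < d & forall x, P0 x -> - d < t0 x < 0 -> M2 x /\ t2 x < e.
Proof.
move=> e0; have [d [d1 sub h]] := ray_germ_small c0' r2 e0; exists d; first lra.
by move=> x P0x hx; split; [apply: sub; split => //=; lra | apply: h; split => //=; lra].
Qed.

Let h1 (d : R) : 0 < d -> exists2 e : R, 0 < e & forall x, M1 x -> t1 x < e ->
  [/\ P0 x, 0 < t0 x < d & forall y, E x y -> (F0 x < F0 y -> F1 x < F1 y)].
Proof.
have [_ _ _ [dg [hdg _ og]]] := r1 => d0.
have [d' [d'0 e1 e2]] := @pos_min d dg d0 ltac:(lra).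
have [e e0 h] := ray_small_germ c0 r1 d'0; exists e => // x Mx tx.
have [P0x /= hx] := h x Mx tx; split => //; first by lra.
by move=> y Exy; apply: og => //; split => //=; lra.
Qed.

Let h2 (d : R) : 0 < d -> exists2 e : R, 0 < e & forall x, M2 x -> t2 x < e ->
  [/\ P0 x, - d < t0 x < 0 & forall y, E x y -> (F0 x < F0 y -> F2 x < F2 y)].
Proof.
have [_ _ _ [dg [hdg _ og]]] := r2 => d0.
have [d' [d'0 e1 e2]] := @pos_min d dg d0 ltac:(lra).
have [e e0 h] := ray_small_germ c0' r2 d'0; exists e => // x Mx tx.
have [P0x /= hx] := h x Mx tx; split => //; first by lra.
by move=> y Exy; apply: og => //; split => //=; lra.
Qed.

Let near0 : exists2 d : R, 0 < d & forall x, P0 x -> - d < t0 x < d -> [\/ M1 x, w0 x | M2 x].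
Proof.
have [d1 d10 H1] := @g1 1 ltac:(lra); have [d2 d20 H2] := @g2 1 ltac:(lra).
have [d [d0 e1 e2]] := pos_min d10 d20; exists d => // x P0x hx.
case: (ltrgtP (t0 x) 0) => h.
- by apply: Or33; have [] := H2 x P0x ltac:(lra).
- by apply: Or31; have [] := H1 x P0x ltac:(lra).
- by apply: Or32.
Qed.

Lemma cover3 x : Q x -> [\/ M1 x, w0 x | M2 x].
Proof.
pose B := M1 `|` w0 `|` M2.
suff -> : Q = B by move=> [[?|?]|?]; [exact: Or31 | exact: Or32 | exact: Or33].
have sB : B `<=` Q.
  move=> y [[M1y|[P0y _]]|M2y]; last by have [_ h _ _] := r2; exact: h.
    by have [_ h _ _] := r1; exact: h.
  exact: s0.
apply/esym; apply: cQ; first by exists p0; left; right; apply/w0E; exact: (rg_refl rg).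
  have [d d0 H] := near0.
  exists (M1 `|` (P0 `&` [set y | - d < t0 y < d]) `|` M2).
    have cd := fchart_sub c0 (a' := Num.max (-1) (- d)) (b' := Num.min 1 d)
      ltac:(by rewrite le_max lexx) ltac:(by rewrite ge_min lexx).
    apply: openU => //; apply: openU => //.
    rewrite (_ : _ `&` _ = P0 `&` [set y | Num.max (-1) (- d) < t0 y < Num.min 1 d]).
      exact: fchart_open cd.
    apply/seteqP; split=> y [P0y /= hy]; split => //=.
      have := fchart_J c0 P0y; rewrite /Iab /= => h; rewrite gt_max lt_min; lra.
    by move: hy; rewrite gt_max lt_min; lra.
  apply/seteqP; split=> y.
    move=> By; split; first exact: sB.
    by case: By => [[?|[P0y /= ty]]|?]; [left; left | left; right; split => //=; rewrite ty; lra | right].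
  by move=> [Qy [[?|[P0y hy]]|?]]; [left; left | have [] := H y P0y hy; [left; left | left; right | right] | right].
exists (closure B); first exact: closed_closure.
apply/seteqP; split=> y; first by move=> By; split; [exact: sB | exact: subset_closure].
move=> [Qy]; rewrite !closureU => -[[h|h]|h].
- by case: (cl1 Qy h) => ?; left; [left | right].
- left; right; apply/w0E; apply: leaf_closed => //; first exact: s0.
  by apply: closureS h => z /w0E.
- by case: (cl2 Qy h) => ?; [right | left; right].
Qed.

Let P0w : w0 p0. Proof. by split. Qed.

Let c1 : fchart E M1 (Iab 0 1) F1 t1. Proof. by case: r1. Qed.
Let c2 : fchart E M2 (Iab 0 1) F2 t2. Proof. by case: r2. Qed.
Let s1 : M1 `<=` Q. Proof. by case: r1. Qed.
Let s2 : M2 `<=` Q. Proof. by case: r2. Qed.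

Tactic Notation "lra" "from" hyp_list(hs) :=
  clear - hs rg cQ Esym Etrans c0 s0 P0p0 tp0 c0' r1 max1 r2 max2 w0 w0E M1w M2w cl1 cl2 oM1 oM2 g1 g2 h1 h2 near0 P0w c1 c2 s1 s2; lra.

Lemma line_case : (forall x, M1 x -> ~ M2 x) -> exists F t, fchart E Q (Iab (-1) 1) F t.
Proof.
move=> disj.
pose tau x := if pselect (M1 x) then t1 x else if pselect (M2 x) then - t2 x else 0.
have tau1 x : M1 x -> tau x = t1 x by rewrite /tau; case: (pselect (M1 x)).
have tau2 x : M2 x -> tau x = - t2 x.
  move=> M2x; rewrite /tau; case: (pselect (M1 x)) => [M1x|?] /=; first by case: (disj x M1x M2x).
  by case: (pselect (M2 x)).
have tau0 x : w0 x -> tau x = 0.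
  by move=> wx; rewrite /tau; case: (pselect (M1 x)) => [/M1w//|?] /=; case: (pselect (M2 x)) => [/M2w//|?].
have b1 x : M1 x -> 0 < t1 x < 1 by move=> /(fchart_J c1).
have b2 x : M2 x -> 0 < t2 x < 1 by move=> /(fchart_J c2).
have tri x : Q x -> [\/ (M1 x /\ 0 < tau x), (w0 x /\ tau x = 0) | (M2 x /\ tau x < 0)].
  move=> /cover3[h|h|h].
  - by apply: Or31; split => //; rewrite tau1//; have := b1 x h; lra.
  - by apply: Or32; split => //; rewrite tau0.
  - by apply: Or33; split => //; rewrite tau2//; have := b2 x h; lra.
have EQ x y : Q x -> (E x y <-> Q y /\ tau y = tau x).
  move=> Qx; split=> [Exy|[Qy]].
    split; first exact: (rg_sat rg Qx).
    case: (tri x Qx) => -[h _].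
    - by have [h' e] := iffLR (fchart_E c1 y h) Exy; rewrite !tau1.
    - have h' : w0 y by apply/w0E; apply: Etrans Exy; exact/w0E.
      by rewrite !tau0.
    - by have [h' e] := iffLR (fchart_E c2 y h) Exy; rewrite !tau2// e.
  case: (tri x Qx) => -[hx ex]; case: (tri y Qy) => -[hy ey] e; try lra.
  - by apply/(fchart_leaf c1) => //; rewrite -!tau1.
  - by apply: Etrans (iffLR (w0E y) hy); apply: Esym; exact/w0E.
  - by apply/(fchart_leaf c2) => //; move: e; rewrite !tau2//; lra.
have tauc x : Q x -> tau y @[y --> x] --> tau x.
  move=> Qx; apply: rlim_itv => e e0; case: (tri x Qx) => -[h _].
  - have nM : \forall y \near x, M1 y by apply: open_nbhs_nbhs.
    have nt := rlim_near (nbhs_filter x) (fchart_t c1 h) e0.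
    near=> y; have My : M1 y by near: y.
    by rewrite !tau1//; near: y.
  - have [d1 d10 H1] := g1 e0; have [d2 d20 H2] := g2 e0.
    have [d [d0 e1 e2]] := pos_min d10 d20.
    have nP : \forall y \near x, P0 y.
      by apply: (fchart_nbhs c0); exact: h.1.
    have nt := rlim_near (nbhs_filter x) (fchart_t c0 h.1) d0.
    rewrite (tau0 x h); rewrite h.2 in nt.
    near=> y; have P0y : P0 y by near: y.
    have ty : 0 - d < t0 y < 0 + d by near: y.
    case: (ltrgtP (t0 y) 0) => hy.
    + by have [My ht] := H2 y P0y ltac:(lra from e2 ty hy); rewrite tau2//; have := b2 y My; lra from ht.
    + by have [My ht] := H1 y P0y ltac:(lra from e1 ty hy); rewrite tau1//; have := b1 y My; lra from ht.
    + by rewrite tau0//; lra.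
  - have nM : \forall y \near x, M2 y by apply: open_nbhs_nbhs.
    have nt := rlim_near (nbhs_filter x) (fchart_t c2 h) e0.
    near=> y; have My : M2 y by near: y.
    by rewrite !tau2//; have : t2 x - e < t2 y < t2 x + e by [near: y]; lra.
have [k1 k10 K1] := @h1 1 ltac:(lra); have [k2 k20 K2] := @h2 1 ltac:(lra).
(* Leaves with |tau| < k lie in P0, and there F1 and F2 are oriented like F0. Since the two rays are
   disjoint, orientations only have to be compared with that of P0. *)
have [k [k0 e1 e2]] := pos_min k10 k20.
pose c n x := if n is 0%N then clamp (1 - Num.max (tau x) (- tau x) / k)
  else if n is 1%N then clamp (tau x) else if n is 2%N then clamp (- tau x) else 0.
pose Fn n := if n is 0%N then F0 else if n is 1%N then F1 else F2.
have c0_pos x : 0 < c 0%N x <-> - k < tau x < k.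
  rewrite /c clamp_gt0 subr_gt0 ltr_pdivrMr// mul1r gt_max; split; lra from.
have c1_pos x : 0 < c 1%N x <-> 0 < tau x by rewrite /c clamp_gt0.
have c2_pos x : 0 < c 2%N x <-> tau x < 0 by rewrite /c clamp_gt0 oppr_gt0.
have c3_pos n x : 0 < c n.+3 x -> False by rewrite /c ltxx.
have QM1 x : Q x -> 0 < tau x -> M1 x by move=> /tri[[]//|[_ ->]|[_ ha]] hb; exfalso; lra.
have QM2 x : Q x -> tau x < 0 -> M2 x by move=> /tri[[_ ha]|[_ ->]|[]//] hb; exfalso; lra.
have QP x : Q x -> - k < tau x < k -> P0 x.
  move=> Qx hx; case: (tri x Qx) => -[h h'].
  - by have [] := K1 x h ltac:(rewrite -tau1//; lra from e1 hx).
  - by case: h.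
  - by have [] := K2 x h ltac:(move: hx; rewrite tau2//; lra).
have cb n x : Q x -> 0 <= c n x <= 1.
  by move=> _; case: n => [|[|[|n]]]; rewrite /c ?clamp_bd//; lra from.
have cc n x : Q x -> c n y @[y --> x] --> c n x.
  move=> Qx; case: n => [|[|[|n]]]; rewrite /c; last exact: rlim_cst.
  - apply: (@clamp_cvg _ (fun y => 1 - Num.max (tau y) (- tau y) / k)).
    apply: rlimB; first exact: rlim_cst.
    apply: rlimM; last exact: rlim_cst.
    by apply: rlim_max; [exact: tauc | apply: rlimN; exact: tauc].
  - by apply: clamp_cvg; exact: tauc.
  - by apply: (@clamp_cvg _ (fun y => - tau y)); apply: rlimN; exact: tauc.
have cE n x y : Q x -> E x y -> c n x = c n y.
  by move=> Qx /(EQ x y Qx) [_ e']; rewrite /c e'.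
have cpos x : Q x -> exists n, 0 < c n x.
  move=> Qx; case: (ltrgtP (tau x) 0) => h.
  - by exists 2%N; apply/c2_pos.
  - by exists 1%N; apply/c1_pos.
  - by exists 0%N; apply/c0_pos; rewrite h; lra.
have charts n x : Q x -> 0 < c n x -> exists U J' t'',
    [/\ fchart E U J' (Fn n) t'', open J', is_interval J', U x & U `<=` Q].
  move=> Qx; case: n => [|[|[|n]]] h; last by case: (c3_pos n x h).
  - by exists P0, (Iab (-1) 1), t0; split => //; [exact: Iab_open | exact: Iab_interval
      | exact/QP/c0_pos].
  - by exists M1, (Iab 0 1), t1; split => //; [exact: Iab_open | exact: Iab_interval
      | exact/QM1/c1_pos].
  - by exists M2, (Iab 0 1), t2; split => //; [exact: Iab_open | exact: Iab_interval
      | exact/QM2/c2_pos].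
have ori0 n x y : (0 < n)%N -> Q x -> E x y -> 0 < c 0%N x -> 0 < c n x ->
    F0 x < F0 y -> Fn n x < Fn n y.
  move=> n0 Qx Exy /c0_pos hk; case: n n0 => [//|[|[|n]]] _ h; last by case: (c3_pos n x h).
  - move/c1_pos: h => h; have Mx := QM1 x Qx h.
    by have [_ _] := K1 x Mx ltac:(rewrite -tau1//; lra from e1 hk); apply.
  - move/c2_pos: h => h; have Mx := QM2 x Qx h.
    by have [_ _] := K2 x Mx ltac:(move: hk; rewrite tau2//; lra from e2); apply.
have ori n m x y : Q x -> E x y -> 0 < c n x -> 0 < c m x -> Fn n x < Fn n y -> Fn m x < Fn m y.
  move=> Qx Exy hn hm; have [->//|nm] := eqVneq n m.
  case: n hn nm => [|n] hn nm; first by apply: ori0 => //; rewrite lt0n eq_sym.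
  case: m hm nm => [|m] hm nm.
    have P0x := QP x Qx (iffLR (c0_pos x) hm).
    have P0y := fchart_sat c0 P0x Exy.
    case: (ltrgtP (F0 x) (F0 y)) => // h h'; exfalso.
      have [Qy ey] := iffLR (EQ x y Qx) Exy.
      have := ori0 n.+1 y x erefl Qy (Esym Exy); rewrite -!(cE _ _ _ Qx Exy) => /(_ hm hn h).
      by lra.
    suff exy : x = y by move: h'; rewrite exy ltxx.
    by apply: (fchart_inj c0) => //; apply/(fchart_leaf c0).
  case: n hn nm => [|[|n]] hn nm; last by case: (c3_pos n x hn).
    case: m hm nm => [|[|m]] hm nm //; last by case: (c3_pos m x hm).
    by move/c1_pos: hn; move/c2_pos: hm; lra.
  case: m hm nm => [|[|m]] hm nm //.
  by move/c1_pos: hm; move/c2_pos: hn; lra.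
have imQ : tau @` Q = Iab (-1) 1.
  apply/seteqP; split=> [_ [x Qx <-]|s hs].
    rewrite /Iab /=; case: (tri x Qx) => -[h e].
    - by rewrite tau1//; have := b1 x h; lra from.
    - by rewrite e; lra.
    - by rewrite tau2//; have := b2 x h; lra from.
  rewrite /Iab /= in hs; case: (ltrgtP s 0) => h.
  - have [x [Mx _ tx]] := fchart_at c2 (x := 0) (s := - s) ltac:(lra from) ltac:(rewrite /Iab /=; lra from hs h).
    by exists x; [exact: s2 | rewrite tau2// tx opprK].
  - have [x [Mx _ tx]] := fchart_at c1 (x := 0) (s := s) ltac:(lra from) ltac:(rewrite /Iab /=; lra from hs h).
    by exists x; [exact: s1 | rewrite tau1].
  - by exists p0; [exact: s0 | rewrite tau0].
have cQ' : fchart E Q (tau @` Q) (blend c Fn) tau.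
  by apply: fchart_glue => //; exact: rg_open rg.
by rewrite imQ in cQ'; exists (blend c Fn), tau.
Unshelve. all: by end_near. Qed.

Lemma circle_case x0 : M1 x0 -> M2 x0 ->
  exists G eps, circle_data E Q P0 M1 F0 t0 G t1 eps.
Proof.
move=> M1x0 M2x0.
(* Inside the connected M2, the set M1 is open, and closed as well: its closure in Q adds at most
   the base leaf, which M2 avoids. The same holds with the rays exchanged. *)
have sM : M2 `<=` M1.
  have := fchart_conn c2 (@Iab_interval _ _).
  move=> /(_ (M2 `&` M1) ltac:(by exists x0) ltac:(by exists M1)) h x M2x.
  suff : (M2 `&` M1) x by case.
  rewrite h//; exists (closure M1); first exact: closed_closure.
  apply/seteqP; split=> y [M2y h']; split => //; first exact: subset_closure.
  by case: (cl1 (s2 M2y) h') => // /(M2w M2y).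
have sM' : M1 `<=` M2.
  have := fchart_conn c1 (@Iab_interval _ _).
  move=> /(_ (M1 `&` M2) ltac:(by exists x0) ltac:(by exists M2)) h x M1x.
  suff : (M1 `&` M2) x by case.
  rewrite h//; exists (closure M2); first exact: closed_closure.
  apply/seteqP; split=> y [M1y h']; split => //; first exact: subset_closure.
  by case: (cl2 (s1 M1y) h') => // /(M1w M1y).
have hc x : M1 x -> t2 y @[y --> x] --> t2 x by move=> /sM'; exact: (fchart_t c2).
have hi x y : M1 x -> M1 y -> (t2 x = t2 y <-> t1 x = t1 y).
  move=> M1x M1y; rewrite -(fchart_leaf c1)//.
  by rewrite (fchart_leaf c2 (sM' _ M1x) (sM' _ M1y)).
have b1 x : M1 x -> 0 < t1 x < 1 by move=> /(fchart_J c1).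
have [m|m] := fchart_mono c1 (@Iab_interval _ _) hc hi.
  (* If t2 increased with t1, a leaf with both small would have t0 > 0 and t0 < 0. *)
  exfalso; have [e2 e20 K2] := @h2 1 ltac:(lra); have [e1 e10 K1] := @h1 1 ltac:(lra).
  have [e3 [e30 e4 e5]] := @pos_min e2 1 e20 ltac:(lra).
  have [y [M2y _ ty]] := fchart_at c2 (x := 0) (s := e3 / 2) ltac:(lra) ltac:(rewrite /Iab /=; lra).
  have M1y := sM _ M2y; have by1 := b1 y M1y.
  have [e6 [e60 e7 e8]] := @pos_min e1 (t1 y) e10 ltac:(lra).
  have [x [M1x _ tx]] := fchart_at c1 (x := 0) (s := e6 / 2) ltac:(lra from) ltac:(rewrite /Iab /=; lra from by1 e60 e8).
  have h := iffRL (m x y M1x M1y) ltac:(lra).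
  have [_ k2 _] := K2 x (sM' _ M1x) ltac:(lra from e30 e4 ty h).
  by have [_ k1 _] := K1 x M1x ltac:(lra from e60 e7 tx); lra from k2 k1.
have high (d : R) : 0 < d -> exists2 e : R, 0 < e & forall x, M1 x -> 1 - e < t1 x ->
    [/\ P0 x, - d < t0 x < 0 & forall y, E x y -> (F0 x < F0 y -> F2 x < F2 y)].
  move=> d0; have [e2 e20 K2] := h2 d0.
  have [e3 [e30 e4 e5]] := @pos_min e2 1 e20 ltac:(lra).
  have [y [M2y _ ty]] := fchart_at c2 (x := 0) (s := e3 / 2) ltac:(lra) ltac:(rewrite /Iab /=; lra).
  have M1y := sM _ M2y; have by1 := b1 y M1y.
  exists (1 - t1 y); first by lra.
  move=> x M1x hx; apply: K2; first exact: sM'.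
  by have := iffRL (m x y M1x M1y) ltac:(lra from hx); lra from e30 e4 ty.
(* F1 and F2 both continue the orientation of F0, from opposite sides of the base leaf; eps records
   whether they agree on the band. *)
have [eps [eps1 epsF]] : exists eps : R, (eps = 1 \/ eps = -1) /\
    forall x y, M1 x -> E x y -> F2 x < F2 y -> eps * F1 x < eps * F1 y.
  have [or1|or1] := fchart_orient c2 (@Iab_interval _ _) c1 sM.
    exists 1; split; first by left.
    by move=> x y M1x Exy h; rewrite !mul1r; apply/(or1 x y (sM' _ M1x) Exy).
  exists (-1); split; first by right.
  by move=> x y M1x Exy h; rewrite !mulN1r ltrN2; apply/(or1 x y (sM' _ M1x) Exy).
have [d1' d10' H1'] := @g1 1 ltac:(lra); have [d2' d20' H2'] := @g2 1 ltac:(lra).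
have [d1 [d10 d11 d12]] := @pos_min d1' 1 d10' ltac:(lra).
have [d2 [d20 d21 d22]] := @pos_min d2' 1 d20' ltac:(lra).
have H1 x : P0 x -> 0 < t0 x < d1 -> M1 x /\ t1 x < 1 by move=> ? ?; apply: H1' => //; lra.
have H2 x : P0 x -> - d2 < t0 x < 0 -> M2 x /\ t2 x < 1 by move=> ? ?; apply: H2' => //; lra.
have [k1 k10 K1] := h1 d10; have [k2 k20 K2] := high d2 d20.
have [k' [k'0 e1 e2]] := pos_min k10 k20.
have [k [k0 e3 e4]] := @pos_min k' (1 / 2) k'0 ltac:(lra from).
(* For t1 < k / 2 only the first weight is positive, for t1 > 1 - k / 2 only the third, so the blend
   is exactly F0, respectively [eps * F0], near the ends. The bound k <= 1/2 keeps the supports of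
   these two weights apart. *)
pose c n x := if n is 0%N then clamp (1 - t1 x / k)
  else if n is 1%N then clamp (Num.min (t1 x - k / 2) (1 - k / 2 - t1 x))
  else if n is 2%N then clamp (1 - (1 - t1 x) / k) else 0.
pose Fn n := if n is 0%N then F0 else if n is 1%N then F1 else (fun x => eps * F0 x).
have c0_pos x : 0 < c 0%N x <-> t1 x < k.
  by rewrite /c clamp_gt0 subr_gt0 ltr_pdivrMr// mul1r.
have c1_pos x : 0 < c 1%N x <-> k / 2 < t1 x < 1 - k / 2.
  by rewrite /c clamp_gt0 lt_min; split; lra from.
have c2_pos x : 0 < c 2%N x <-> 1 - k < t1 x.
  by rewrite /c clamp_gt0 subr_gt0 ltr_pdivrMr// mul1r; split; lra from.
have c3_pos n x : 0 < c n.+3 x -> False by rewrite /c ltxx.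
have cb n x : M1 x -> 0 <= c n x <= 1.
  by move=> _; case: n => [|[|[|n]]]; rewrite /c ?clamp_bd//; lra from.
have cc n x : M1 x -> c n y @[y --> x] --> c n x.
  move=> M1x; have ct := fchart_t c1 M1x.
  case: n => [|[|[|n]]]; rewrite /c; last exact: rlim_cst.
  - apply: (@clamp_cvg _ (fun y => 1 - t1 y / k)).
    by apply: rlimB; [exact: rlim_cst | apply: rlimM => //; exact: rlim_cst].
  - apply: (@clamp_cvg _ (fun y => Num.min (t1 y - k / 2) (1 - k / 2 - t1 y))).
    by apply: rlim_min; apply: rlimB => //; exact: rlim_cst.
  - apply: (@clamp_cvg _ (fun y => 1 - (1 - t1 y) / k)).
    apply: rlimB; first exact: rlim_cst.
    by apply: rlimM; [apply: rlimB => //|]; exact: rlim_cst.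
have cE n x y : M1 x -> E x y -> c n x = c n y.
  by move=> M1x /(fchart_E c1 y M1x) [_ e']; rewrite /c e'.
have cpos x : M1 x -> exists n, 0 < c n x.
  move=> M1x; have [h|h] := ltP (t1 x) k; first by exists 0%N; apply/c0_pos.
  have [h'|h'] := ltP (1 - k) (t1 x); first by exists 2%N; apply/c2_pos.
  by exists 1%N; apply/c1_pos; lra from k0 h h'.
have ceps : fchart E P0 (Iab (-1) 1) (fun x => eps * F0 x) t0.
  case: eps1 => ->; first by under eq_fun do rewrite mul1r.
  by under eq_fun do rewrite mulN1r; exact: fchart_flipF.
have cR := fchart_sub c0 (a' := 0) (b' := d1) ltac:(lra from) d12.
have cL := fchart_sub ceps (a' := - d2) (b' := 0) ltac:(lra from d22) ltac:(lra from).
have charts n x : M1 x -> 0 < c n x -> exists U J' t'',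
    [/\ fchart E U J' (Fn n) t'', open J', is_interval J', U x & U `<=` M1].
  move=> M1x; case: n => [|[|[|n]]] h; last by case: (c3_pos n x h).
  - exists (P0 `&` [set y | 0 < t0 y < d1]), (Iab 0 d1), t0.
    have [P0x hx _] := K1 x M1x ltac:(have := iffLR (c0_pos x) h; lra from e1 e3).
    by split => //; [exact: Iab_open | exact: Iab_interval | move=> y [P0y hy]; have [] := H1 y P0y hy].
  - by exists M1, (Iab 0 1), t1; split => //; [exact: Iab_open | exact: Iab_interval].
  - exists (P0 `&` [set y | - d2 < t0 y < 0]), (Iab (- d2) 0), t0.
    have [P0x hx _] := K2 x M1x ltac:(have := iffLR (c2_pos x) h; lra from e2 e3).
    split => //; [exact: Iab_open | exact: Iab_interval | move=> y [P0y hy]].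
    by have [/sM] := H2 y P0y hy.
have ori1 n x y : M1 x -> E x y -> 0 < c n x -> Fn n x < Fn n y -> F1 x < F1 y.
  move=> M1x Exy; case: n => [|[|[|n]]] h; last by case: (c3_pos n x h).
  - by have [_ _] := K1 x M1x ltac:(have := iffLR (c0_pos x) h; lra from e1 e3); apply.
  - by [].
  have [P0x hx _] := K2 x M1x ltac:(have := iffLR (c2_pos x) h; lra from e2 e3).
  have M1y := fchart_sat c1 M1x Exy; have e := iffLR (fchart_leaf c1 M1x M1y) Exy.
  have [_ _ k2x] := K2 x M1x ltac:(have := iffLR (c2_pos x) h; lra from e2 e3).
  have [_ _ k2y] := K2 y M1y ltac:(have := iffLR (c2_pos x) h; lra from e2 e3 e).
  rewrite /Fn => hF; case: eps1 => eE; rewrite eE in hF epsF.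
    by have := epsF x y M1x Exy (k2x y Exy ltac:(lra from hF)); lra from.
  by have := epsF y x M1y (Esym Exy) (k2y x (Esym Exy) ltac:(lra from hF)); lra from.
have ori n n' x y : M1 x -> E x y -> 0 < c n x -> 0 < c n' x -> Fn n x < Fn n y -> Fn n' x < Fn n' y.
  move=> M1x Exy hn hm hF; have h1' := ori1 n x y M1x Exy hn hF.
  have M1y := fchart_sat c1 M1x Exy.
  case: (ltrgtP (Fn n' x) (Fn n' y)) => // h; exfalso.
    by have := ori1 n' y x M1y (Esym Exy) ltac:(rewrite -(cE n' x y M1x Exy)) h; lra from hm h1'.
  have [U [J' [t'' [cU _ _ Ux _]]]] := charts n' x M1x hm.
  have Uy := fchart_sat cU Ux Exy.
  suff exy : x = y by move: hF; rewrite exy ltxx.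
  by apply: (fchart_inj cU) => //; apply/(fchart_leaf cU).
have cG : fchart E M1 (t1 @` M1) (blend c Fn) t1.
  by apply: fchart_glue => //; [exact: (fchart_t c1) | exact: (fchart_E c1)].
have imM : t1 @` M1 = Iab 0 1.
  apply/seteqP; split=> [_ [x /b1 h <-]//|s hs].
  by have [x [M1x _ tx]] := fchart_at c1 (x := 0) (s := s) ltac:(lra from) hs; exists x.
rewrite imM in cG.
have c_zero n x : M1 x -> ~ 0 < c n x -> c n x = 0.
  by move=> M1x h; have := cb n x M1x; case: (ltrgtP 0 (c n x)) => // h' _; case: h.
exists (blend c Fn), eps; split => //.
- move=> x; split=> [/cover3[h|h|/sM h]|[/s1//|[/s0//]]]; by [left|right].
- move=> d d0; have [e e0 He] := h1 d0.
  have [e' [e'0 e5 e6]] := @pos_min e (k / 2) e0 ltac:(lra from k0).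
  exists e' => // x M1x hx; have [P0x ht _] := He x M1x ltac:(lra from e5 hx).
  split => //; have Fb := fchart_Fb c0 P0x.
  apply: (@blend_single _ c Fn 0%N).
  + by move=> m0; exact: cb.
  + by rewrite /Fn; lra from Fb.
  + by apply/c0_pos; lra from e'0 e6 hx.
  move=> [|[|[|n]]] // _; apply: c_zero => //.
  + by move/c1_pos; lra from e6 hx.
  + by move/c2_pos; lra from e4 e6 hx.
- move=> d d0; have [e e0 He] := high d d0.
  have [e' [e'0 e5 e6]] := @pos_min e (k / 2) e0 ltac:(lra from k0).
  exists e' => // x M1x hx; have [P0x ht _] := He x M1x ltac:(lra from e5 hx).
  split => //; have Fb := fchart_Fb ceps P0x.
  apply: (@blend_single _ c Fn 2%N).
  + by move=> m0; exact: cb.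
  + by rewrite /Fn; lra from Fb.
  + by apply/c2_pos; lra from e'0 e6 hx.
  move=> [|[|[|n]]] // _; apply: c_zero => //.
  + by move/c0_pos; lra from e4 e6 hx.
  + by move/c1_pos; lra from e6 hx.
- move=> e e0; have [e' [e'0 e5 e6]] := @pos_min e 1 e0 ltac:(lra from).
  have [y [M1y _ ty]] := fchart_at c1 (x := 0) (s := 1 - e' / 2) ltac:(lra from) ltac:(rewrite /Iab /=; lra from e'0 e6).
  have b2 := fchart_J c2 (sM' _ M1y); rewrite /Iab /= in b2.
  have [d d0 Hd] := @g2 (t2 y) ltac:(lra from b2).
  exists d => // x P0x hx; have [M2x h] := Hd x P0x hx.
  have M1x := sM _ M2x; split => //.
  by have := iffLR (m x y M1x M1y) h; lra from ty e5 e6 e'0.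
Qed.

End structure.

Lemma regular_structure (T : topologicalType) (E : T -> T -> Prop) (Q : set T) :
  regular E Q -> connected Q -> Q !=set0 -> @second_countable T ->
  (exists F t, fchart E Q (Iab (-1) 1) F t) \/
  (exists P0 M F0 t0 G t eps, circle_data E Q P0 M F0 t0 G t eps).
Proof.
move=> rg cQ [p0 Qp0] sc; have [P0 [F0 [t0 [c0 P0p0 tp0 s0]]]] := rg_chart rg Qp0.
have c0' := fchart_neg c0; rewrite opprK in c0'.
have [M1 [F1 [t1 [r1 max1]]]] := max_ray rg c0 s0 sc.
have [M2 [F2 [t2 [r2 max2]]]] := max_ray rg c0' s0 sc.
have [[x [M1x M2x]]|no] := pselect (exists x, M1 x /\ M2 x).
  right; have [G [eps h]] := circle_case rg cQ c0 s0 P0p0 tp0 r1 max1 r2 max2 M1x M2x.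
  by exists P0, M1, F0, t0, G, t1, eps.
left; apply: (line_case rg cQ c0 s0 P0p0 tp0 r1 max1 r2 max2) => x M1x M2x.
by apply: no; exists x.
Qed.

(** * Coordinates in the plane *)

(** Passes between the bounded leaf coordinates of charts, needed for weighted sums, and the full
    lines of the models. Its oddness makes it compatible with the twist by eps. *)
Definition sigma (x : R) : R := x / (1 + `|x|).

Definition isigma (y : R) : R := y / (1 - `|y|).

Lemma sigma_bd x : -1 < sigma x < 1.
Proof.
rewrite /sigma; have h : 0 < 1 + `|x| by have := normr_ge0 x; lra.
rewrite ltr_pdivlMr// ltr_pdivrMr//.
by have := ler_norm x; have := ler_norm (- x); rewrite normrN; lra.
Qed.

Lemma sigmaK x : isigma (sigma x) = x.
Proof.
have h : 0 < 1 + `|x| by have := normr_ge0 x; lra.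
have e : `|sigma x| = `|x| / (1 + `|x|) by rewrite /sigma normrM normfV (gtr0_norm h).
rewrite /isigma e /sigma; field; apply/andP; split; first by rewrite gt_eqF.
by rewrite addrK oner_neq0.
Qed.

Lemma isigmaK (y : R) : -1 < y < 1 -> sigma (isigma y) = y.
Proof.
move=> hy; have h : 0 < 1 - `|y| by have : `|y| < 1; [rewrite ltr_norml | lra].
have e : `|isigma y| = `|y| / (1 - `|y|) by rewrite /isigma normrM normfV (gtr0_norm h).
rewrite /sigma e /isigma; field; apply/andP; split; first by rewrite gt_eqF.
by rewrite subrK oner_neq0.
Qed.

Lemma sigmaN x : sigma (- x) = - sigma x.
Proof. by rewrite /sigma normrN mulNr. Qed.

Lemma sigma_inj : injective sigma.
Proof. exact: can_inj sigmaK. Qed.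

Lemma sigma_cvg (I : Type) (G : set_system I) (FG : Filter G) (f : I -> R) (a : R) :
  f @ G --> a -> (fun x => sigma (f x)) @ G --> sigma a.
Proof.
move=> fa; apply: rlimM => //; apply: rlimV.
  by have := normr_ge0 a => h; rewrite gt_eqF//; lra.
by apply: rlimD; [exact: rlim_cst | exact: (@cvg_norm _ R^o)].
Qed.

Lemma isigma_cvg (I : Type) (G : set_system I) (FG : Filter G) (f : I -> R) (a : R) :
  -1 < a < 1 -> f @ G --> a -> (fun x => isigma (f x)) @ G --> isigma a.
Proof.
move=> ha fa; apply: rlimM => //; apply: rlimV.
  have : `|a| < 1 by rewrite ltr_norml.
  by move=> h; rewrite gt_eqF//; lra.
by apply: rlimB; [exact: rlim_cst | exact: (@cvg_norm _ R^o)].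
Qed.

Lemma rcvg_id (a : R) : (fun x : R => x) @ a --> a.
Proof. exact: cvg_id. Qed.

Lemma sigma_inv_box (a d : R) : 0 < d -> exists2 e : R, 0 < e &
  forall b : R, sigma a - e < sigma b < sigma a + e -> a - d < b < a + d.
Proof.
move=> d0; have := rlim_near _ (isigma_cvg _ (sigma_bd a) (@rcvg_id (sigma a))) d0.
move=> /(_ (nbhs_filter _) (nbhs_filter _))/nbhs_ballP[e /= e0 He]; exists e => // b hb.
have := He (sigma b); rewrite !sigmaK; apply.
by rewrite /ball /= ltr_distl; lra.
Qed.

Lemma sigma_box (a d : R) : 0 < d -> exists2 e : R, 0 < e &
  forall b : R, a - e < b < a + e -> sigma a - d < sigma b < sigma a + d.
Proof.
move=> d0; have := rlim_near _ (sigma_cvg _ (@rcvg_id a)) d0.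
move=> /(_ (nbhs_filter _) (nbhs_filter _))/nbhs_ballP[e /= e0 He]; exists e => // b hb.
by apply: He; rewrite /ball /= ltr_distl; lra.
Qed.

Section plane_coordinates.
Variables (T : topologicalType).

Lemma R2_box (p : R2) (O : set R2) : nbhs p O -> exists2 d : R, 0 < d &
  forall q : R2, p.1 - d < q.1 < p.1 + d -> p.2 - d < q.2 < p.2 + d -> O q.
Proof.
move=> /nbhs_ballP[d /= d0 H]; exists d => // q h1 h2; apply: H.
by split; rewrite /ball /= ltr_distl; lra.
Qed.

Lemma R2_open_box (p : R2) (d : R) :
  open [set q : R2 | p.1 - d < q.1 < p.1 + d /\ p.2 - d < q.2 < p.2 + d].
Proof.
rewrite (_ : [set _ | _] = (fst @^-1` Iab (p.1 - d) (p.1 + d)) `&` (snd @^-1` Iab (p.2 - d) (p.2 + d))) //.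
apply: openI; apply: open_comp; try exact: Iab_open.
  by move=> x _; exact: cvg_fst.
by move=> x _; exact: cvg_snd.
Qed.

(** Translates [homeo_onto], stated by relatively open sets, into the pointwise box conditions of
    charts; [coords_homeo] is the way back. *)
Lemma homeo_coords (D : set R2) (phi : R2 -> T) (U : set T) : homeo_onto D phi U ->
  exists a b : T -> R,
  [/\ forall p, D p -> a (phi p) = p.1 /\ b (phi p) = p.2,
      forall x, U x -> D (a x, b x) /\ phi (a x, b x) = x,
      forall x (d : R), U x -> 0 < d -> exists O : set T, [/\ open O, O x &
        forall q, U q -> O q -> a x - d < a q < a x + d /\ b x - d < b q < b x + d] &
      forall x N, U x -> nbhs x N -> exists2 d : R, 0 < d & forall q, U q ->
        a x - d < a q < a x + d -> b x - d < b q < b x + d -> N q].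
Proof.
move=> [im [inj top]].
have ex x : exists p : R2, U x -> D p /\ phi p = x.
  have [Ux|nU] := pselect (U x); last by exists (0, 0).
  by move: Ux; rewrite -im => -[p Dp e]; exists p.
have [g gP] := choice ex.
have gK p : D p -> g (phi p) = p.
  move=> Dp; have Up : U (phi p) by rewrite -im; exists p.
  by have [Dg e] := gP _ Up; apply/inj.
exists (fun x => (g x).1), (fun x => (g x).2); split.
- by move=> p Dp; rewrite gK.
- by move=> x Ux; rewrite -surjective_pairing; exact: gP.
- move=> x d Ux d0; have [Dg e] := gP x Ux.
  pose B := [set q : R2 | (g x).1 - d < q.1 < (g x).1 + d /\ (g x).2 - d < q.2 < (g x).2 + d].
  have sV : phi @` (D `&` B) `<=` U by move=> _ [p [Dp _] <-]; rewrite -im; exists p.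
  have [|O [oO EO]] := iffRL (top _ sV).
    exists B; split; first exact: R2_open_box.
    apply/seteqP; split=> [p [Dp [q [Dq Bq] /inj e']]|p [Dp Bp]].
      by have <- : q = p by exact: e'.
    by split => //; exists p.
  have key q : U q -> O q -> B (g q).
    move=> Uq Oq; have : (U `&` O) q by [].
    by rewrite -EO => -[p [Dp Bp] <-]; rewrite gK.
  exists O; split => //.
  have : (U `&` O) x; last by case.
  by rewrite -EO; exists (g x) => //; split => //; rewrite /B /=; split; lra.
- move=> x N Ux nN; have [Dg e] := gP x Ux.
  have [ O [oO Ox ON]] : exists O : set T, [/\ open O, O x & O `<=` N].
    exists N°; split; [exact: open_interior | exact: nN | exact: interior_subset].
  have [|B [oB EB]] := iffLR (top (U `&` O) (@subIsetl _ _ _)); first by exists O.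
  have Bg : B (g x).
    have : (D `&` phi @^-1` (U `&` O)) (g x) by split => //; rewrite /preimage /= e.
    by rewrite EB => -[].
  have [d d0 H] := R2_box (open_nbhs_nbhs (conj oB Bg)).
  exists d => // q Uq h1 h2; have [Dq eq] := gP q Uq.
  have : (D `&` B) (g q) by split => //; exact: H.
  by rewrite -EB => -[_ [_]]; rewrite eq; exact: ON.
Qed.

Lemma coords_homeo (A : set T) (a b : T -> R) (p0 : T) :
  (forall x y, A x -> A y -> a x = a y -> b x = b y -> x = y) ->
  (forall x (d : R), A x -> 0 < d -> exists O : set T, [/\ open O, O x &
     forall q, A q -> O q -> a x - d < a q < a x + d /\ b x - d < b q < b x + d]) ->
  (forall x N, A x -> nbhs x N -> exists2 d : R, 0 < d & forall q, A q ->
     a x - d < a q < a x + d -> b x - d < b q < b x + d -> N q) ->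
  exists f : R2 -> T, homeo_onto ((fun x => (a x, b x)) @` A) f A /\
    forall x, A x -> f (a x, b x) = x.
Proof.
move=> inj ab inv; set D := _ @` A.
pose f p := xget p0 [set x | A x /\ (a x, b x) = p].
have fK x : A x -> f (a x, b x) = x.
  move=> Ax; have [Af e] : [set y | A y /\ (a y, b y) = (a x, b x)] (f (a x, b x)).
    by apply: (@xgetPex _ p0 [set y | A y /\ (a y, b y) = (a x, b x)]); exists x.
  by case: e => e1 e2; apply: inj.
exists f; split => //; split.
  apply/seteqP; split=> [_ [_ [x Ax <-] <-]|x Ax]; first by rewrite fK.
  by exists (a x, b x); [exists x | exact: fK].
split=> [_ _ [x Ax <-] [y Ay <-]|U sU].
  by rewrite !fK//; split=> [->//|[e1 e2]]; exact: inj.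
split=> [[ O [oO ->]]|[ O [oO EO]]].
  pose B := \bigcup_(x in A `&` O) [set p : R2 | exists2 d : R, 0 < d & 
    (a x - d < p.1 < a x + d /\ b x - d < p.2 < b x + d) /\
    forall q, A q -> a x - d < a q < a x + d -> b x - d < b q < b x + d -> O q].
  exists B; split.
    apply: bigcup_open => x [Ax Ox].
    rewrite (_ : [set _ | _] = \bigcup_(d in [set d : R | 0 < d /\
      forall q, A q -> a x - d < a q < a x + d -> b x - d < b q < b x + d -> O q])
      [set p : R2 | a x - d < p.1 < a x + d /\ b x - d < p.2 < b x + d]).
      by apply: bigcup_open => d _; exact: (@R2_open_box (a x, b x) d).
    by apply/seteqP; split=> [p [d d0 [h1 h2]]|p [d [d0 h2] h1]]; exists d.
  apply/seteqP; split=> p [[x Ax <-]]; rewrite /preimage /=.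
    rewrite fK// => -[_ Ox]; split; first by exists x.
    have [d d0 H] := inv x O Ax (open_nbhs_nbhs (conj oO Ox)).
    by exists x => //; exists d => //=; split; [split; lra | exact: H].
  move=> [y [Ay Oy] [d d0 [/= [h1 h2] H]]]; split; first by exists x.
  by rewrite /preimage /= fK//; split => //; apply: H.
pose V := \bigcup_(x in U) [set z | exists O' : set T, [/\ open O', O' z &
  forall q, A q -> O' q -> O (a q, b q)]].
exists V; split.
  apply: bigcup_open => x Ux.
  rewrite (_ : [set _ | _] = \bigcup_(O' in [set O' : set T | open O' /\
     forall q, A q -> O' q -> O (a q, b q)]) O').
    by apply: bigcup_open => O' [].
  by apply/seteqP; split=> [z [ O' [h1 h2 h3]]|z [ O' [h1 h3] h2]]; exists O'.
apply/seteqP; split=> x.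
  move=> Ux; have Ax := sU x Ux; split => //; exists x => //.
  have Ox : O (a x, b x).
    have : (D `&` f @^-1` U) (a x, b x) by split; [exists x | rewrite /preimage /= fK].
    by rewrite EO => -[].
  have [d d0 H] := R2_box (open_nbhs_nbhs (conj oO Ox)).
  have [ O' [oO' O'x h]] := ab x d Ax d0.
  by exists O'; split => // q Aq O'q; have [h1 h2] := h q Aq O'q; exact: H.
move=> [Ax [y Uy [ O' [oO' O'x h]]]].
have : (D `&` O) (a x, b x) by split; [exists x | exact: h].
by rewrite -EO => -[_]; rewrite /preimage /= fK.
Qed.

End plane_coordinates.

(** * Surfaces foliated by closed leaves *)

Lemma fchart_scale (T : topologicalType) (E : T -> T -> Prop) P (d : R) F t : 0 < d ->
  fchart E P (Iab (- d) d) F t -> fchart E P (Iab (-1) 1) F (fun x => t x / d).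
Proof.
move=> d0 c; have -> : Iab (-1) 1 = (fun x => t x / d) @` P.
  apply/seteqP; split=> [s hs|_ [x Px <-]].
    have [||x [Px _ tx]] := @fchart_at _ _ _ _ _ _ 0 (s * d) c; first by lra.
      by move: hs; rewrite /Iab /=; nra.
    by exists x => //; rewrite tx mulfK// gt_eqF.
  have := fchart_J c Px; rewrite /Iab /= => h.
  by rewrite ltr_pdivlMr// ltr_pdivrMr//; lra.
apply: (fchart_reparam c); first exact: Iab_interval.
  by move=> x Px; apply: rlimM; [exact: (fchart_t c) | exact: rlim_cst].
move=> x y Px Py; split=> [|->//].
by apply: mulIf; rewrite invr_neq0// gt_eqF.
Qed.

Section foliated_surface.
Variables (X : topologicalType) (Delta : set (set X)).
Hypothesis CF : class_F Delta.

Definition leafE (x y : X) : Prop := exists w, [/\ Delta w, w x & w y].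

Let E := leafE.

Lemma leafE_eq w1 w2 x : Delta w1 -> Delta w2 -> w1 x -> w2 x -> w1 = w2.
Proof. by move=> h1 h2 x1 x2; have [[_ [h _]] _] := CF; apply: h => //; exists x. Qed.

Lemma leafE_refl x : E x x.
Proof. by have [[_ [_ h]] _] := CF; have [w [Dw wx]] := h x; exists w. Qed.

Lemma induced_leaf (Q w : set X) x : Delta w -> w x -> Q x ->
  (forall y, E x y -> Q y) -> induced_fol Delta Q w.
Proof. by move=> Dw wx Qx h; split => // y wy; apply: h; exists w. Qed.

Lemma leafE_sym x y : E x y -> E y x.
Proof. by move=> [w [Dw wx wy]]; exists w. Qed.

Lemma leafE_trans x y z : E x y -> E y z -> E x z.
Proof.
move=> [w [Dw wx wy]] [w' [Dw' wy' wz]]; exists w; split => //.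
by rewrite (leafE_eq Dw Dw' wy wy').
Qed.

Lemma leafE_in w x y : Delta w -> w x -> (E x y <-> w y).
Proof.
move=> Dw wx; split=> [[w' [Dw' wx' wy]]|wy]; last by exists w.
by rewrite (leafE_eq Dw Dw' wx wx').
Qed.

Tactic Notation "lra" "from" hyp_list(hs) :=
  clear - hs CF E; lra.

Lemma homeo_fchart (J : set R) (U : set X) (phi : R2 -> X) :
  open U -> homeo_onto [set p : R2 | J p.2] phi U ->
  (forall s, J s -> Delta (phi @` hline s)) ->
  exists a t, [/\ fchart E U J (fun x => sigma (a x)) t,
    forall p : R2, J p.2 -> a (phi p) = p.1 /\ t (phi p) = p.2 &
    forall x, U x -> phi (a x, t x) = x].
Proof.
move=> oU hm leaf; have [a [t [ak gk ac ai]]] := homeo_coords hm.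
have lim (h : X -> R) x (d : R) : U x -> (exists O : set X, [/\ open O, O x &
    forall q, U q -> O q -> h x - d < h q < h x + d]) ->
    \forall q \near x, h x - d < h q < h x + d.
  move=> Ux [ O [oO Ox H]].
  have nU : \forall q \near x, U q by apply: open_nbhs_nbhs.
  have nO : \forall q \near x, O q by apply: open_nbhs_nbhs.
  by near=> q; apply: H; near: q.
exists a, t; split.
- split => //.
  + move=> p Up; apply: sigma_cvg; apply: rlim_itv => e e0; apply: lim => //.
    by have [ O [oO Op H]] := ac p e Up e0; exists O; split => // q Uq /(H q Uq) [].
  + move=> p Up; apply: rlim_itv => e e0; apply: lim => //.
    by have [ O [oO Op H]] := ac p e Up e0; exists O; split => // q Uq /(H q Uq) [].
  + by move=> p _; exact: sigma_bd.
  + by move=> p /gk [].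
  + move=> x s x1 Js; have Ds : [set p : R2 | J p.2] (isigma x, s) by [].
    exists (phi (isigma x, s)); split.
    * by have [im _] := hm; rewrite -im; exists (isigma x, s).
    * by have [-> _] := ak _ Ds; rewrite isigmaK.
    * by have [] := ak _ Ds.
  + move=> p N Up nN; have [d d0 H] := ai p N Up nN.
    have [e e0 He] := sigma_inv_box (a p) d0.
    have [e' [e'0 e1 e2]] := pos_min d0 e0.
    by exists e' => // q Uq h1 h2; apply: H => //; [apply: He; lra from e2 h1 | lra from e1 h2].
  + move=> p q Up Uq /sigma_inj e1 e2.
    by have [_ <-] := gk p Up; have [_ <-] := gk q Uq; rewrite e1 e2.
  + move=> p q Up; have [Jp ep] := gk p Up.
    have Dw := leaf _ Jp.
    have wp : (phi @` hline (t p)) p by exists (a p, t p).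
    rewrite (leafE_in q Dw wp); split.
      move=> [r hr <-]; rewrite /hline /= in hr.
      have Dr : [set p : R2 | J p.2] r by rewrite /= hr.
      have [_ ->] := ak r Dr; split => //.
      by have [im _] := hm; rewrite -im; exists r.
    move=> [Uq tq]; exists (a q, t q); first by rewrite /hline /= tq.
    by have [] := gk q Uq.
- by move=> p Jp; exact: ak.
- by move=> x /gk [].
Unshelve. all: by end_near. Qed.

Lemma leaf_fchart w : Delta w -> exists P F t,
  [/\ fchart E P (J_interval (w `<=` boundary X)) F t & forall x, w x <-> P x /\ t x = 0].
Proof.
move=> Dw; have [_ [_ [_ h]]] := CF.
have [U [phi [oU [wU [hm [im leaf]]]]]] := h w Dw.
set J := J_interval _ in hm leaf *.
have J0 : J 0 by rewrite /J /J_interval; case: pselect => _ /=; lra.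
have [a [t [c ak gk]]] := homeo_fchart oU hm leaf.
exists U, (fun x => sigma (a x)), t; split => // x; rewrite -im; split.
  move=> [p hp <-]; rewrite /hline /= in hp.
  have Dp : J p.2 by rewrite hp.
  have [_ ->] := ak p Dp; split => //; have [e _] := hm; rewrite -e; by exists p.
by move=> [Ux tx]; exists (a x, t x); [rewrite /hline /= | exact: gk].
Qed.

Lemma boundary_sat x y : boundary X x -> E x y -> boundary X y.
Proof.
move=> bx; have [_ [_ [h _]]] := CF; have Dw := h x bx.
rewrite (leafE_in y Dw); last exact: connected_component_refl.
exact: connected_component_sub.
Qed.

Lemma leaf_boundary w x : Delta w -> w x -> boundary X x -> w `<=` boundary X.
Proof. by move=> Dw wx bx y wy; apply: (boundary_sat bx); apply/(leafE_in y Dw wx). Qed.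

Lemma JE_bd (b : Prop) : b -> J_interval b = [set s : R | 0 <= s < 1].
Proof. by rewrite /J_interval; case: pselect. Qed.

Lemma JE_int (b : Prop) : ~ b -> J_interval b = Iab (-1) 1.
Proof. by rewrite /J_interval; case: pselect. Qed.

Lemma half_interval (a b : R) : is_interval [set s : R | a <= s < b].
Proof. by move=> x y /= hx hy z hz; lra. Qed.

Lemma fchart_sub_half P (b b' : R) F t : fchart E P [set s | 0 <= s < b] F t -> b' <= b ->
  fchart E (P `&` [set x | t x < b']) [set s | 0 <= s < b'] F t.
Proof.
move=> c bb; set P' := P `&` _.
have oP' : open P'.
  rewrite openE => x [Px /= h]; rewrite /interior.
  have nP : nbhs x P by apply: (fchart_nbhs c).
  have n2 : \forall y \near x, t y < b' by apply: (cvgr_lt (t x)) => //; exact: (fchart_t c).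
  by near=> y; split; near: y.
have -> : [set s : R | 0 <= s < b'] = t @` P'.
  apply/seteqP; split => [s /= hs|_ [x [Px /= h] <-]].
    have [||p [Pp _ tp]] := @fchart_at _ _ _ _ _ _ 0 s c => /=; [lra | lra |].
    by exists p => //; split => //=; rewrite tp; lra.
  by have := fchart_J c Px; rewrite /= => h'; lra.
by apply: (fchart_restr c) => // [x []|x y [Px h] Py /= txy] //; split => //=; rewrite txy.
Unshelve. all: by end_near. Qed.

(* A boundary leaf has a one-sided chart, where t would be monotone and have an extremum at p. *)
Lemma interior_not_boundary P J F t p (e : R) : fchart E P J F t -> P p -> 0 < e ->
  (forall s, t p - e < s < t p + e -> J s) -> ~ boundary X p.
Proof.
move=> c Pp e0 Je bp; have [w [Dw wp _]] := leafE_refl p.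
have bw := leaf_boundary Dw wp bp.
have [P' [F' [t' [c' w']]]] := leaf_fchart Dw; rewrite (JE_bd bw) in c'.
have [P'p t'p] := iffLR (w' p) wp.
have nP : nbhs p P by apply: (fchart_nbhs c).
have [d [d0 Hd]] := fchart_near c' P'p nP.
have [d' [d'0 d1 d2]] := @pos_min d 1 d0 ltac:(lra).
have cd := fchart_sub_half c' (b' := d') d2.
set V := P' `&` _ in cd.
have VP x : V x -> P x.
  move=> [P'x /= hx]; have := fchart_J c' P'x; rewrite /= => h.
  have [v [_ Pv _ Ev]] := Hd x P'x ltac:(rewrite t'p; lra).
  exact: (fchart_sat c Pv (leafE_sym Ev)).
have Vp : V p by split => //=; rewrite t'p.
have hc x : V x -> t y @[y --> x] --> t x by move=> /VP; exact: (fchart_t c).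
have hi x y : V x -> V y -> (t x = t y <-> t' x = t' y).
  by move=> Vx Vy; rewrite -(fchart_leaf cd Vx Vy) (fchart_leaf c (VP _ Vx) (VP _ Vy)).
have nV : nbhs p V by apply: (fchart_nbhs cd).
have [k [k0 Hk]] := fchart_near c Pp nV.
have [m [m0 m1 m2]] := pos_min e0 k0.
have side s : t p - m < s < t p + m -> exists v, V v /\ t v = s.
  move=> hs; have [u [Pu _ tu]] := fchart_at c (x := 0) (s := s) ltac:(lra from) ltac:(apply: Je; lra from m1 hs).
  have [v [_ Vv tv _]] := Hk u Pu ltac:(lra).
  by exists v; split => //; rewrite tv.
have [v1 [V1 t1]] := side (t p - m / 2) ltac:(lra).
have [v2 [V2 t2]] := side (t p + m / 2) ltac:(lra).
have j1 := fchart_J cd V1; have j2 := fchart_J cd V2; rewrite /= in j1 j2.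
have [mm|mm] := fchart_mono cd (@half_interval _ _) hc hi.
  by have := iffLR (mm v1 p V1 Vp) ltac:(lra from m0 t1); lra from t'p j1.
by have := iffLR (mm p v2 Vp V2) ltac:(lra from m0 t2); lra from t'p j2.
Qed.

(** The definition of special points enters here: if p and q are not separated up to E, the leaf of
    q lies in the closure of every neighbourhood of the leaf of p in the leaf space, and for a
    nonspecial leaf this intersection is a single point. *)
Lemma nonspecial_sep p q : (forall w, special_leaf Delta w -> ~ w p) ->
  (forall A B, nbhs p A -> nbhs q B -> exists a b, [/\ A a, B b & E a b]) -> E p q.
Proof.
move=> ns h; have [w [Dw wp _]] := leafE_refl p; have [w' [Dw' w'q _]] := leafE_refl q.
suff e : w' = w by exists w; split => //; rewrite -e.
have : [set z | Delta z /\ forall V, leafspace_nbhd Delta w V -> leafspace_closure Delta V z] = [set w].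
  by apply: contrapT => sp; apply: (ns w).
move=> eS; suff : [set w] w' by [].
rewrite -eS; split => // V [VD [S [[SD oS] [Sw SV]]]]; split => // S' [S'D oS'] S'w'.
have [||a [b [[w1 Sw1 w1a] [w2 S'w2 w2b] Eab]]] := h (\bigcup_(v in S) v) (\bigcup_(v in S') v).
- by apply: open_nbhs_nbhs; split => //; exists w.
- by apply: open_nbhs_nbhs; split => //; exists w'.
exists w2; split => //; apply: SV.
have : w1 b by apply/(leafE_in b (SD _ Sw1) w1a).
by move=> w1b; rewrite (leafE_eq (S'D _ S'w2) (SD _ Sw1) w2b w1b).
Qed.

Hypothesis LF : locally_finite (special_leaf Delta).

(** A neighbourhood of p meets finitely many of these leaves, and each is closed. Subfamilies are
    allowed because later all special leaves except one given leaf have to be avoided. *)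
Lemma special_closed (Fm : set (set X)) : Fm `<=` special_leaf Delta ->
  closed (\bigcup_(w in Fm) w).
Proof.
move=> sF; rewrite -openC openE => p np; rewrite /interior.
have [N [nN fN]] := LF p.
pose K := [set w | special_leaf Delta w /\ w `&` N !=set0] `&` Fm.
have fK : finite_set K by exact: finite_setIl.
have cK : closed (\bigcup_(w in K) w).
  apply: closed_bigcup => // w [_ /sF [Dw _]].
  by have [_ [h _]] := CF; exact: h.
have oK : open (~` \bigcup_(w in K) w) by exact: closed_openC.
have nK : nbhs p (~` \bigcup_(w in K) w).
  by apply: open_nbhs_nbhs; split => // -[w [_ Fw] wp]; apply: np; exists w.
near=> q => -[w Fw wq].
have Nq : N q by near: q.
have : (~` \bigcup_(w in K) w) q by near: q.
by apply; exists w => //; split => //; split; [exact: sF | exists q].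
Unshelve. all: by end_near. Qed.

Lemma boundary_closed : closed (boundary X).
Proof.
rewrite -openC openE => p np; rewrite /interior.
have [w [Dw wp _]] := leafE_refl p.
have nb : ~ (w `<=` boundary X) by move=> /(_ p wp).
have [P [F [t [c wP]]]] := leaf_fchart Dw; rewrite (JE_int nb) in c.
have [Pp tp] := iffLR (wP p) wp.
have nP : nbhs p P by apply: (fchart_nbhs c).
apply: filterS nP => q Pq.
have [e [e0 e1 e2]] := @pos_min (t q + 1) (1 - t q)
  ltac:(have := fchart_J c Pq; rewrite /Iab /=; lra) ltac:(have := fchart_J c Pq; rewrite /Iab /=; lra).
by apply: (interior_not_boundary c Pq e0) => s hs; rewrite /Iab /=; lra.
Qed.

Let Gd : set X := ~` (\bigcup_(w in special_leaf Delta) w `|` boundary X).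

Let oG : open Gd.
Proof.
by apply: closed_openC; apply: closedU; [exact: special_closed | exact: boundary_closed].
Qed.

Lemma good_sat x y : Gd x -> E x y -> Gd y.
Proof.
move=> Gx Exy [[w sw wy]|byy]; apply: Gx.
  by left; exists w => //; apply/(leafE_in x sw.1 wy); exact: leafE_sym.
by right; exact: boundary_sat byy (leafE_sym Exy).
Qed.

Lemma good_chart p : Gd p -> exists P F t,
  [/\ fchart E P (Iab (-1) 1) F t, P p, t p = 0 & P `<=` Gd].
Proof.
move=> Gp; have [w [Dw wp _]] := leafE_refl p.
have nb : ~ (w `<=` boundary X) by move=> /(_ p wp) bp; apply: Gp; right.
have [P [F [t [c wP]]]] := leaf_fchart Dw; rewrite (JE_int nb) in c.
have [Pp tp] := iffLR (wP p) wp.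
have nG : nbhs p Gd by apply: open_nbhs_nbhs.
have [d' [d'0 H]] := fchart_near c Pp nG.
have [d [d0 e1 e2]] := @pos_min d' 1 d'0 ltac:(lra).
have cd := fchart_sub c (a' := - d) (b' := d) ltac:(lra) ltac:(lra).
exists (P `&` [set x | - d < t x < d]), F, (fun x => t x / d); split.
- exact: fchart_scale.
- by split => //=; rewrite tp; lra.
- by rewrite tp mul0r.
move=> x [Px /= hx]; have [v [_ Gv _ Ev]] := H x Px ltac:(rewrite tp; lra).
exact: good_sat Gv (leafE_sym Ev).
Qed.

Lemma good_component x0 : Gd x0 -> regular E (connected_component Gd x0).
Proof.
move=> Gx0; set Q := connected_component Gd x0.
have QG : Q `<=` Gd by exact: connected_component_sub.
(* Charts are connected, so a chart inside [Gd] that meets a component is contained in it. *)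
have sub q P F t : Q q -> fchart E P (Iab (-1) 1) F t -> P q -> P `<=` Gd -> P `<=` Q.
  move=> Qq c Pq PG; rewrite /Q (same_connected_component Qq).
  by apply: connected_component_max => //; exact: fchart_conn c (@Iab_interval _ _).
split.
- exact: leafE_refl.
- exact: leafE_sym.
- exact: leafE_trans.
- rewrite openE => q Qq; rewrite /interior.
  have [P [F [t [c Pq _ PG]]]] := good_chart (QG _ Qq).
  apply: filterS (sub q P F t Qq c Pq PG) _.
  by apply: (fchart_nbhs c).
- move=> x y Qx Exy; have [P [F [t [c Pq _ PG]]]] := good_chart (QG _ Qx).
  by apply: (sub x P F t Qx c Pq PG); exact: fchart_sat c Pq Exy.
- move=> q Qq; have [P [F [t [c Pq tq PG]]]] := good_chart (QG _ Qq).
  by exists P, F, t; split => //; exact: (sub q P F t).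
- move=> x y Qx Qy; apply: nonspecial_sep => w sw wx.
  by apply: (QG _ Qx); left; exists w.
Qed.

End foliated_surface.

(** * Strips and bands *)

Lemma open_in_boxP (D W : set R2) : open_in D (D `&` W) <->
  forall p, D p -> W p -> exists2 d : R, 0 < d & forall q, D q ->
    p.1 - d < q.1 < p.1 + d -> p.2 - d < q.2 < p.2 + d -> W q.
Proof.
split=> [[ O [oO EO]] p Dp Wp|H].
  have Op : O p by have : (D `&` W) p by []; rewrite EO => -[].
  have [d d0 h] := R2_box (open_nbhs_nbhs (conj oO Op)).
  exists d => // q Dq h1 h2; have : (D `&` O) q by split => //; exact: h.
  by rewrite -EO => -[].
pose good p (d : R) := forall q, D q -> p.1 - d < q.1 < p.1 + d ->
  p.2 - d < q.2 < p.2 + d -> W q.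
exists (\bigcup_(i in [set i : R2 * R | [/\ D i.1, 0 < i.2 & good i.1 i.2]])
  [set q : R2 | i.1.1 - i.2 < q.1 < i.1.1 + i.2 /\ i.1.2 - i.2 < q.2 < i.1.2 + i.2]).
split; first by apply: bigcup_open => i _; exact: R2_open_box.
apply/seteqP; split=> p [Dp].
  move=> Wp; have [d d0 h] := H p Dp Wp; split => //.
  by exists (p, d) => //=; split; lra.
by move=> [[q d] /= [_ _ h] [h1 h2]]; split => //; exact: h.
Qed.

Lemma sigmaM (eps x : R) : eps = 1 \/ eps = -1 -> sigma (eps * x) = eps * sigma x.
Proof. by move=> [->|->]; rewrite ?mul1r// !mulN1r sigmaN. Qed.

Lemma mul_pm1 (eps x y d : R) : eps = 1 \/ eps = -1 ->
  (eps * x - d < eps * y < eps * x + d <-> x - d < y < x + d).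
Proof. by move=> [->|->]; split; lra. Qed.

Lemma pm1K (eps x : R) : eps = 1 \/ eps = -1 -> eps * (eps * x) = x.
Proof. by move=> [->|->]; lra. Qed.

(** Treats the two quotients at once: eps = 1 is the cylinder and eps = -1 the Möbius band. *)
Definition twisted_rel (eps : R) (p q : R2) : Prop :=
  p = q \/ (q.1 = eps * p.1 /\ ((p.2 = -1 /\ q.2 = 1) \/ (p.2 = 1 /\ q.2 = -1))).

Lemma twisted_cylinder p q : twisted_rel 1 p q <-> cylinder_rel p q.
Proof.
by rewrite /twisted_rel /cylinder_rel mul1r; split=> -[|[-> h]]; [left | right | left | right].
Qed.

Lemma twisted_moebius p q : twisted_rel (-1) p q <-> moebius_rel p q.
Proof. by rewrite /twisted_rel /moebius_rel mulN1r. Qed.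

Section models.
Variables (X : topologicalType) (Delta : set (set X)).
Hypothesis CF : class_F Delta.

Let E := leafE Delta.

Lemma line_model (Q : set X) F t : (forall x y, Q x -> E x y -> Q y) ->
  fchart E Q (Iab (-1) 1) F t -> Q !=set0 -> exists phi : R2 -> X,
    foliated_homeo open_strip open_strip_foliation phi Q (induced_fol Delta Q).
Proof.
move=> satQ c [p0 Qp0].
have oQ := fchart_open c.
pose a x := isigma (F x).
have aF x : Q x -> sigma (a x) = F x by move=> Qx; exact/isigmaK/(fchart_Fb c).
have [|||f [hf fK]] := @coords_homeo X Q a t p0.
- move=> x y Qx Qy e; apply: (fchart_inj c) => //.
  by rewrite -aF// -[RHS]aF// e.
- move=> x d Qx d0.
  have n1 := rlim_near (nbhs_filter x) (isigma_cvg (nbhs_filter x) (fchart_Fb c Qx) (fchart_F c Qx)) d0.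
  have n2 := rlim_near (nbhs_filter x) (fchart_t c Qx) d0.
  have n12 : nbhs x ([set q | a x - d < a q < a x + d] `&` [set q | t x - d < t q < t x + d]).
    by apply: filterI.
  by rewrite nbhsE in n12; case: n12 => O [oO Ox] sO; exists O; split => // q _ /sO [].
- move=> x N Qx nN; have [d d0 H] := fchart_inv c Qx nN.
  have [e e0 He] := @sigma_box (a x) d d0.
  have [e' [e'0 e1 e2]] := pos_min d0 e0.
  exists e' => // q Qq h1 h2; apply: H => //; last by lra.
  by rewrite -!aF//; apply: He; lra.
have D : (fun x => (a x, t x)) @` Q = open_strip.
  apply/seteqP; split=> [_ [x Qx <-]|[u s] hs].
    by rewrite /open_strip /=; exact: (fchart_J c Qx).
  have [x [Qx Fx tx]] := fchart_at c (sigma_bd u) hs.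
  by exists x => //; rewrite /a Fx sigmaK tx.
rewrite D in hf; exists f; split => //.
have leaf x w : Q x -> Delta w -> w x -> f @` hline (t x) = w.
  move=> Qx Dw wx; apply/seteqP; split=> [_ [[u s] hs <-]|y wy].
    rewrite /hline /= in hs; subst s.
    have [y [Qy Fy ty]] := fchart_at c (sigma_bd u) (fchart_J c Qx).
    have <- : y = f (u, t x) by rewrite -ty -(sigmaK u) -Fy fK.
    by apply/(leafE_in CF y Dw wx)/(fchart_leaf c).
  have [Qy ty] := iffLR (fchart_E c y Qx) (iffRL (leafE_in CF y Dw wx) wy).
  by exists (a y, t y); [rewrite /hline /= | exact: fK].
split=> [_ [s [hs ->]]|w [Dw wQ]].
  have [x [Qx _ tx]] := fchart_at c (x := 0) (s := s) ltac:(lra) hs.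
  have [w [Dw wx _]] := leafE_refl CF x.
  rewrite -tx (leaf x w)//; apply: (induced_leaf Dw wx) => // y; exact: satQ.
have [[wne _] _] := CF; have [x wx] := wne w Dw.
exists (hline (t x)); split; last by rewrite (leaf x w)//; exact: wQ.
by exists (t x); split => //; apply: (fchart_J c); exact: wQ.
Qed.

Tactic Notation "lra" "from" hyp_list(hs) :=
  clear - hs CF E; lra.

Lemma circle_model (Q P0 M : set X) F0 t0 G t eps : (forall x y, Q x -> E x y -> Q y) ->
  open Q -> circle_data E Q P0 M F0 t0 G t eps -> Q !=set0 -> exists f : R2 -> X,
    foliated_quotient_onto closed_band (twisted_rel eps) closed_band_foliation f Q
      (induced_fol Delta Q).
Proof.
move=> satQ oQ cd [q0 Qq0].
have c0 := cd_base cd; have cM := cd_band cd; have eps1 := cd_eps cd.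
pose w0 x := P0 x /\ t0 x = 0.
(* The open band goes to M by rescaling (-1, 1) to (0, 1), and both edges go to the base leaf; the
   factor eps on the upper edge is the one in [cd_high]. *)
pose spec (p : R2) x := [/\ (-1 < p.2 < 1 -> [/\ M x, G x = sigma p.1 & t x = (p.2 + 1) / 2]),
  (p.2 = -1 -> w0 x /\ F0 x = sigma p.1) & (p.2 = 1 -> w0 x /\ F0 x = eps * sigma p.1)].
have ex p : exists x, spec p x.
  have [h|h] := pselect (-1 < p.2 < 1).
    have [x [Mx Gx tx]] := fchart_at cM (s := (p.2 + 1) / 2) (sigma_bd p.1) ltac:(rewrite /Iab /=; lra).
    by exists x; split=> [//||] e; lra.
  have [h'|h'] := eqVneq p.2 (-1).
    have [x [Px Fx tx]] := fchart_at c0 (s := 0) (sigma_bd p.1) ltac:(rewrite /Iab /=; lra).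
    by exists x; split=> // e; lra.
  have b : -1 < eps * sigma p.1 < 1 by rewrite -sigmaM//; exact: sigma_bd.
  have [x [Px Fx tx]] := fchart_at c0 (s := 0) b ltac:(rewrite /Iab /=; lra).
  by exists x; split=> // e; move: h'; rewrite e eqxx.
have [f fP] := choice ex.
have fint p : -1 < p.2 < 1 -> [/\ M (f p), G (f p) = sigma p.1 & t (f p) = (p.2 + 1) / 2].
  by have [h _ _] := fP p.
have flow (x : R) : w0 (f (x, -1)) /\ F0 (f (x, -1)) = sigma x.
  by have [_ h _] := fP (x, -1); exact: h.
have fhigh (x : R) : w0 (f (x, 1)) /\ F0 (f (x, 1)) = eps * sigma x.
  by have [_ _ h] := fP (x, 1); exact: h.
have w0_inj x y : w0 x -> w0 y -> F0 x = F0 y -> x = y.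
  by move=> [Px tx] [Py ty] e; apply: (fchart_inj c0) => //; rewrite ty.
have M_w0 x : M x -> w0 x -> False by move=> Mx; exact: (cd_disj cd Mx).
have fM x : M x -> f (isigma (G x), 2 * t x - 1) = x.
  move=> Mx; have b := fchart_J cM Mx; rewrite /Iab /= in b.
  have [My Gy ty] := fint (isigma (G x), 2 * t x - 1) ltac:(rewrite /=; lra).
  apply: (fchart_inj cM) => //; last by rewrite ty /=; lra.
  by rewrite Gy /= isigmaK//; exact: (fchart_Fb cM).
have fw x : w0 x -> f (isigma (F0 x), -1) = x.
  move=> wx; have [wy Fy] := flow (isigma (F0 x)); apply: w0_inj => //.
  by rewrite Fy isigmaK//; exact: (fchart_Fb c0 wx.1).
have fw' x : w0 x -> f (eps * isigma (F0 x), 1) = x.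
  move=> wx; have [wy Fy] := fhigh (eps * isigma (F0 x)); apply: w0_inj => //.
  by rewrite Fy sigmaM// pm1K// isigmaK//; exact: (fchart_Fb c0 wx.1).
have band_case p : closed_band p -> [\/ -1 < p.2 < 1, p = (p.1, -1) | p = (p.1, 1)].
  case: p => u s; rewrite /closed_band /= => hs.
  have [->|h1] := eqVneq s (-1); first exact: Or32.
  have [->|h2] := eqVneq s 1; first exact: Or33.
  by apply: Or31; rewrite !lt_neqAle h2 eq_sym h1.
have cover x : Q x <-> M x \/ w0 x by exact: (cd_cover cd).
have bandQ p : closed_band p -> Q (f p).
  move=> /band_case[h|->|->]; apply/cover.
  - by left; have [] := fint p h.
  - by right; have [] := flow p.1.
  - by right; have [] := fhigh p.1.
have top_fw U : open U -> forall p, closed_band p -> U (f p) -> exists2 d : R, 0 < d &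
    forall q, closed_band q -> p.1 - d < q.1 < p.1 + d -> p.2 - d < q.2 < p.2 + d -> U (f q).
  move=> oU p bp Ufp; have nU : nbhs (f p) U by apply: open_nbhs_nbhs.
  case: (band_case p bp) => [h|ep|ep].
  - have [Mp Gp tp] := fint p h.
    have [d d0 H] := fchart_inv cM Mp nU.
    have [e e0 He] := @sigma_box p.1 d d0.
    have [d1 [d10 k1 k2]] := pos_min d0 e0.
    have [d2 [d20 k3 k4]] := @pos_min (p.2 + 1) (1 - p.2) ltac:(lra from h) ltac:(lra from h).
    have [d3 [d30 k5 k6]] := pos_min d10 d20.
    exists d3 => // q bq h1 h2; have [Mq Gq tq] := fint q ltac:(lra from k3 k4 k6 h2).
    apply: H => //; last by rewrite tp tq; lra from k1 k5 h2.
    by rewrite Gp Gq; apply: He; lra from k2 k5 h1.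
  - rewrite ep in nU *; have [wp Fp] := flow p.1; have [P0p tp] := wp.
    have [d d0 H] := fchart_inv c0 P0p nU.
    have [e e0 He] := @sigma_box p.1 d d0.
    have [k k0 K] := cd_low cd d0.
    have [d1 [d10 k1 k2]] := pos_min k0 e0.
    have [d2 [d20 k3 k4]] := @pos_min d1 1 d10 ltac:(lra from).
    exists d2 => // q bq /= h1 h2; case: (band_case q bq) => [hq|eq|eq].
    + have [Mq Gq tq] := fint q hq; have [P0q t0q Gq'] := K _ Mq ltac:(rewrite tq; lra from k1 k3 h2).
      apply: H => //; last by rewrite tp; lra from t0q.
      by rewrite Fp -Gq' Gq; apply: He; lra from k2 k3 h1.
    + rewrite eq; have [[P0q tq] Fq] := flow q.1; apply: H => //; last by rewrite tp tq; lra from d0.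
      by rewrite Fp Fq; apply: He; lra from k2 k3 h1.
    + by rewrite eq /= in h2; lra from k4 h2.
  - rewrite ep in nU *; have [wp Fp] := fhigh p.1; have [P0p tp] := wp.
    have [d d0 H] := fchart_inv c0 P0p nU.
    have [e e0 He] := @sigma_box p.1 d d0.
    have [k k0 K] := cd_high cd d0.
    have [d1 [d10 k1 k2]] := pos_min k0 e0.
    have [d2 [d20 k3 k4]] := @pos_min d1 1 d10 ltac:(lra from).
    exists d2 => // q bq /= h1 h2; case: (band_case q bq) => [hq|eq|eq].
    + have [Mq Gq tq] := fint q hq; have [P0q t0q Gq'] := K _ Mq ltac:(rewrite tq; lra from k1 k3 h2).
      apply: H => //; last by rewrite tp; lra from t0q.
      have -> : F0 (f q) = eps * sigma q.1 by rewrite -Gq Gq' pm1K.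
      by rewrite Fp mul_pm1//; apply: He; lra from k2 k3 h1.
    + by rewrite eq /= in h2; lra from k4 h2.
    + rewrite eq; have [[P0q tq] Fq] := fhigh q.1; apply: H => //; last by rewrite tp tq; lra from d0.
      by rewrite Fp Fq mul_pm1//; apply: He; lra from k2 k3 h1.
have top_bw (U : set X) : U `<=` Q -> (forall p, closed_band p -> U (f p) -> exists2 d : R, 0 < d &
    forall q, closed_band q -> p.1 - d < q.1 < p.1 + d -> p.2 - d < q.2 < p.2 + d -> U (f q)) ->
    open U.
  move=> sU H; rewrite openE => x Ux; rewrite /interior.
  have [Mx|wx] := iffLR (cover x) (sU x Ux).
    have b := fchart_J cM Mx; rewrite /Iab /= in b.
    have [|d d0 Hd] := H (isigma (G x), 2 * t x - 1) ltac:(rewrite /closed_band /=; lra from b).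
      by rewrite fM.
    have nM : \forall y \near x, M y by apply: (fchart_nbhs cM).
    have n1 := rlim_near (nbhs_filter x) (isigma_cvg (nbhs_filter x) (fchart_Fb cM Mx) (fchart_F cM Mx)) d0.
    have n2 := rlim_near (nbhs_filter x) (fchart_t cM Mx) (e := d / 2) ltac:(lra).
    near=> y; have My : M y by near: y.
    have h1 : isigma (G x) - d < isigma (G y) < isigma (G x) + d by near: y.
    have h2 : t x - d / 2 < t y < t x + d / 2 by near: y.
    have by' := fchart_J cM My; rewrite /Iab /= in by'.
    by rewrite -(fM y My); apply: Hd => /=; [rewrite /closed_band /=; lra from by' | done | lra from h2].
  have [P0x tx] := wx.
  (* A point of the base leaf has one preimage on each edge. Nearby points with t0 >= 0 are reached
     from the lower edge, those with t0 < 0 from the upper one. The bound e <= d / 2 below accounts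
     for the height being 2t - 1. *)
  have [|d1 d10 H1] := H (isigma (F0 x), -1) ltac:(rewrite /closed_band /=; lra).
    by rewrite fw.
  have [|d2 d20 H2] := H (eps * isigma (F0 x), 1) ltac:(rewrite /closed_band /=; lra).
    by rewrite fw'.
  have [d [d0 k1 k2]] := pos_min d10 d20.
  have [e1 e10 K1] := @cd_low _ _ _ _ _ _ _ _ _ _ cd 1 ltac:(lra from).
  have [e2 e20 K2] := @cd_high _ _ _ _ _ _ _ _ _ _ cd 1 ltac:(lra from).
  have [e3 [e30 k3 k4]] := pos_min e10 e20.
  have [e [e0 k5 k6]] := @pos_min e3 (d / 2) e30 ltac:(lra from d0).
  have [r1 r10 R1] := cd_right cd e0; have [r2 r20 R2'] := cd_left cd e0.
  have [r [r0 k7 k8]] := pos_min r10 r20.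
  have nP : \forall y \near x, P0 y by apply: (fchart_nbhs c0).
  have n1 := rlim_near (nbhs_filter x) (isigma_cvg (nbhs_filter x) (fchart_Fb c0 P0x) (fchart_F c0 P0x)) d0.
  have n2 := rlim_near (nbhs_filter x) (fchart_t c0 P0x) r0; rewrite tx in n2.
  near=> y; have P0y : P0 y by near: y.
  have h1 : isigma (F0 x) - d < isigma (F0 y) < isigma (F0 x) + d by near: y.
  have h2 : 0 - r < t0 y < 0 + r by near: y.
  case: (ltrgtP (t0 y) 0) => hy.
  - have [My ty] := R2' y P0y ltac:(lra from k8 h2 hy).
    have [_ _ Gy] := K2 y My ltac:(lra from k4 k5 ty).
    have by' := fchart_J cM My; rewrite /Iab /= in by'.
    rewrite -(fM y My) Gy; apply: H2 => /=; [rewrite /closed_band /=; lra from by' | | lra from k2 k6 ty by'].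
    have -> : isigma (eps * F0 y) = eps * isigma (F0 y).
      have Fb := fchart_Fb c0 P0y.
      by apply: sigma_inj; rewrite sigmaM// !isigmaK//; case: eps1 => ->; lra from Fb Fb.
    by rewrite mul_pm1//; lra from k2 h1.
  - have [My ty] := R1 y P0y ltac:(lra from k7 h2 hy).
    have [_ _ Gy] := K1 y My ltac:(lra from k3 k5 ty).
    have by' := fchart_J cM My; rewrite /Iab /= in by'.
    by rewrite -(fM y My) Gy; apply: H1 => /=; [rewrite /closed_band /=; lra from by' | lra from k1 h1 | lra from k1 k6 ty by'].
  - by rewrite -(fw y)//; apply: H1 => /=; [rewrite /closed_band /=; lra from | lra from k1 h1 | lra from k1 h1].
exists f; split; first split.
- apply/seteqP; split=> [_ [p bp <-]|x /cover[Mx|wx]]; first exact: bandQ.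
    have b := fchart_J cM Mx; rewrite /Iab /= in b.
    by exists (isigma (G x), 2 * t x - 1); [rewrite /closed_band /=; lra | exact: fM].
  by exists (isigma (F0 x), -1); [rewrite /closed_band /=; lra | exact: fw].
- split=> [p q bp bq|U sU].
    split=> [e|[->//|[e1 e2]]]; last first.
      case: p q bp bq e1 e2 => [u s] [v r] /= _ _ -> [[-> ->]|[-> ->]].
        have [w1 F1] := flow u; have [w2 F2] := fhigh (eps * u).
        by apply: w0_inj => //; rewrite F1 F2 sigmaM// pm1K.
      have [w1 F1] := fhigh u; have [w2 F2] := flow (eps * u).
      by apply: w0_inj => //; rewrite F1 F2 sigmaM.
    case: (band_case p bp) => [hp|ep|ep]; case: (band_case q bq) => [hq|eq|eq].
    + have [_ G1 t1] := fint p hp; have [_ G2 t2] := fint q hq; left.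
      case: p q e G1 t1 G2 t2 {bp bq hp hq} => [u s] [v r] /= e G1 t1 G2 t2.
      have -> : u = v by apply: sigma_inj; rewrite -G1 -G2 e.
      by congr (_, _); move: t2; rewrite -e t1; lra from.
    + by have [Mp _ _] := fint p hp; rewrite e eq in Mp; case: (M_w0 _ Mp (flow q.1).1).
    + by have [Mp _ _] := fint p hp; rewrite e eq in Mp; case: (M_w0 _ Mp (fhigh q.1).1).
    + by have [Mp _ _] := fint q hq; rewrite -e ep in Mp; case: (M_w0 _ Mp (flow p.1).1).
    + left; rewrite ep eq; congr (_, _); apply: sigma_inj.
      by rewrite -(flow p.1).2 -(flow q.1).2 -ep -eq e.
    + right; split; last by left; rewrite ep eq.
      apply: sigma_inj; rewrite sigmaM// -(flow p.1).2 -ep e eq (fhigh q.1).2 pm1K//.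
    + by have [Mp _ _] := fint q hq; rewrite -e ep in Mp; case: (M_w0 _ Mp (fhigh p.1).1).
    + right; split; last by right; rewrite ep eq.
      by apply: sigma_inj; rewrite sigmaM// -(fhigh p.1).2 -ep e eq (flow q.1).2.
    + left; rewrite ep eq; congr (_, _); apply: sigma_inj.
      rewrite -[LHS](pm1K _ eps1) -[RHS](pm1K _ eps1).
      by rewrite -(fhigh p.1).2 -(fhigh q.1).2 -ep -eq e.
  split=> [[ O [oO EU]]|/open_in_boxP h].
    by apply/open_in_boxP; apply: top_fw; rewrite EU; exact: openI.
  by exists U; split; [exact: top_bw | rewrite setIidr].
have leafM x w : M x -> Delta w -> w x -> f @` hline (2 * t x - 1) = w.
  move=> Mx Dw wx; have b := fchart_J cM Mx; rewrite /Iab /= in b.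
  apply/seteqP; split=> [_ [[u s] hs <-]|y wy].
    rewrite /hline /= in hs; subst s.
    have [My Gy ty] := fint (u, 2 * t x - 1) ltac:(rewrite /=; lra from b).
    by apply/(leafE_in CF _ Dw wx)/(fchart_leaf cM) => //; rewrite ty /=; lra from.
  have [My ty] := iffLR (fchart_E cM y Mx) (iffRL (leafE_in CF y Dw wx) wy).
  by exists (isigma (G y), 2 * t y - 1); [rewrite /hline /= ty | exact: fM].
have wsat x y : w0 x -> E x y -> w0 y.
  by move=> [Px tx] /(fchart_E c0 y Px) [Py ty]; split => //; rewrite ty.
have wE x y : w0 x -> w0 y -> E x y.
  by move=> [Px tx] [Py ty]; apply/(fchart_leaf c0) => //; rewrite tx.
have leafw x w : w0 x -> Delta w -> w x -> f @` hline (-1) = w /\ f @` hline 1 = w.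
  move=> wx Dw wwx; split; apply/seteqP; split=> [_ [[u s] hs <-]|y wy].
  - rewrite /hline /= in hs; subst s.
    by apply/(leafE_in CF _ Dw wwx); apply: wE => //; have [] := flow u.
  - have wy' := wsat x y wx (iffRL (leafE_in CF y Dw wwx) wy).
    by exists (isigma (F0 y), -1); [rewrite /hline /= | exact: fw].
  - rewrite /hline /= in hs; subst s.
    by apply/(leafE_in CF _ Dw wwx); apply: wE => //; have [] := fhigh u.
  - have wy' := wsat x y wx (iffRL (leafE_in CF y Dw wwx) wy).
    by exists (eps * isigma (F0 y), 1); [rewrite /hline /= | exact: fw'].
split=> [_ [s [hs ->]]|w [Dw wQ]].
  have bs : closed_band (0, s) by [].
  have Qx := bandQ _ bs; have [w [Dw wx _]] := leafE_refl CF (f (0, s)).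
  have iw : induced_fol Delta Q w by apply: (induced_leaf Dw wx) => // y; exact: satQ.
  case: (band_case _ bs) => /= [h|[e]|[e]].
  - have [Mx _ tx] := fint (0, s) h; rewrite /= in tx.
    by have -> : s = 2 * t (f (0, s)) - 1 by [lra from tx]; rewrite (leafM _ w).
  - by rewrite e in wx *; have [-> _] := leafw _ w (flow 0).1 Dw wx.
  - by rewrite e in wx *; have [_ ->] := leafw _ w (fhigh 0).1 Dw wx.
have [[wne _] _] := CF; have [x wx] := wne w Dw.
have [Mx|wx0] := iffLR (cover x) (wQ x wx).
  exists (hline (2 * t x - 1)); split; last by rewrite (leafM x w).
  have b := fchart_J cM Mx; rewrite /Iab /= in b.
  by exists (2 * t x - 1); split => //; lra.
exists (hline (-1)); split; last by have [] := leafw x w wx0 Dw wx.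
by exists (-1); split => //; lra.
Unshelve. all: by end_near. Qed.

(** The compact transversal {0} x [-1, 1] meets every leaf of Q. A point z outside Q is separated
    from each of these nonspecial leaves, and by compactness one neighbourhood of z serves for all
    of them, hence misses Q. *)
Lemma band_closed (Q : set X) rel f :
  (forall p, Q p -> forall w, special_leaf Delta w -> ~ w p) ->
  (forall x y, Q x -> E x y -> Q y) ->
  foliated_quotient_onto closed_band rel closed_band_foliation f Q (induced_fol Delta Q) ->
  closed Q.
Proof.
move=> ns satQ [[im [_ top]] [leaf _]] z clz; apply: contrapT => nQz.
have fQ p : closed_band p -> Q (f p) by move=> bp; rewrite -im; exists p.
have /compact_near_coveringP/near_covering_withinP key := @segment_compact R (-1) 1.
have nN : nbhs z [set z' | `[-1, 1]%classic `<=` (fun s => ~ E z' (f (0, s)))].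
  apply: (key X (nbhs z) (fun z' s => ~ E z' (f (0, s)))).
  move=> s; rewrite /= in_itv /= => hs.
  have bs : closed_band (0, s) by [].
  have Qs := fQ _ bs.
  have [A [B [nA nB AB]]] : exists A B, [/\ nbhs (f (0, s)) A, nbhs z B &
      forall a b, A a -> B b -> ~ E a b].
    apply: contrapT => no; apply: nQz; apply: (satQ _ _ Qs).
    apply: (nonspecial_sep CF (ns _ Qs)) => A B nA nB; apply: contrapT => no'.
    by apply: no; exists A, B; split => // a b Aa Bb Eab; apply: no'; exists a, b.
  have : open_in closed_band (closed_band `&` f @^-1` (Q `&` A°)).
    apply/(top _ (@subIsetl _ _ _)); exists A°; split => //; exact: open_interior.
  move/open_in_boxP => /(_ (0, s) bs (conj Qs nA)) [d d0 Hd].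
  exists ([set r | s - d < r < s + d], B) => /=.
    split => //; apply/nbhs_ballP; exists d => // r; rewrite /ball /= ltr_distl; lra.
  move=> [r z'] [/= hr Bz']; rewrite in_itv /= => hr'.
  have [|||_ Ar] := Hd (0, r) => //=; first by lra.
  by move=> /(leafE_sym) ; apply: AB => //; exact: interior_subset.
have [z' [Qz' Nz']] := clz _ nN.
move: Qz'; rewrite -im => -[[u s] bs ez].
have hs : `[-1, 1]%classic s by rewrite /= in_itv.
apply: (Nz' s hs).
have [|Dl _] := leaf (hline s); first by exists s.
exists (f @` hline s); split => //; first by exists (u, s).
by exists (0, s).
Qed.

End models.

(** * Boundary leaves of a half strip *)

Section edge_gluing.
Variables (T : topologicalType) (E : T -> T -> Prop).
Hypothesis Esym : forall x y, E x y -> E y x.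
Variables (M : set T) (Fq t : T -> R).
Let J : set R := [set s | -1 < s <= 0].
Hypothesis cM : fchart E M J Fq t.
Variables (B : nat -> set T) (F : nat -> T -> R) (c : nat -> R).
Hypothesis c_bd : forall n, -1 < c n <= 0.
Hypothesis cB : forall n, fchart E (B n) [set s | -1 <= s < c n] (F n) t.
Hypothesis BM : forall n x, (B n x /\ -1 < t x) <-> (M x /\ t x < c n).
Hypothesis ori : forall n x y, M x -> t x < c n -> E x y -> Fq x < Fq y -> F n x < F n y.
Let A : set T := M `|` \bigcup_n B n.
Hypothesis haus : forall x y, A x -> A y -> x <> y -> exists U V,
  [/\ nbhs x U, nbhs y V & forall z, U z -> ~ V z].

(** The midpoint of -1 and [c n]: [F n] is used unchanged below this level and frozen above it. *)
Let cut n : R := (c n - 1) / 2.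

Let cut_bd n : -1 < cut n < c n.
Proof. by rewrite /cut; have := c_bd n; lra. Qed.

Let edge n (x : T) : Prop := B n x /\ t x = -1.

Let M_t x : M x -> -1 < t x <= 0. Proof. exact: (fchart_J cM). Qed.

Let edge_nM n x : edge n x -> ~ M x. Proof. by move=> [_ e] /M_t; lra. Qed.

Let B_edge n x : B n x -> ~ M x -> edge n x.
Proof.
move=> Bx nM; split => //; have := fchart_J (cB n) Bx; rewrite /= => h.
by apply: contrapT => h'; apply: nM; apply: (iffLR (BM n x) _).1; split => //; lra.
Qed.

Let edge_B n m x : edge n x -> B m x -> edge m x.
Proof. by move=> [_ e] Bm; split. Qed.

Let edge_sat n x y : edge n x -> edge n y -> E x y.
Proof. by move=> [Bx tx] [By ty]; apply/(fchart_leaf (cB n)) => //; rewrite tx. Qed.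

Let A_case x : A x -> M x \/ exists n, edge n x.
Proof.
move=> [|[n _ Bx]]; first by left.
by have [|nM] := pselect (M x); [left | right; exists n; exact: B_edge].
Qed.

Let oA : open A.
Proof. by apply: openU; [exact: fchart_open cM | apply: bigcup_open => n _; exact: fchart_open (cB n)]. Qed.

Let t_cvg x : A x -> t y @[y --> x] --> t x.
Proof. by move=> [|[n _]]; [exact: (fchart_t cM) | exact: (fchart_t (cB n))]. Qed.

(* Moves x along its fibre of Fq into the domain of the n-th chart. *)
Let slide n (x : T) : T := xget x [set y | [/\ M x, M y, Fq y = Fq x & t y = Num.min (t x) (cut n)]].

Let slideP n x : M x -> [/\ M (slide n x), Fq (slide n x) = Fq x & t (slide n x) = Num.min (t x) (cut n)].
Proof.
move=> Mx; suff : [set y | [/\ M x, M y, Fq y = Fq x & t y = Num.min (t x) (cut n)]] (slide n x).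
  by case.
have hx := M_t Mx; have hc := cut_bd n; have hc' := c_bd n.
have [||y [My Fy ty]] := @fchart_at _ _ _ _ _ _ (Fq x) (Num.min (t x) (cut n)) cM.
- exact: (fchart_Fb cM).
- by rewrite /J /=; case: (leP (t x) (cut n)) => h; lra.
- by apply: xgetPex; exists y.
Qed.

Let slide_lt n x : M x -> t (slide n x) < c n.
Proof.
move=> Mx; have [_ _ ->] := slideP n Mx; have := cut_bd n.
by case: (leP (t x) (cut n)) => h; lra.
Qed.

Let slideB n x : M x -> B n (slide n x).
Proof.
move=> Mx; have [Ms _ _] := slideP n Mx.
by apply: (iffRL (BM n _) _).1; split => //; exact: slide_lt.
Qed.

Let slide_low n x : t x <= cut n -> slide n x = x.
Proof.
move=> h; have [Mx|nM] := pselect (M x).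
  have [Ms Fs ts] := slideP n Mx; apply: (fchart_inj cM) => //.
  by rewrite ts; case: (leP (t x) (cut n)) => //; lra.
by rewrite /slide xgetPN // => y [].
Qed.

Let slide_out n x : ~ M x -> slide n x = x.
Proof. by move=> nM; rewrite /slide xgetPN // => y []. Qed.

Let slide_cvg n x : M x -> slide n y @[y --> x] --> slide n x.
Proof.
move=> Mx N nN; have [Ms Fs ts] := slideP n Mx.
have [d d0 H] := fchart_inv cM Ms nN.
have nM : \forall y \near x, M y by apply: (fchart_nbhs cM).
have n1 := rlim_near (nbhs_filter x) (fchart_F cM Mx) d0.
have n2 := rlim_near (nbhs_filter x)
  (rlim_min (nbhs_filter x) (fchart_t cM Mx) (@rlim_cst _ _ (nbhs_filter x) (cut n))) d0.
change (\forall y \near x, N (slide n y)).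
near=> y; have My : M y by near: y.
have [My' Fy ty] := slideP n My; apply: H => //.
  by rewrite Fy Fs; near: y.
by rewrite ty ts; near: y.
Unshelve. all: by end_near. Qed.

(* The limit of F n o slide n at a boundary leaf outside B n, see edge_sgn. *)
Let sgn n (x : T) : R := if pselect (\forall y \near x, M y -> 0 < F n (slide n y)) then 1 else -1.

(** On a boundary leaf of the n-th chart [slide] is the identity, by its default value outside M, so
    [F n] itself is taken there; the remaining boundary leaves receive the constant [sgn]. *)
Let u n (x : T) : R := if pselect (B n (slide n x)) then F n (slide n x) else sgn n x.

Let u_M n x : M x -> u n x = F n (slide n x).
Proof. by move=> /(slideB n) h; rewrite /u; case: pselect. Qed.

Let u_low n x : B n x -> t x <= cut n -> u n x = F n x.
Proof. by move=> Bx h; rewrite /u slide_low//; case: pselect. Qed.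

Let u_edge n x : edge n x -> u n x = F n x.
Proof. by move=> [Bx tx]; rewrite u_low// tx; have := cut_bd n; lra. Qed.

Let u_out n x : ~ M x -> ~ B n x -> u n x = sgn n x.
Proof. by move=> nM nB; rewrite /u slide_out//; case: pselect. Qed.

Let u_strict n x : M x \/ B n x -> -1 < u n x < 1.
Proof.
have [Mx _|nM [//|Bx]] := pselect (M x).
  by rewrite u_M//; apply: (fchart_Fb (cB n)); exact: slideB.
by rewrite u_edge; [exact: (fchart_Fb (cB n)) | exact: B_edge].
Qed.

Let u_bd x : bdd1 (u^~ x).
Proof.
move=> n; rewrite /u; case: pselect => [h|?] /=; first by have := fchart_Fb (cB n) h; lra.
by rewrite /sgn; case: pselect => [?|?] /=; lra.
Qed.

Let u_cvgM n x : M x -> u n y @[y --> x] --> u n x.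
Proof.
move=> Mx; apply: rlim_itv => e e0.
have nM : \forall y \near x, M y by apply: (fchart_nbhs cM).
have h := fchart_F (cB n) (slideB n Mx).
have h2 : F n (slide n y) @[y --> x] --> F n (slide n x).
  by apply: cvg_comp h; exact: slide_cvg.
have n1 := rlim_near (nbhs_filter x) h2 e0.
near=> y; have My : M y by near: y.
by rewrite !u_M//; near: y.
Unshelve. all: by end_near. Qed.

Let u_mono n x y : M x -> E x y -> Fq x < Fq y -> u n x < u n y.
Proof.
move=> Mx Exy h; have [My ty] := iffLR (fchart_E cM y Mx) Exy.
have [M1 F1 t1] := slideP n Mx; have [M2 F2 t2] := slideP n My.
rewrite !u_M//; apply: ori => //; first exact: slide_lt.
  by apply/(fchart_leaf cM) => //; rewrite t1 t2 ty.
by rewrite F1 F2.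
Qed.

Let u_mono' n x y : M x -> E x y -> u n x < u n y -> Fq x < Fq y.
Proof.
move=> Mx Exy h; have [My ty] := iffLR (fchart_E cM y Mx) Exy.
case: (ltrgtP (Fq x) (Fq y)) => // [h'|e].
  by have := u_mono n My (Esym Exy) h'; lra.
by move: h; rewrite (fchart_inj cM Mx My e) ?ltxx.
Qed.

(** Above the level [cut n], sliding along the fibres of Fq carries a leaf bijectively onto the leaf
    at that level, where [F n] is onto (-1, 1). *)
Let u_chart n : fchart E M J (u n) t.
Proof.
apply: (fchart_refiber cM).
- by move=> x; exact: u_cvgM.
- by move=> x y Mx My txy; apply: u_mono => //; apply/(fchart_leaf cM).
- by move=> x Mx; apply: u_strict; left.
move=> s x s1 Mx; have hx := M_t Mx; have hc := cut_bd n.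
have [|y [By Fy ty]] := @fchart_at _ _ _ _ _ _ s (Num.min (t x) (cut n)) (cB n) s1.
  by case: (leP (t x) (cut n)) => h /=; lra.
have t1 : -1 < t y by rewrite ty; case: (leP (t x) (cut n)) => h /=; lra.
have [My _] := iffLR (BM n y) (conj By t1).
have [q [Mq Fqq tq]] := fchart_at cM (fchart_Fb cM My) (fchart_J cM Mx).
exists q; split => //; rewrite u_M// -Fy; congr (F n _).
have [Ms Fs ts] := slideP n Mq; apply: (fchart_inj cM) => //.
  by rewrite Fs.
by rewrite ts tq.
Qed.

Let edge_dense n x N : edge n x -> nbhs x N -> exists d : R, 0 < d /\
  forall s : R, -1 < s < -1 + d -> exists y, [/\ M y, N y & t y = s].
Proof.
move=> [Bx tx] nN; have [d [d0 H]] := fchart_near (cB n) Bx nN.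
have [d' [d'0 d1 d2]] := @pos_min d (c n + 1) d0 ltac:(have := c_bd n; lra).
exists d'; split => // s hs.
have [||y [By _ ty]] := @fchart_at _ _ _ _ _ _ 0 s (cB n) => /=; [lra | lra | ].
have [v [Bv Nv tv _]] := H y By ltac:(rewrite tx ty; lra).
exists v; split => //; last by rewrite tv.
by apply: (iffLR (BM n v) _).1; split => //; rewrite tv ty; lra.
Qed.

(* A point z and the compact part |F n| <= k of another boundary leaf have disjoint
   neighbourhoods, so near z the continued coordinate is larger than k in modulus. *)
Let edge_away n m z (k : R) : edge m z -> ~ B n z -> k < 1 ->
  \forall x \near z, M x -> k < `|u n x|.
Proof.
move=> ez nBz k1; have Az : A z by right; exists m => //; exact: ez.1.
have [k0|k0] := ltP k 0.
  by near=> x => _; apply: (lt_le_trans k0).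
have /compact_near_coveringP/near_covering_withinP key := @segment_compact R (- k) k.
have hc := cut_bd n.
have nN : nbhs z [set x | `[- k, k]%classic `<=` (fun s => M x -> t x <= cut n -> F n x <> s)].
  apply: (key T (nbhs z) (fun x s => M x -> t x <= cut n -> F n x <> s)).
  move=> s; rewrite /= in_itv /= => hs.
  have [||p [Bp Fp tp]] := @fchart_at _ _ _ _ _ _ s (-1) (cB n) => /=; [lra | lra |].
  have Ap : A p by right; exists n.
  have zp : z <> p by move=> e; apply: nBz; rewrite e.
  have [U [V [nU nV UV]]] := haus Az Ap zp.
  have [d d0 Hd] := fchart_inv (cB n) Bp nV.
  have n1 := rlim_near (nbhs_filter z) (t_cvg Az) d0; rewrite ez.2 in n1.
  exists ([set r | s - d < r < s + d], U `&` [set x | -1 - d < t x < -1 + d]) => /=.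
    by split; [apply/nbhs_ballP; exists d => // r; rewrite /ball /= ltr_distl; lra | exact: filterI].
  move=> [r x] [/= hr [Ux hx]]; rewrite in_itv /= => hr' Mx tx Fx.
  apply: (UV x Ux); apply: Hd; rewrite ?tp ?Fp ?Fx//.
  by apply: (iffRL (BM n x) _).1; split => //; lra.
have nt : \forall x \near z, t x < cut n.
  by apply: (cvgr_lt (t z)); [exact: t_cvg | rewrite ez.2; lra].
near=> x => Mx; have h1 : t x < cut n by near: x.
have h2 : `[- k, k]%classic `<=` (fun s => M x -> t x <= cut n -> F n x <> s) by near: x.
have Bx : B n x by apply: (iffRL (BM n x) _).1; split => //; lra.
rewrite u_low//; last exact: ltW.
rewrite ltNge; apply/negP; rewrite ler_norml => h.
have hs : `[- k, k]%classic (F n x) by rewrite /= in_itv.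
by apply: (h2 (F n x) hs) => //; exact: ltW.
Unshelve. all: by end_near. Qed.

(** By [edge_away] with k = 0 the continued coordinate has no zero in M near z. The part in M of a
    box around z is a box in a chart, so a change of sign would produce a zero. *)
Let edge_sgn n m z : edge m z -> ~ B n z ->
  (sgn n z = 1 /\ \forall x \near z, M x -> 0 < u n x) \/
  (sgn n z = -1 /\ \forall x \near z, M x -> u n x < 0).
Proof.
move=> ez nBz; have n0 := edge_away ez nBz ltr01.
have [Bz tz] := ez.
have [d d0 H] := fchart_inv (cB m) Bz n0.
have cW := fchart_strip (cB m) (a := -1) (b := c m) ltac:(move=> s /=; lra).
set W := B m `&` _ in cW.
have WM x : W x -> M x by move=> [Bx /= hx]; apply: (iffLR (BM m x) _).1; split => //; lra.
have nB : \forall x \near z, B m x by apply: (fchart_nbhs (cB m)).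
have n1 := rlim_near (nbhs_filter z) (fchart_F (cB m) Bz) d0.
have n2 := rlim_near (nbhs_filter z) (fchart_t (cB m) Bz) d0.
pose V x := [/\ B m x, F m z - d < F m x < F m z + d & t z - d < t x < t z + d].
have nV : \forall x \near z, V x by near=> x; split; near: x.
have const x y : V x -> M x -> V y -> M y -> u n x < 0 -> 0 < u n y -> False.
  move=> [Bx Fx tx] Mx [By Fy ty] My ux uy.
  have jx := fchart_J (cB m) Bx; have jy := fchart_J (cB m) By; rewrite /= in jx jy.
  have Wx : W x by split => //=; have := M_t Mx; lra.
  have Wy : W y by split => //=; have := M_t My; lra.
  have [|r [Wr ur Fr tr]] := @fchart_ivt _ _ _ _ _ _ cW (@Iab_interval _ _) (u n) 0 x y
    (fun r Wr => u_cvgM (WM r Wr)) Wx Wy; first by lra.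
  have := H r Wr.1; rewrite /btw in Fr tr; move=> /(_ ltac:(lra) ltac:(lra) (WM r Wr)).
  by rewrite ur normr0 ltxx.
have [pos|npos] := pselect (\forall y \near z, M y -> 0 < F n (slide n y)).
  left; split; first by rewrite /sgn; case: pselect.
  by apply: filterS pos => x h Mx; rewrite u_M//; exact: h.
right; split; first by rewrite /sgn; case: pselect.
have neg x : V x -> M x -> ~ 0 < u n x.
  move=> Vx Mx ge; apply: npos; apply: filterS2 nV n0 => y Vy n0y My.
  rewrite -u_M// ltNge; apply/negP => le.
  have := n0y My; rewrite normr_gt0 => nz.
  by apply: (const y x Vy My Vx Mx) => //; rewrite lt_neqAle nz.
apply: filterS2 nV n0 => x Vx n0x Mx.
have := n0x Mx; rewrite normr_gt0 => nz; rewrite lt_neqAle nz leNgt.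
by apply/negP; exact: neg.
Unshelve. all: by end_near. Qed.

(** The case to settle is a boundary leaf outside [B n]: on M the modulus tends to 1 with a fixed
    sign. Points y of the boundary leaf itself have the same [sgn], since points of M close to y are
    close to x. *)
Let u_cvg n x : A x -> u n y @[y --> x] --> u n x.
Proof.
move=> Ax; have [Mx|[m ex]] := A_case Ax; first exact: u_cvgM.
have hc := cut_bd n; apply: rlim_itv => e e0.
have [Bx|nB] := pselect (B n x).
  have nB : \forall y \near x, B n y by apply: (fchart_nbhs (cB n)).
  have nt : \forall y \near x, t y < cut n.
    by apply: (cvgr_lt (t x)); [exact: t_cvg | rewrite ex.2; lra].
  have n1 := rlim_near (nbhs_filter x) (fchart_F (cB n) Bx) e0.
  near=> y; have By : B n y by near: y.
  have ty : t y < cut n by near: y.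
  rewrite (u_low By (ltW ty)) (u_edge (conj Bx ex.2)).
  by near: y.
have nBm : \forall y \near x, B m y by apply: (fchart_nbhs (cB m)); exact: ex.1.
have edge_case y : B m y -> ~ M y -> edge m y /\ ~ B n y.
  move=> By nM; have ey := B_edge By nM; split => // Bny; apply: nB.
  exact: fchart_sat (cB n) Bny (edge_sat ey ex).
have k1 : 1 - e / 2 < 1 by lra.
have far := edge_away ex nB k1.
rewrite (u_out (edge_nM ex) nB).
have [[-> pos]|[-> neg]] := edge_sgn ex nB.
  have pos' := nbhs_interior pos.
  near=> y; have By : B m y by near: y.
  have [My|nM] := pselect (M y).
    have h1 : M y -> 0 < u n y by near: y.
    have h2 : M y -> 1 - e / 2 < `|u n y| by near: y.
    have := h2 My; have := h1 My; have := u_bd y n; move=> b p; rewrite gtr0_norm//; lra.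
  have [ey nBy] := edge_case y By nM; rewrite u_out//.
  have [[-> _]|[_ neg]] := edge_sgn ey nBy; first by lra.
  have pos2 : \forall w \near y, M w -> 0 < u n w by near: y.
  have [d [d0 H]] := edge_dense ey (filterI pos2 neg).
  by have [w [Mw [h1 h2] _]] := H (-1 + d / 2) ltac:(lra); have := h1 Mw; have := h2 Mw; lra.
have neg' := nbhs_interior neg.
near=> y; have By : B m y by near: y.
have [My|nM] := pselect (M y).
  have h1 : M y -> u n y < 0 by near: y.
  have h2 : M y -> 1 - e / 2 < `|u n y| by near: y.
  have := h2 My; have := h1 My; have := u_bd y n; move=> b p; rewrite ltr0_norm//; lra.
have [ey nBy] := edge_case y By nM; rewrite u_out//.
have [[_ pos]|[-> _]] := edge_sgn ey nBy; last by lra.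
have neg2 : \forall w \near y, M w -> u n w < 0 by near: y.
have [d [d0 H]] := edge_dense ey (filterI neg2 pos).
by have [w [Mw [h1 h2] _]] := H (-1 + d / 2) ltac:(lra); have := h1 Mw; have := h2 Mw; lra.
Unshelve. all: by end_near. Qed.

(* The order of boundary points is inherited from the order on the nearby lines of M,
   which is the same for all coordinates. *)
Let edge_order n m k x y i : edge n x -> edge m y -> u k x < u k y -> u i x <= u i y.
Proof.
move=> ex ey h; rewrite leNgt; apply/negP => h'.
have Ax : A x by right; exists n => //; exact: ex.1.
have Ay : A y by right; exists m => //; exact: ey.1.
have mid (a b : R) : a < b -> a < (a + b) / 2 < b by lra.
have /andP[h1 h2] := mid _ _ h; have /andP[h3 h4] := mid _ _ h'.
have n1 : \forall z \near x, u k z < (u k x + u k y) / 2.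
  by apply: (cvgr_lt (u k x)) => //; exact: u_cvg.
have n2 : \forall z \near x, (u i y + u i x) / 2 < u i z.
  by apply: (cvgr_gt (u i x)) => //; exact: u_cvg.
have n3 : \forall z \near y, (u k x + u k y) / 2 < u k z.
  by apply: (cvgr_gt (u k y)) => //; exact: u_cvg.
have n4 : \forall z \near y, u i z < (u i y + u i x) / 2.
  by apply: (cvgr_lt (u i y)) => //; exact: u_cvg.
have [d1 [d10 H1]] := edge_dense ex (filterI n1 n2).
have [d2 [d20 H2]] := edge_dense ey (filterI n3 n4).
have [d [d0 e1 e2]] := pos_min d10 d20.
have [x' [Mx' [/= k1 k2] tx']] := H1 (-1 + d / 2) ltac:(lra).
have [y' [My' [/= k3 k4] ty']] := H2 (-1 + d / 2) ltac:(lra).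
have Exy : E x' y' by apply/(fchart_leaf cM) => //; rewrite tx'.
have := u_mono i Mx' Exy (u_mono' Mx' Exy (lt_trans k1 k3)).
by move=> k5; have := lt_trans (lt_trans k4 k2) k5; rewrite ltxx.
Qed.

Let G (x : T) : R := wsum (u^~ x).

Let G_lt n m k x y : edge n x -> edge m y -> u k x < u k y -> G x < G y.
Proof.
move=> ex ey h; apply: (wsum_lt (u_bd x) (u_bd y) _ h) => i.
exact: (edge_order i ex ey h).
Qed.

Let G_cvg x : A x -> G y @[y --> x] --> G x.
Proof.
move=> Ax; apply: wsum_lim.
- by near=> y; exact: u_bd.
- exact: u_bd.
- by move=> n; exact: u_cvg.
Unshelve. all: by end_near. Qed.

Let G_bd x : A x -> -1 < G x < 1.
Proof.
move=> Ax; have b1 : bdd1 (fun=> 1) by move=> n; lra.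
have b2 : bdd1 (fun=> - 1) by move=> n; lra.
have [n h] : exists n, -1 < u n x < 1.
  case: Ax => [Mx|[n _ Bx]]; last by exists n; apply: u_strict; right.
  by exists 0%N; apply: u_strict; left.
apply/andP; split; last first.
  rewrite -wsum1; apply: (@wsum_lt _ _ n (u_bd x) b1) => [m|]; last by lra.
  by have := u_bd x m; lra.
rewrite -wsum1 -wsumN//; apply: (@wsum_lt _ _ n b2 (u_bd x)) => [m|]; last by lra.
by have := u_bd x m; lra.
Qed.

Let G_mono x y : M x -> E x y -> Fq x < Fq y -> G x < G y.
Proof.
move=> Mx Exy h; apply: (@wsum_lt _ _ 0); [exact: u_bd | exact: u_bd | move=> n |].
  by apply: ltW; exact: u_mono.
exact: u_mono.
Qed.

(** A blend with all weights equal to 1 is the weighted sum itself, so [blend_top] applies. *)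
Let G_top (v : nat -> T -> R) x (s : R) : (forall n, fchart E M J (v n) t) ->
  (forall n m y z, M y -> E y z -> v n y < v n z -> v m y < v m z) ->
  M x -> s < 1 -> exists y, E x y /\ s < wsum (v^~ y).
Proof.
move=> cv mv Mx s1.
have [||||||y [Exy h]] := @blend_top _ E M t (fun _ _ => 1) v _ _ _ _ _ _ x s Mx s1.
- exact: (fchart_E cM).
- by move=> n y _; lra.
- by [].
- by move=> y _; exists 0%N; lra.
- by move=> n y My _; exists M, J, t; split.
- by move=> n m y z My Eyz _ _; exact: mv.
exists y; split => //; move: h; rewrite /blend wsum1 divr1.
by rewrite (_ : (fun n => 1 * v n y) = v^~ y)//; apply: funext => n; rewrite mul1r.
Qed.

Let G_chart : fchart E M J G t.
Proof.
have mu n m y z : M y -> E y z -> u n y < u n z -> u m y < u m z.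
  by move=> My Eyz h; apply: u_mono => //; exact: u_mono' h.
apply: (fchart_refiber cM).
- by move=> x Mx; apply: G_cvg; left.
- by move=> x y Mx My txy; apply: G_mono => //; apply/(fchart_leaf cM).
- by move=> x Mx; apply: G_bd; left.
move=> s x s1 Mx.
have [|y [Exy hy]] := G_top u_chart mu Mx (s := s); first by lra.
have [|||z [Exz hz]] := @G_top (fun n x => - u n x) x (- s) _ _ Mx.
- by move=> n; exact: fchart_flipF.
- move=> n m y' z' My Eyz; rewrite !ltrN2; have [Mz _] := iffLR (fchart_E cM z' My) Eyz.
  by apply: mu => //; exact: Esym.
- by lra.
have [My ty] := iffLR (fchart_E cM y Mx) Exy.
have [Mz tz] := iffLR (fchart_E cM z Mx) Exz.
rewrite wsumN ?ltrN2 in hz; last exact: u_bd.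
have [|||r [Mr Gr _ tr]] := @fchart_ivt _ _ _ _ _ _ cM _ G s z y _ Mz My.
- by move=> a b /= ha hb v hv; rewrite /J /=; rewrite /J /= in ha hb; lra.
- by move=> r Mr; apply: G_cvg; left.
- by rewrite /G; lra.
by exists r; split => //; move: tr; rewrite /btw ty tz; lra.
Qed.

Let G_edge_mono n x y : edge n x -> edge n y -> F n x < F n y -> G x < G y.
Proof. by move=> ex ey h; apply: (G_lt ex ey (k := n)); rewrite !u_edge. Qed.

(** If G agrees at two boundary points, every [u k] agrees there by [G_lt]. For a chart n containing
    x this value lies strictly inside (-1, 1), whereas it would be 1 or -1 at y outside [B n]; so
    both points are in [B n], where [F n] is injective. *)
Let G_inj x y : A x -> A y -> G x = G y -> t x = t y -> x = y.
Proof.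
move=> Ax Ay Gxy txy; have [Mx|[n ex]] := A_case Ax; have [My|[m ey]] := A_case Ay.
- exact: (fchart_inj G_chart).
- by exfalso; have := M_t Mx; have := ey.2; lra.
- by exfalso; have := M_t My; have := ex.2; lra.
have no k : u k x = u k y.
  case: (ltrgtP (u k x) (u k y)) => // h.
    by have := G_lt ex ey h; rewrite Gxy ltxx.
  by have := G_lt ey ex h; rewrite Gxy ltxx.
have [By|nB] := pselect (B n y).
  apply: (fchart_inj (cB n)) => //; first exact: ex.1.
  by rewrite -(u_edge ex) -(u_edge (edge_B ey By)).
exfalso; have := @u_strict n x (or_intror ex.1); rewrite (no n) u_out//; last exact: edge_nM ey.
by rewrite /sgn; case: pselect => [?|?] /=; lra.
Qed.

Let G_edge_itv n : exists a b : R, [/\ -1 <= a, a < b, b <= 1 & G @` edge n = Iab a b].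
Proof.
have hc := c_bd n.
have ept (s : R) : -1 < s < 1 -> exists x, edge n x /\ F n x = s.
  move=> hs; have [|x [Bx Fx tx]] := @fchart_at _ _ _ _ _ _ s (-1) (cB n) hs; first by move=> /=; lra.
  by exists x.
have eA x : edge n x -> A x by move=> [Bx _]; right; exists n.
have itv : is_interval (G @` edge n).
  move=> _ _ [x ex <-] [y ey <-] s hs.
  have [||r [Br Gr _ tr]] := @fchart_ivt _ _ _ _ _ _ (cB n) (@half_interval _ _) G s x y _ ex.1 ey.1.
  - by move=> r Br; apply: G_cvg; right; exists n.
  - by lra.
  by exists r => //; split => //; move: tr; rewrite /btw ex.2 ey.2; lra.
have [|||a [b [ab e]]] := @open_interval_Iab (G @` edge n) (-1) 1 _ _ itv.
- by have [x [ex _]] := ept 0 ltac:(lra); exists (G x), x.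
- rewrite openE => _ [x ex <-]; rewrite /interior; have b := fchart_Fb (cB n) ex.1.
  have [y [ey Fy]] := ept ((F n x - 1) / 2) ltac:(lra).
  have [z [ez Fz]] := ept ((F n x + 1) / 2) ltac:(lra).
  have h1 := G_edge_mono ey ex ltac:(lra); have h2 := G_edge_mono ex ez ltac:(lra).
  have [d [d0 e1 e2]] := @pos_min (G x - G y) (G z - G x) ltac:(lra) ltac:(lra).
  apply/nbhs_ballP; exists d => // s; rewrite /ball /= ltr_distl => hs.
  by apply: (itv (G y) (G z)); [exists y | exists z | lra].
- by move=> _ [x /eA/G_bd h <-]; lra.
have Iab_in (s : R) : Iab a b s -> -1 < s < 1.
  by rewrite -e => -[x /eA/G_bd h <-].
exists a, b; split => //; rewrite leNgt; apply/negP => h.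
  have [s [h1 h2 h3]] := @gt_between (-1) b a ltac:(lra) ltac:(lra).
  by have := Iab_in s ltac:(rewrite /Iab /=; lra); lra.
have [s [h1 h2 h3]] := @lt_between 1 a b ltac:(lra) ltac:(lra).
by have := Iab_in s ltac:(rewrite /Iab /=; lra); lra.
Qed.

(** At a point of M, a bound on t excludes the boundary leaves. At a boundary point, values of G
    close to G x stay in the open interval of this leaf, so [G_inj] excludes the other boundary
    leaves; points of M at low level are in [B n], where [fchart_sandwich] applies. *)
Let G_inv x N : A x -> nbhs x N -> exists2 d : R, 0 < d & forall y, A y ->
  G x - d < G y < G x + d -> t x - d < t y < t x + d -> N y.
Proof.
move=> Ax nN; have [Mx|[n ex]] := A_case Ax.
  have [d d0 H] := fchart_inv G_chart Mx nN; have hx := M_t Mx.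
  have [d' [d'0 e1 e2]] := @pos_min d (t x + 1) d0 ltac:(lra).
  exists d' => // y Ay h1 h2; have [My|[m ey]] := A_case Ay.
    by apply: H => //; lra.
  by have := ey.2; lra.
have [|d d0 H] := fchart_sandwich (cB n) (fun y By => G_cvg (or_intror (ex_intro2 _ _ n I By))) _ ex.1 nN.
  move=> p q Bp Bq tpq Fpq; have Epq : E p q by apply/(fchart_leaf (cB n)).
  have [Mp|nM] := pselect (M p).
    have [Mq _] := iffLR (fchart_E cM q Mp) Epq.
    have [_ hp] := iffLR (BM n p) (conj Bp (proj1 (andP (M_t Mp)))).
    apply: G_mono => //; case: (ltrgtP (Fq p) (Fq q)) => // [h|e].
      by have := ori Mq (n := n) ltac:(rewrite -tpq//) (Esym Epq) h; lra.
    by move: Fpq; rewrite (fchart_inj cM Mp Mq e tpq) ltxx.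
  have ep := B_edge Bp nM; apply: (G_edge_mono ep) => //.
  by split => //; rewrite -tpq ep.2.
have [a [b [_ ab _ e]]] := G_edge_itv n.
have : (G @` edge n) (G x) by exists x.
rewrite e /Iab /= => hGx.
have hc := c_bd n; have tx := ex.2.
have [d1 [d10 e1 e2]] := @pos_min (G x - a) (b - G x) ltac:(lra) ltac:(lra).
have [d2 [d20 e3 e4]] := @pos_min d (c n + 1) d0 ltac:(lra).
have [d3 [d30 e5 e6]] := pos_min d10 d20.
exists d3 => // y Ay h1 h2.
suff By : B n y by apply: H => //; lra.
have [My|[m ey]] := A_case Ay.
  by apply: (iffRL (BM n y) _).1; split => //; lra.
have : (G @` edge n) (G y) by rewrite e /Iab /=; lra.
move=> [y' ey' Gy']; rewrite -(@G_inj y' y) //; first exact: ey'.1.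
  by right; exists n => //; exact: ey'.1.
by rewrite ey'.2 ey.2.
Qed.

(** The third clause also makes the intervals of different boundary leaves disjoint, because t = -1
    on all of them. *)
Lemma edge_gluing : exists G : T -> R, [/\
  forall x, A x -> G y @[y --> x] --> G x,
  forall x, A x -> -1 < G x < 1,
  forall x y, A x -> A y -> G x = G y -> t x = t y -> x = y,
  forall x N, A x -> nbhs x N -> exists2 d : R, 0 < d & forall y, A y ->
    G x - d < G y < G x + d -> t x - d < t y < t x + d -> N y &
  fchart E M J G t /\ forall n x, B n x -> t x = -1 -> exists a b : R,
    [/\ -1 <= a, a < b, b <= 1 & G @` [set y | E x y] = Iab a b]].
Proof.
exists G; split => //; split => // n x Bx tx.
rewrite (_ : [set y | E x y] = edge n); first exact: G_edge_itv.
apply/seteqP; split=> [y /(fchart_E (cB n) y Bx) [By ty]|y ey].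
  by split => //; rewrite ty.
by apply: (edge_sat (n := n)).
Qed.

End edge_gluing.

Lemma fchart_ext (T : topologicalType) (E : T -> T -> Prop) P J F t t' :
  fchart E P J F t -> (forall x, P x -> t' x = t x) -> fchart E P J F t'.
Proof.
move=> c e; split => //.
- exact: fchart_open c.
- exact: fchart_F c.
- move=> x Px; apply: rlim_itv => d d0.
  have nP : \forall y \near x, P y by apply: (fchart_nbhs c).
  have n1 := rlim_near (nbhs_filter x) (fchart_t c Px) d0.
  by near=> y; have Py : P y by [near: y]; rewrite !e//; near: y.
- exact: fchart_Fb c.
- by move=> x Px; rewrite e//; exact: (fchart_J c).
- by move=> x s x1 Js; have [p [Pp Fp tp]] := fchart_at c x1 Js; exists p; rewrite e.
- move=> x N Px nN; have [d d0 H] := fchart_inv c Px nN; exists d => // y Py.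
  by rewrite !e//; exact: H.
- by move=> x y Px Py; rewrite !e//; exact: (fchart_inj c).
- move=> x y Px; rewrite (fchart_E c y Px) (e x Px).
  by split=> -[Py h]; split => //; move: h; rewrite (e y Py).
Unshelve. all: by end_near. Qed.

Lemma near_subspace (T : topologicalType) (A : set T) (x : T) (N : set T) : A x ->
  nbhs (x : subspace A) N <-> \forall y \near x, A y -> N y.
Proof. by move=> Ax; change (@nbhs_subspace T A x N <-> within A (nbhs x) N); rewrite -nbhs_subspace_in. Qed.

Lemma fchart_subspace (T : topologicalType) (E : T -> T -> Prop) (A P : set T) J J' F t :
  fchart E P J F t -> J' `<=` J -> (forall x, P x -> (A x <-> J' (t x))) ->
  @fchart (subspace A) E (P `&` A) J' F t.
Proof.
move=> c JJ AJ.
have lim (f : T -> R) x : A x -> f y @[y --> x] --> f x ->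
    f y @[y --> (x : subspace A)] --> f x.
  move=> Ax fx; apply: (@rlim_itv _ (nbhs (x : subspace A)) (nbhs_filter (x : subspace A))) => e e0.
  apply/(near_subspace _ Ax); have n1 := rlim_near (nbhs_filter x) fx e0.
  by apply: filterS n1.
split.
- rewrite openE => x [Px Ax]; apply/(near_subspace _ Ax).
  have nP : @nbhs T T x P by apply: (fchart_nbhs c).
  by apply: filterS nP => y Py Ay.
- by move=> x [Px Ax]; apply: lim => //; exact: (fchart_F c).
- by move=> x [Px Ax]; apply: lim => //; exact: (fchart_t c).
- by move=> x [Px _]; exact: (fchart_Fb c).
- by move=> x [Px Ax]; apply/AJ.
- move=> x s x1 Js; have [p [Pp Fp tp]] := fchart_at c x1 (JJ s Js).
  by exists p; split => //; split => //; apply/AJ => //; rewrite tp.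
- move=> x N [Px Ax] /(near_subspace _ Ax) nN; have [d d0 H] := fchart_inv c Px nN.
  by exists d => // y [Py Ay] h1 h2; exact: H.
- by move=> x y [Px _] [Py _]; exact: (fchart_inj c).
- move=> x y [Px Ax]; rewrite (fchart_E c y Px).
  split=> [[Py txy]|[[Py _] txy]] //; split => //; split => //.
  by apply/AJ => //; rewrite txy; apply/AJ.
Qed.

Lemma sigma_lt (x y : R) : x < y -> sigma x < sigma y.
Proof.
move=> xy; have hx := normr_ge0 x; have hy := normr_ge0 y.
have px : 0 < 1 + `|x| by lra.
have py : 0 < 1 + `|y| by lra.
rewrite /sigma ltr_pdivrMr// mulrAC ltr_pdivlMr//.
move: hx hy px py; case: (ger0P x) => x0; case: (ger0P y) => y0 hx hy px py; try lra.
by have := mulr_ge0_le0 y0 (ltW x0); lra.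
Qed.

(** The values -1 and 1 are not attained by [sigma]; as end values they correspond to infinite end
    points. *)
Lemma open_interval_sigma (a b : R) : -1 <= a -> a < b -> b <= 1 ->
  open_interval [set u | a < sigma u < b].
Proof.
move=> a1 ab b1.
have lt_iff (x y : R) : (x < y) = (sigma x < sigma y).
  apply/idP/idP; first exact: sigma_lt.
  by case: (ltrgtP x y) => // [/sigma_lt|->]; lra.
pose x : \bar R := if a == -1 then -oo%E else (isigma a)%:E.
pose y : \bar R := if b == 1 then +oo%E else (isigma b)%:E.
have xE u : (x < u%:E)%E = (a < sigma u).
  rewrite /x; have [->|h] := eqVneq a (-1).
    by rewrite ltNyr; have /andP[-> _] := sigma_bd u.
  have : -1 < a by rewrite lt_neqAle eq_sym h.
  by move=> h'; rewrite lte_fin (lt_iff (isigma a)) isigmaK//; lra.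
have yE u : (u%:E < y)%E = (sigma u < b).
  rewrite /y; have [->|h] := eqVneq b 1.
    by rewrite ltry; have /andP[_ ->] := sigma_bd u.
  have : b < 1 by rewrite lt_neqAle h.
  by move=> h'; rewrite lte_fin (lt_iff u (isigma b)) isigmaK//; lra.
exists x, y; split; last by apply/seteqP; split=> u /=; rewrite xE yE.
apply: (@lt_trans _ _ (isigma ((a + b) / 2))%:E); [rewrite xE | rewrite yE]; rewrite isigmaK; lra.
Qed.

(** * The closure of a half of an open strip *)

Section half_closure.
Variables (X : topologicalType) (Delta : set (set X)).
Hypothesis CF : class_F Delta.
Hypothesis LF : locally_finite (special_leaf Delta).
Let E := leafE Delta.
Let Gd : set X := ~` (\bigcup_(w in special_leaf Delta) w `|` boundary X).
Variables (Q : set X) (Fq tq : X -> R).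
Hypothesis rgQ : regular E Q.
Hypothesis QG : Q `<=` Gd.
Hypothesis Qmax : forall S, connected S -> S `<=` Gd -> S `&` Q !=set0 -> S `<=` Q.
Hypothesis cQ : fchart E Q (Iab (-1) 1) Fq tq.

Let Erefl := rg_refl rgQ.
Let Esym := rg_sym rgQ.
Let Etrans := rg_trans rgQ.
Let Qsat := rg_sat rgQ.
Let oQ := rg_open rgQ.

Let M : set X := Q `&` [set x | tq x <= 0].
Let A : set X := closure M.

(** The default -1 is the limit of tq at the leaves of the closure outside Q, which makes the height
    continuous on A. *)
Definition height (x : X) : R := if pselect (Q x) then tq x else -1.
Let tA := height.

Let tA_Q x : Q x -> tA x = tq x.
Proof. by rewrite /tA /height; case: pselect. Qed.

Let tA_nQ x : ~ Q x -> tA x = -1.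
Proof. by rewrite /tA /height; case: pselect. Qed.

Let nonsep x y : Q x ->
  (forall U V, nbhs x U -> nbhs y V -> exists a b, [/\ U a, V b & E a b]) -> E x y.
Proof.
move=> Qx; apply: (nonspecial_sep CF) => w sw wx.
by apply: (QG Qx); left; exists w.
Qed.

Lemma half_closure_Q x : Q x -> (A x <-> tq x <= 0).
Proof.
move=> Qx; split=> [Ax|h]; last by apply: subset_closure; split.
rewrite leNgt; apply/negP => h.
have n1 : \forall y \near x, 0 < tq y by apply: (cvgr_gt (tq x)) => //; exact: (fchart_t cQ).
by have [y [[_ /= h1] h2]] := Ax _ n1; lra.
Qed.

Tactic Notation "lra" "from" hyp_list(hs) :=
  clear - hs CF LF E Gd rgQ QG Qmax cQ Erefl Esym Etrans Qsat oQ M A tA tA_Q tA_nQ nonsep; lra.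

(* On a strip of Q next to a leaf outside Q, tq is monotone, and it tends to -1 or 1 since
   a limit inside (-1, 1) would be attained on a leaf of Q not separated from z. *)
Lemma edge_side P J F t z (d : R) : fchart E P J F t -> P z -> t z = 0 -> ~ Q z ->
  0 < d -> (forall s, 0 < s < d -> J s) -> (forall x, P x -> 0 < t x < d -> Q x) ->
  ((forall x y, P x -> 0 < t x < d -> P y -> 0 < t y < d -> (tq x < tq y <-> t x < t y)) /\
   forall e : R, -1 < e -> exists x, [/\ P x, 0 < t x < d & tq x < e]) \/
  ((forall x y, P x -> 0 < t x < d -> P y -> 0 < t y < d -> (tq x < tq y <-> t y < t x)) /\
   forall e : R, e < 1 -> exists x, [/\ P x, 0 < t x < d & e < tq x]).
Proof.
move=> c Pz tz nQz d0 JJ SQ.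
have cS := fchart_strip c JJ; set S := P `&` _ in cS.
have SQ' x : S x -> Q x by move=> [Px hx]; exact: SQ.
have Jopp (s : R) : - d < s < 0 -> [set s | J (- s)] s by move=> hs /=; apply: JJ; lra.
have WQ x : P x -> - d < - t x < 0 -> Q x by move=> Px hx; apply: SQ => //; lra.
have nd : - d < 0 by lra.
have tz' : - t z = 0 by rewrite tz oppr0.
have [||m|m] := fchart_mono cS (@Iab_interval _ _) (h := tq).
- by move=> x /SQ'; exact: (fchart_t cQ).
- by move=> x y Sx Sy; rewrite -(fchart_leaf cQ (SQ' _ Sx) (SQ' _ Sy)) (fchart_leaf cS Sx Sy).
- left; split=> [x y Px hx Py hy|e e1]; first exact: m.
  apply: contrapT => no; apply: nQz.
  apply: (limit_leaf rgQ (fchart_neg cQ) (fun y Qy => @nonsep y z Qy) (fchart_opp c) Jopp nd WQ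
    _ Pz tz' (c := - e)).
  + by move=> x y Px hx Py hy; rewrite !ltrN2 => h; apply/m => //; split => //=; lra from hy hx.
  + by rewrite opprK; lra.
  + move=> x Px hx; rewrite lerN2 leNgt; apply/negP => h; apply: no; exists x; split => //; lra.
- right; split=> [x y Px hx Py hy|e e1]; first exact: m.
  apply: contrapT => no; apply: nQz.
  apply: (limit_leaf rgQ cQ (fun y Qy => @nonsep y z Qy) (fchart_opp c) Jopp nd WQ _ Pz tz' e1).
  + by move=> x y Px hx Py hy; rewrite ltrN2 => h; apply/m => //; split => //=; lra.
  + move=> x Px hx; rewrite leNgt; apply/negP => h; apply: no; exists x; split => //; lra.
Qed.

(** The hypotheses of [edge_gluing] for a single chart, in the subspace topology of A. The level c
    is the one up to which B contains the leaves of the half strip. *)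
Definition edge_datum (B : set X) (F : X -> R) (c : R) : Prop :=
  [/\ @fchart (subspace A) E B [set s | -1 <= s < c] F tA, B `<=` A /\ -1 < c <= 0,
      (forall x, (B x /\ -1 < tA x) <-> (M x /\ tA x < c)) &
      (forall x y, M x -> tA x < c -> E x y -> Fq x < Fq y -> F x < F y)].

(** Near z the set A is just the side t >= 0 of P, since the other side misses it. There the height
    is a continuous increasing function of t, so it can replace t as transverse coordinate. *)
Lemma edge_datum_of_side P J F t z (d d' : R) : fchart E P J F t -> P z -> t z = 0 -> ~ Q z ->
  0 < d -> (forall s, 0 <= s < d -> J s) -> (forall x, P x -> 0 < t x < d -> Q x) ->
  (forall x y, P x -> 0 < t x < d -> P y -> 0 < t y < d -> (tq x < tq y <-> t x < t y)) ->
  (forall e : R, -1 < e -> exists x, [/\ P x, 0 < t x < d & tq x < e]) ->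
  0 < d' -> (forall x, P x -> - d' < t x < 0 -> ~ A x) ->
  exists B F c, edge_datum B F c /\ B z.
Proof.
move=> c Pz tz nQz d0 JJ SQ mono low d'0 nA.
have JJ' (s : R) : 0 < s < d -> J s by move=> hs; apply: JJ; lra.
have cS := fchart_strip c JJ'; set S := P `&` _ in cS.
(* The leaf of y0 bounds the chart: 0 <= t < t y0 corresponds to heights from -1 up to tq y0.
   Choosing tq y0 < 0 keeps these leaves in the half strip. *)
have [y0 [Py0 hy0 ty0]] := low 0 ltac:(lra).
have Qy0 := SQ _ Py0 hy0.
pose eta := t y0; pose c0 := tq y0.
have c0_bd : -1 < c0 < 0 by have := fchart_J cQ Qy0; rewrite /Iab /= /c0; lra.
have edgeA x : P x -> t x = 0 -> A x.
  move=> Px tx N nN; have [k [k0 H]] := fchart_near c Px nN.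
  have [s [s1 s2 s3]] := @gt_between (t y0) k 0 ltac:(lra) k0.
  have [y [Py _ ty]] := @fchart_at _ _ _ _ _ _ 0 s c ltac:(lra from) ltac:(apply: JJ; lra from hy0 s1 s3).
  have hy : 0 < t y < d by lra.
  have [v [Pv Nv tv Ev]] := H y Py ltac:(lra from tx s2 ty hy).
  exists v; split => //; have [Qv tqv] := iffLR (fchart_E cQ v (SQ _ Py hy)) Ev.
  split => //=; have := iffRL (mono y y0 Py hy Py0 hy0) ltac:(lra from s1 ty); lra from ty0 tqv.
pose P' := P `&` [set x | - d' < t x < eta].
have oP' : open P' by exact: (fchart_slab _ _ c).
have cP' : fchart E P' (t @` P') F t.
  by apply: (fchart_restr c) => // [x []|x y [Px h] Py /= txy] //; split => //=; rewrite txy.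
have AP' x : P' x -> (A x <-> 0 <= t x < eta).
  move=> [Px /= hx]; split=> [Ax|h].
    have : ~ t x < 0 by move=> h; apply: (nA x Px) => //; lra.
    by lra.
  have [tx|tx] := eqVneq (t x) 0; first exact: edgeA.
  have hx' : 0 < t x < d.
    have : 0 < t x by rewrite lt_neqAle eq_sym tx; lra.
    by rewrite /eta in h; lra.
  have Qx := SQ _ Px hx'; apply/half_closure_Q => //.
  by have := iffRL (mono x y0 Px hx' Py0 hy0) ltac:(rewrite /eta in h; lra from h); lra from ty0.
pose B := P' `&` A.
have cB0 : @fchart (subspace A) E B [set s | 0 <= s < eta] F t.
  apply: (fchart_subspace cP') => // s /= hs.
  have [p [Pp _ tp]] := @fchart_at _ _ _ _ _ _ 0 s c ltac:(lra from) ltac:(apply: JJ; rewrite /eta in hs; lra from hy0 hs).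
  by exists p => //; split => //=; rewrite tp; lra.
have B_case x : B x -> (Q x /\ 0 < t x < eta) \/ (~ Q x /\ t x = 0).
  move=> [[Px hx] Ax]; have [h0 h1] := andP (iffLR (AP' x (conj Px hx)) Ax).
  have [tx|tx] := eqVneq (t x) 0.
    right; split => // Qx; apply: nQz; apply: (Qsat Qx).
    by apply/(fchart_leaf c) => //; rewrite tx.
  have h2 : 0 < t x by rewrite lt_neqAle eq_sym tx.
  by left; split; [apply: SQ => //; rewrite /eta in h1; lra from hy0 h2 h1 | lra from h1 h2].
have B_P x : B x -> P x by move=> [[]].
have monoB x y : B x -> B y -> Q x -> Q y -> (tq x < tq y <-> t x < t y).
  move=> Bx By Qx Qy; have [[_ hx]|[]//] := B_case x Bx; have [[_ hy]|[]//] := B_case y By.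
  by apply: mono; rewrite ?/eta in hx hy *; [exact: B_P | lra from hy0 hx | exact: B_P | lra from hy0 hy].
have lt_c0 x : B x -> Q x -> -1 < tq x < c0.
  move=> Bx Qx; have [[_ hx]|[]//] := B_case x Bx.
  have := iffRL (mono x y0 (B_P _ Bx) ltac:(rewrite /eta in hx; lra from hy0 hx) Py0 hy0) ltac:(rewrite /eta in hx; lra from hx).
  by have := fchart_J cQ Qx; rewrite /Iab /= /c0; lra from.
(* No leaf of Q below the level c0 escapes: on the strip tq comes arbitrarily close to -1, so the
   intermediate value theorem finds the leaf there. *)
have MB x : Q x -> tq x < c0 -> B x /\ 0 < t x.
  move=> Qx hx; have jx := fchart_J cQ Qx; rewrite /Iab /= in jx.
  have [x1 [Px1 hx1 tx1]] := low (tq x) ltac:(lra from jx).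
  have [|r [[Pr /= hr] tr _ _]] := @fchart_ivt _ _ _ _ _ _ cS (@Iab_interval _ _) tq (tq x) x1 y0
    (fun y Sy => fchart_t cQ (SQ _ Sy.1 Sy.2)) (conj Px1 hx1) (conj Py0 hy0); first by rewrite /c0 in hx; lra from tx1 hx.
  have Erx : E r x by apply/(fchart_leaf cQ) => //; exact: SQ.
  have [Px txr] := iffLR (fchart_E c x Pr) Erx.
  have := iffLR (mono r y0 Pr hr Py0 hy0) ltac:(rewrite /c0 in hx; lra) => h.
  have Ax : A x by apply/half_closure_Q => //; lra from c0_bd hx.
  by split; [split => //; split => //=; rewrite /eta; lra from d'0 hr txr h | lra from hr txr].
have tA_cvg x : B x -> tA y @[y --> (x : subspace A)] --> tA x.
  move=> Bx; have [_ Ax] := Bx.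
  apply: (@rlim_itv _ (nbhs (x : subspace A)) (nbhs_filter (x : subspace A))) => e e0.
  apply/(near_subspace _ Ax); have [[Qx hx]|[nQx tx]] := B_case x Bx.
    have nQ : \forall y \near x, Q y by apply: open_nbhs_nbhs.
    have n1 := rlim_near (nbhs_filter x) (fchart_t cQ Qx) e0.
    by near=> y => _; rewrite !tA_Q//; near: y.
  have [y1 [Py1 hy1 ty1]] := low (-1 + e) ltac:(lra from e0).
  have nP' : \forall y \near x, P' y by apply: open_nbhs_nbhs; split => //; exact: Bx.1.
  have nt : \forall y \near x, t y < t y1.
    by apply: (cvgr_lt (t x)); [exact: (fchart_t c (B_P _ Bx)) | rewrite tx; lra from hy1].
  near=> y => Ay; have By : B y by split => //; near: y.
  rewrite (tA_nQ nQx); have [[Qy hy]|[nQy _]] := B_case y By; last by rewrite tA_nQ//; lra from e0.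
  rewrite tA_Q//; have := lt_c0 y By Qy; have h : t y < t y1 by near: y.
  have := iffRL (mono y y1 (B_P _ By) ltac:(rewrite /eta in hy; lra from hy1 h hy) Py1 hy1) h; lra from ty1.
have tA_inj x y : B x -> B y -> (tA x = tA y <-> t x = t y).
  move=> Bx By; have [[Qx hx]|[nQx tx]] := B_case x Bx; have [[Qy hy]|[nQy ty]] := B_case y By.
  - by rewrite !tA_Q// -(fchart_leaf cQ Qx Qy) (fchart_leaf c (B_P _ Bx) (B_P _ By)).
  - by rewrite tA_Q// tA_nQ// ty; have := lt_c0 x Bx Qx; split; lra from H hx.
  - by rewrite tA_nQ// tA_Q// tx; have := lt_c0 y By Qy; split; lra from H hy.
  - by rewrite !tA_nQ// tx ty.
have cB1 := fchart_reparam cB0 (@half_interval _ _) tA_cvg tA_inj.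
have Bz : B z by split; [split => //=; rewrite tz /eta; lra from d'0 hy0 | exact: edgeA].
have imB : tA @` B = [set s | -1 <= s < c0].
  apply/seteqP; split=> [_ [x Bx <-]|s /= hs].
    have [[Qx hx]|[nQx _]] := B_case x Bx; last by rewrite /= tA_nQ//; lra from c0_bd.
    by have := lt_c0 x Bx Qx; rewrite /= tA_Q//; lra from.
  have [->|sn] := eqVneq s (-1); first by exists z => //; exact: tA_nQ.
  have s1 : -1 < s by rewrite lt_neqAle eq_sym sn; lra from hs.
  have [x [Qx _ tx]] := @fchart_at _ _ _ _ _ _ 0 s cQ ltac:(lra from) ltac:(rewrite /Iab /=; lra from c0_bd hs s1).
  by have [Bx _] := MB x Qx ltac:(lra from hs tx); exists x => //; rewrite tA_Q.
rewrite imB in cB1.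
have BM x : (B x /\ -1 < tA x) <-> (M x /\ tA x < c0).
  split=> [[Bx h]|[[Qx _]]]; last first.
    rewrite tA_Q// => h; split; first exact: (MB x Qx h).1.
    by have := fchart_J cQ Qx; rewrite /Iab /=; lra from.
  have [[Qx hx]|[nQx _]] := B_case x Bx; last by move: h; rewrite tA_nQ//; lra from.
  by have := lt_c0 x Bx Qx; rewrite tA_Q// => h'; split; [split => //=; lra from c0_bd h' | lra from h'].
have MS x : M x -> tA x < c0 -> S x.
  move=> [Qx _]; rewrite tA_Q// => h; have [Bx t0] := MB x Qx h.
  have [[_ hx]|[_ hx]] := B_case x Bx; last by lra.
  by split => //=; [exact: B_P | rewrite /eta in hx; lra].
have c0' : B `<=` A /\ -1 < c0 <= 0 by split => [x []//|]; lra.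
have [or1|or1] := fchart_orient cS (@Iab_interval _ _) cQ (fun x h => SQ x h.1 h.2).
  exists B, F, c0; split => //; split => // x y Mx hx Exy h.
  by apply/(or1 x y) => //; exact: MS.
exists B, (fun x => - F x), c0; split => //; split => //; first exact: fchart_flipF.
move=> x y Mx hx Exy h; rewrite ltrN2.
have [Qy ty] := iffLR (fchart_E cQ y Mx.1) Exy.
apply/(or1 y x); [|exact: Esym|exact: h].
apply: MS; first by split => //=; rewrite ty; exact: Mx.2.
by rewrite tA_Q// ty -tA_Q//; exact: Mx.1.
Unshelve. all: by end_near. Qed.

(** Either Q approaches z on this side through its end tq = -1, or a thin slab on this side misses
    M. The latter happens when the side is absent at a boundary leaf, when it lies outside Q, or
    when it is the end tq = 1. *)
Lemma edge_dichotomy P J F t z (d : R) : fchart E P J F t -> P z -> t z = 0 -> ~ Q z ->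
  0 < d -> (forall s, 0 < s < d -> J s) \/ (forall s, 0 < s -> ~ J s) ->
  (forall x, P x -> 0 < t x < d -> Gd x) ->
  [/\ forall s, 0 < s < d -> J s, forall x, P x -> 0 < t x < d -> Q x,
    forall x y, P x -> 0 < t x < d -> P y -> 0 < t y < d -> (tq x < tq y <-> t x < t y) &
    forall e : R, -1 < e -> exists x, [/\ P x, 0 < t x < d & tq x < e]] \/
  exists d' : R, 0 < d' /\ forall x, P x -> 0 < t x < d' -> ~ M x.
Proof.
move=> c Pz tz nQz d0 [JJ|nJ] SG; last first.
  by right; exists d; split => // x Px hx; exfalso; apply: (nJ (t x)); [lra | exact: (fchart_J c)].
have cS := fchart_strip c JJ; set S := P `&` _ in cS.
have [[y [Sy Qy]]|no] := pselect (S `&` Q !=set0); last first.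
  by right; exists d; split => // x Px hx [Qx _]; apply: no; exists x.
have SQ : S `<=` Q.
  apply: Qmax; [exact: fchart_conn cS (@Iab_interval _ _) | by move=> x [Px hx]; exact: SG | by exists y].
have SQ' x : P x -> 0 < t x < d -> Q x by move=> Px hx; apply: SQ.
have [[m low]|[m high]] := edge_side c Pz tz nQz d0 JJ SQ'; first by left.
right; have [x [Px hx tx]] := high 0 ltac:(lra).
exists (t x); split => [|x' Px' hx' [_ /= h]]; first by lra.
by have := iffRL (m x x' Px hx Px' ltac:(lra)) ltac:(lra); lra.
Qed.

Lemma edge_chart z : A z -> ~ Q z -> exists B F c, edge_datum B F c /\ B z.
Proof.
move=> Az nQz; have [w [Dw wz _]] := leafE_refl CF z.
have [P [F [t [c wP]]]] := leaf_fchart CF Dw; set J := J_interval _ in c.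
have [Pz tz] := iffLR (wP z) wz.
have J01 (s : R) : 0 <= s < 1 -> J s.
  by rewrite /J /J_interval; case: pselect => [?|?] /=; lra.
have Jneg : (forall s : R, -1 < s < 1 -> J s) \/ (forall s : R, J s -> 0 <= s).
  by rewrite /J /J_interval; case: pselect => [?|?] /=; [right => s; lra | left].
(* Local finiteness keeps the special leaves other than w away from z, and P has no boundary points
   off w. Each side of w in a thin slab thus lies in [Gd] and, being connected, is inside Q or
   disjoint from it. *)
pose Fm := [set w' | special_leaf Delta w' /\ w' <> w].
have nS : nbhs z (~` \bigcup_(w' in Fm) w').
  apply: open_nbhs_nbhs; split.
    by apply: closed_openC; apply: (special_closed CF LF) => w' [].
  by move=> [w' [[Dw' _] ne] w'z]; apply: ne; exact: (leafE_eq CF Dw' Dw w'z wz).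
have [d0 [d00 H0]] := fchart_near c Pz nS; rewrite tz in H0.
have [d [dp d1 d2]] := @pos_min d0 1 d00 ltac:(lra).
have good x : P x -> t x <> 0 -> - d < t x < d -> Gd x.
  move=> Px tx hx [[w' sw' w'x]|].
    have [v [Pv nv tv Ev]] := H0 x Px ltac:(lra).
    apply: nv; exists w'; last by apply/(leafE_in CF v sw'.1 w'x).
    by split => // e; apply: tx; move: w'x; rewrite e => /wP [].
  case: (ltrgtP (t x) 0) => // h.
    case: Jneg => [J1|J0]; last by have := J0 _ (fchart_J c Px); lra.
    have [e [e0 e1 e2]] := @pos_min (t x + 1) (1 - t x) ltac:(lra) ltac:(lra).
    by apply: (interior_not_boundary CF c Px e0) => s hs; apply: J1; lra.
  have [e [e0 e1 e2]] := @pos_min (t x) (1 - t x) ltac:(lra) ltac:(lra).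
  by apply: (interior_not_boundary CF c Px e0) => s hs; apply: J01; lra.
have c' := fchart_opp c.
have tz' : - t z = 0 by rewrite tz oppr0.
have notA (b a : R) : a < 0 < b -> (forall x, P x -> a < t x < b -> t x <> 0 -> ~ M x) -> False.
  move=> hab no; have oS := fchart_slab a b c.
  have [|x [Mx [Px hx]]] := Az (P `&` [set x | a < t x < b]).
    by apply: open_nbhs_nbhs; split => //; split => //=; rewrite tz.
  have [tx|tx] := eqVneq (t x) 0; last by apply: (no x Px hx _ Mx); exact/eqP.
  apply: nQz; apply: (Qsat Mx.1); apply/(fchart_leaf c) => //; by rewrite tx.
have slabA (b a : R) : (forall x, P x -> a < t x < b -> ~ M x) -> forall x, P x -> a < t x < b -> ~ A x.
  move=> no x Px hx Ax; have oS := fchart_slab a b c.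
  have [|y [My [Py hy]]] := Ax (P `&` [set x | a < t x < b]); first by apply: open_nbhs_nbhs.
  exact: (no y).
have [|[Jp SQ m low]|[dp' [dp0 Hp]]] := @edge_dichotomy P J F t z d c Pz tz nQz dp _
    (fun x Px hx => good x Px ltac:(lra) ltac:(lra)).
- by left => s hs; apply: J01; lra.
- have [||[Jp' SQ' m' low']|[dn [dn0 Hn]]] := edge_dichotomy (F := F) c' Pz tz' nQz dp _ _.
  + case: Jneg => [J1|J0]; first by left => s hs /=; apply: J1; lra.
    by right => s hs /= /J0; lra.
  + by move=> x Px hx; apply: good => //; lra.
  (* If both sides approached the end tq = -1, a leaf of Q at a low level would be met at a positive
     and at a negative value of t. *)
  + exfalso.
    have [x1 [Px1 hx1 _]] := low 1 ltac:(lra).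
    have Q1 := SQ _ Px1 hx1; have j1 := fchart_J cQ Q1; rewrite /Iab /= in j1.
    have [x2 [Px2 hx2 tx2]] := low' (tq x1) ltac:(lra).
    have Q2 := SQ' _ Px2 hx2; have j2 := fchart_J cQ Q2; rewrite /Iab /= in j2.
    have [x3 [Px3 hx3 tx3]] := low (tq x2) ltac:(lra).
    have cS := fchart_strip c Jp.
    have [|r [[Pr /= hr] tr _ _]] := @fchart_ivt _ _ _ _ _ _ cS (@Iab_interval _ _) tq (tq x2) x3 x1
      (fun y Sy => fchart_t cQ (SQ _ Sy.1 Sy.2)) (conj Px3 hx3) (conj Px1 hx1); first by lra.
    have Er : E r x2 by apply/(fchart_leaf cQ) => //; exact: SQ.
    by have [_ e] := iffLR (fchart_E c x2 Pr) Er; lra.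
  apply: (edge_datum_of_side (F := F) c Pz tz nQz dp _ SQ m low dn0) => [s hs|].
    by apply: J01; lra.
  by apply: slabA => x Px hx; apply: Hn => //; lra.
(* The side t > 0 misses M, so the other side must carry the chart; if both missed M, z would not be
   in its closure. *)
have [||[Jp SQ m low]|[dn [dn0 Hn]]] := edge_dichotomy (F := F) c' Pz tz' nQz dp _ _.
- case: Jneg => [J1|J0]; first by left => s hs /=; apply: J1; lra.
  by right => s hs /= /J0; lra.
- by move=> x Px hx; apply: good => //; lra.
- apply: (edge_datum_of_side (F := F) c' Pz tz' nQz dp _ SQ m low dp0) => [s hs|x Px hx].
    have [->|s0] := eqVneq s 0; first by rewrite /= oppr0; apply: J01; lra.
    by apply: Jp; rewrite lt_neqAle eq_sym s0; lra.
  by apply: (slabA dp' 0 Hp x Px); lra.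
exfalso; apply: (notA dp' (- dn)) => [|x Px hx tx]; first by lra.
case: (ltrgtP (t x) 0) => // h; first by apply: Hn => //; lra.
by apply: Hp => //; lra.
Qed.

Lemma half_closure_sat x y : A x -> E x y -> A y.
Proof.
move=> Ax Exy; have [Qx|nQx] := pselect (Q x).
  have [Qy ty] := iffLR (fchart_E cQ y Qx) Exy.
  by apply/half_closure_Q => //; rewrite ty; apply/half_closure_Q.
have [B [F [c [[cB [BA _] _ _] Bx]]]] := edge_chart Ax nQx.
exact: BA (fchart_sat cB Bx Exy).
Qed.

Let cM : @fchart (subspace A) E M [set s | -1 < s <= 0] Fq tA.
Proof.
have eM : M = Q `&` A.
  by apply/seteqP; split=> x [Qx h]; split => //; apply/half_closure_Q.
rewrite eM; apply: (@fchart_ext (subspace A) _ _ _ _ tq) => [|x [Qx _]]; last exact: tA_Q.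
apply: (fchart_subspace cQ) => [s|x Qx]; first by rewrite /Iab /=; lra.
by rewrite half_closure_Q//; have := fchart_J cQ Qx; rewrite /Iab /=; split; lra.
Qed.

Hypothesis hX : hausdorff_space X.
Hypothesis scX : @second_countable X.

Lemma half_coords : exists G : X -> R, [/\
  forall x, A x -> G y @[y --> (x : subspace A)] --> G x,
  forall x, A x -> tA y @[y --> (x : subspace A)] --> tA x,
  forall x y, A x -> A y -> G x = G y -> tA x = tA y -> x = y,
  forall x (N : set (subspace A)), A x -> nbhs (x : subspace A) N -> exists2 d : R, 0 < d & forall y, A y ->
    G x - d < G y < G x + d -> tA x - d < tA y < tA x + d -> N y &
  [/\ @fchart (subspace A) E M [set s | -1 < s <= 0] G tA,
    forall x, A x -> -1 < G x < 1 &
    forall x, A x -> ~ Q x -> exists a b : R,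
      [/\ -1 <= a, a < b, b <= 1 & G @` [set y | E x y] = Iab a b]]].
Proof.
have [[z0 [Az0 nQz0]]|no] := pselect (exists z, A z /\ ~ Q z); last first.
  have AM x : A x -> M x.
    move=> Ax; have Qx : Q x by apply: contrapT => nQ; apply: no; exists x.
    by split => //; apply/half_closure_Q.
  exists Fq; split.
  - by move=> x /AM; exact: (fchart_F cM).
  - by move=> x /AM; exact: (fchart_t cM).
  - by move=> x y /AM Mx /AM My; exact: (fchart_inj cM).
  - move=> x N /AM Mx nN; have [d d0 H] := fchart_inv cM Mx nN.
    by exists d => // y /AM; exact: H.
  - split => // [x /AM/(fchart_Fb cM)//|x Ax nQ].
    by exfalso; apply: no; exists x.
have [B0 [F0 [c0 [ed0 _]]]] := edge_chart Az0 nQz0.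
(* The chart at z0 serves as default index; this is why the case without boundary leaves was settled
   separately, with Fq itself as coordinate. *)
have [|f [fok fcov]] := @second_countable_cover X A (set X * ((X -> R) * R))%type
    (fun i => i.1) (fun i => edge_datum i.1 i.2.1 i.2.2) (B0, (F0, c0)) scX ed0.
  move=> [B [F c]] x /= [cB [BA _] _ _] Bx; apply/(near_subspace _ (BA _ Bx)).
  by apply: (fchart_nbhs cB).
pose B n := (f n).1; pose F n := (f n).2.1; pose c n := (f n).2.2.
have fd n : edge_datum (B n) (F n) (c n) by exact: fok.
have cB n : @fchart (subspace A) E (B n) [set s | -1 <= s < c n] (F n) tA by have [] := fd n.
have c_bd n : -1 < c n <= 0 by have [_ []] := fd n.
have BM n x : (B n x /\ -1 < tA x) <-> (M x /\ tA x < c n) by have [_ _ h _] := fd n.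
have ori n x y : M x -> tA x < c n -> E x y -> Fq x < Fq y -> F n x < F n y.
  by have [_ _ _ h] := fd n; exact: h.
have eA : M `|` \bigcup_n B n = A.
  apply/seteqP; split=> [x [[Qx h]|[n _ Bx]]|x Ax].
  - exact/half_closure_Q.
  - by have [_ [BA _] _ _] := fd n; exact: BA.
  have [Qx|nQx] := pselect (Q x); first by left; split => //; apply/half_closure_Q.
  have [Bx [Fx [cx [edx Bxx]]]] := edge_chart Ax nQx.
  have [n Bn] := fcov (Bx, (Fx, cx)) x edx Ax Bxx.
  by right; exists n.
have haus (x y : subspace A) : (M `|` \bigcup_n B n) x -> (M `|` \bigcup_n B n) y -> x <> y ->
    exists U V : set (subspace A), [/\ nbhs x U, nbhs y V & forall z, U z -> ~ V z].
  rewrite eA => Ax Ay xy; apply: contrapT => none; apply: xy.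
  apply: hX => U V nU nV; apply: contrapT => dis; apply: none.
  exists U, V; split; [apply: (iffRL (@near_subspace X A x U Ax)) | apply: (iffRL (@near_subspace X A y V Ay)) | ].
  - by apply: filterS nU.
  - by apply: filterS nV.
  - by move=> z Uz Vz; apply: dis; exists z.
have [G [g1 g2 g3 g4 [g5 g6]]] :=
  @edge_gluing (subspace A) E Esym M Fq tA cM B F c c_bd cB BM ori haus.
rewrite eA in g1 g2 g3 g4.
exists G; split => //.
  move=> x; rewrite -[in X in X -> _]eA => -[Mx|[n _ Bx]]; first exact: (fchart_t cM).
  exact: (fchart_t (cB n)).
split => // x Ax nQx; have : (M `|` \bigcup_n B n) x by rewrite eA.
by move=> [[//]|[n _ Bx]]; apply: (g6 n x Bx); exact: tA_nQ.
Qed.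

Lemma half_model : Q !=set0 -> foliated_model_strip A (induced_fol Delta A).
Proof.
move=> [q0 Qq0]; have [G [Gc tc Ginj Ginv [cG Gb Gedge]]] := half_coords.
pose a x := isigma (G x).
have aG x : A x -> sigma (a x) = G x by move=> Ax; exact/isigmaK/Gb.
have MA x : M x -> A x by exact: subset_closure.
have [|||f [hf fK]] := @coords_homeo X A a tA q0.
- by move=> x y Ax Ay e; apply: Ginj => //; rewrite -aG// -[RHS]aG// e.
- move=> x d Ax d0.
  have n1 := rlim_near (nbhs_filter (x : subspace A)) (isigma_cvg (nbhs_filter (x : subspace A)) (Gb _ Ax) (Gc _ Ax)) d0.
  have n2 := rlim_near (nbhs_filter (x : subspace A)) (tc _ Ax) d0.
  have n3 : @nbhs X X x _ := iffLR (@near_subspace X A x _ Ax)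
    (@filterI _ _ (nbhs_filter (x : subspace A)) _ _ n1 n2).
  rewrite nbhsE in n3; case: n3 => O [oO Ox] sO.
  by exists O; split => // q Aq Oq; have [] := sO q Oq Aq.
- move=> x N Ax nN; have [|d d0 H] := Ginv x N Ax.
    by apply: (iffRL (@near_subspace X A x N Ax)); apply: filterS nN.
  have [e e0 He] := @sigma_box (a x) d d0.
  have [e' [e'0 e1 e2]] := pos_min d0 e0.
  by exists e' => // q Aq h1 h2; apply: H => //; [rewrite -!aG//; apply: He; lra | lra].
set D := _ @` A in hf.
pose I_of z := a @` [set y | E z y].
pose Ia := [set I | exists z, [/\ A z, ~ Q z & I = I_of z]].
have A_case x : A x -> (M x /\ -1 < tA x <= 0) \/ (~ Q x /\ tA x = -1).
  move=> Ax; have [Qx|nQx] := pselect (Q x); last by right; split => //; exact: tA_nQ.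
  have Mx : M x by split => //; apply/half_closure_Q.
  by left; split => //; exact: (fchart_J cG).
have pt (u s : R) : -1 < s <= 0 -> exists y, [/\ M y, a y = u, tA y = s & f (u, s) = y].
  move=> hs; have [y [My Gy ty]] := fchart_at cG (sigma_bd u) hs.
  have e : a y = u by rewrite /a Gy sigmaK.
  by exists y; split => //; rewrite -e -ty; apply: fK; exact: MA.
have DM u s : -1 < s <= 0 -> D (u, s).
  by move=> /(pt u) [y [My ay ty _]]; exists y; [exact: MA | rewrite ay ty].
have De u : D (u, -1) -> exists y, [/\ A y, ~ Q y & a y = u].
  move=> [y Ay [ay ty]]; have [[_ h]|[nQ _]] := A_case y Ay; first by lra.
  by exists y.
have Esat z y : A z -> ~ Q z -> E z y -> [/\ A y, ~ Q y & tA y = -1].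
  move=> Az nQz Ezy; have nQy : ~ Q y by move=> Qy; apply: nQz; exact: Qsat Qy (Esym Ezy).
  by split => //; [exact: half_closure_sat Ezy | exact: tA_nQ].
(* The upper edge of the model is one full line, the leaf tq = 0 of Q; the lower edge carries one
   interval for each leaf of A outside Q. *)
exists (-1), 0, Ia, [set setT], D, f; split; last split => //.
- split; first by lra.
  split; first by move=> [u s] /= hs; apply: DM; lra.
  split.
    move=> _ [x Ax <-] /=; have [[_ h]|[_ ->]] := A_case x Ax; lra.
  split.
    split; [|split].
    + move=> I [z [Az nQz ->]]; have [l [r [l1 lr r1 e]]] := Gedge z Az nQz.
      rewrite (_ : I_of z = [set u | l < sigma u < r]); first exact: open_interval_sigma.
      apply/seteqP; split=> [_ [y Ezy <-]|u hu].
        have [Ay _ _] := Esat z y Az nQz Ezy.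
        have : (G @` [set y | E z y]) (G y) by exists y.
        by rewrite e /= aG.
      have : (G @` [set y | E z y]) (sigma u) by rewrite e.
      by move=> [y Ezy Gy]; exists y => //; rewrite /a Gy sigmaK.
    + move=> I1 I2 [z1 [A1 n1 ->]] [z2 [A2 n2 ->]] [u [[y1 E1 e1] [y2 E2 e2]]].
      have [Ay1 _ ty1] := Esat z1 y1 A1 n1 E1; have [Ay2 _ ty2] := Esat z2 y2 A2 n2 E2.
      have e : y1 = y2 by rewrite -(fK y1)// -(fK y2)// e1 e2 ty1 ty2.
      have E12 : E z1 z2 by apply: Etrans E1 _; rewrite e; exact: Esym.
      congr (a @` _); apply/seteqP; split=> y /=; last exact: Etrans.
      by apply: Etrans; exact: Esym.
    + apply/seteqP; split=> [u /De [y [Ay nQy ay]]|u [I [z [Az nQz ->]] [y Ezy <-]]].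
        by exists (I_of y); [exists y | exists y => //; exact: Erefl].
      by have [Ay _ ty] := Esat z y Az nQz Ezy; exists y => //; rewrite ty.
  split; [|split].
  + by move=> _ ->; exists -oo%E, +oo%E; split => //; apply/seteqP; split => // u _ /=; rewrite ltNyr ltry.
  + by move=> I1 I2 -> ->.
  + apply/seteqP; split=> [u _|u _]; first by exists setT.
    by apply: DM; lra.
have leafM x w : M x -> Delta w -> w x -> f @` hline (tA x) = w.
  move=> Mx Dw wx; have jx := fchart_J cG Mx; apply/seteqP; split=> [_ [[u s] hs <-]|y wy].
    rewrite /hline /= in hs; subst s.
    have [y [My _ ty ->]] := pt u (tA x) jx.
    by apply/(leafE_in CF y Dw wx)/(fchart_leaf cG).
  have [My ty] := iffLR (fchart_E cG y Mx) (iffRL (leafE_in CF y Dw wx) wy).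
  by exists (a y, tA y); [rewrite /hline /= | apply: fK; exact: MA].
have leafe z w : A z -> ~ Q z -> Delta w -> w z ->
    f @` [set p : R2 | p.2 = -1 /\ I_of z p.1] = w.
  move=> Az nQz Dw wz; apply/seteqP; split=> [_ [[u s] /= [-> [y Ezy <-]] <-]|y wy].
    have [Ay _ ty] := Esat z y Az nQz Ezy.
    by rewrite -ty fK//; apply/(leafE_in CF y Dw wz).
  have Ezy := iffRL (leafE_in CF y Dw wz) wy.
  have [Ay _ ty] := Esat z y Az nQz Ezy.
  by exists (a y, tA y); [split => //=; exists y | exact: fK].
have ind x w : A x -> Delta w -> w x -> induced_fol Delta A w.
  by move=> Ax Dw wx; apply: (induced_leaf Dw wx Ax) => y; exact: half_closure_sat.
split=> [l hl|w [Dw wA]].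
  have {hl} [[s [hs ->]]|[z [Az nQz ->]]] : (exists s, -1 < s <= 0 /\ l = hline s) \/
      exists z, [/\ A z, ~ Q z & l = [set p : R2 | p.2 = -1 /\ I_of z p.1]].
    case: hl => [[s [hs ->]]|[[I [[z [Az nQz ->]] ->]]|[I [-> ->]]]].
    - by left; exists s; split => //; lra.
    - by right; exists z.
    - left; exists 0; split; first by lra.
      by apply/seteqP; split=> p /=; [case | split].
    have [x [Mx _ tx _]] := pt 0 s hs; have [w [Dw wx _]] := leafE_refl CF x.
    by rewrite -tx (leafM x w)//; apply: (ind x) => //; exact: MA.
  by have [w [Dw wz _]] := leafE_refl CF z; rewrite (leafe z w)//; exact: (ind z).
have [[wne _] _] := CF; have [x wx] := wne w Dw; have Ax := wA x wx.
have [[Mx hx]|[nQx tx]] := A_case x Ax.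
  exists (hline (tA x)); split; last by rewrite (leafM x w).
  have [h|h] := eqVneq (tA x) 0.
    right; right; exists setT; split => //.
    by rewrite h; apply/seteqP; split=> p /=; [split | case].
  left; exists (tA x); split => //.
  by rewrite [_ < 0]lt_neqAle h; lra.
exists [set p : R2 | p.2 = -1 /\ I_of x p.1]; split; last by rewrite (leafe x w).
by right; left; exists (I_of x); split => //; exists x.
Qed.

End half_closure.

Lemma quotient_onto_iff (T1 T2 : topologicalType) (D : set T1) (r r' : T1 -> T1 -> Prop)
    LD (f : T1 -> T2) Q LQ : (forall a b, r a b <-> r' a b) ->
  foliated_quotient_onto D r LD f Q LQ -> foliated_quotient_onto D r' LD f Q LQ.
Proof.
move=> e [[im [inj top]] leaf]; split => //; split => //; split => // a b Da Db.
by rewrite -e; exact: inj.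
Qed.

Unset Implicit Arguments.

Theorem theorem1p8 (X : topologicalType) (Delta : set (set X))
  (Q : set X) :
  surface X ->
  connected [set: X] ->
  class_F Delta ->
  locally_finite (special_leaf Delta) ->
  (exists x, (~` (\bigcup_(w in special_leaf Delta) w `|` boundary X)) x /\
     Q = connected_component
           (~` (\bigcup_(w in special_leaf Delta) w `|` boundary X)) x) ->
  (* (1) *)
  ((foliated_cylinder Q (induced_fol Delta Q) \/
    foliated_moebius Q (induced_fol Delta Q) \/
    (exists phi : R2 -> X,
       foliated_homeo open_strip open_strip_foliation phi Q (induced_fol Delta Q))) /\
   ((foliated_cylinder Q (induced_fol Delta Q) \/
     foliated_moebius Q (induced_fol Delta Q)) -> Q = [set: X])) /\
  (* (2) *)
  (forall phi : R2 -> X,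
     foliated_homeo open_strip open_strip_foliation phi Q (induced_fol Delta Q) ->
     let Qm := phi @` [set p : R2 | -1 < p.2 <= 0] in
     let Qp := phi @` [set p : R2 | 0 <= p.2 < 1] in
     foliated_model_strip (closure Qm) (induced_fol Delta (closure Qm)) /\
     foliated_model_strip (closure Qp) (induced_fol Delta (closure Qp))).
Proof.
move=> [hX [scX _]] cX CF LF [x0 [Gx0 ->]].
have rg := good_component CF LF Gx0.
set Gd := ~` _ in Gx0 rg *; set Q0 := connected_component Gd x0 in rg *.
have Q0x : Q0 x0 by exact: connected_component_refl.
have QG : Q0 `<=` Gd by exact: connected_component_sub.
have satQ := rg_sat rg.
have Qmax S : connected S -> S `<=` Gd -> S `&` Q0 !=set0 -> S `<=` Q0.
  move=> cS SG [y [Sy Qy]]; rewrite /Q0 (same_connected_component Qy).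
  exact: connected_component_max.
(* X is connected and Q is open and nonempty, so closedness suffices; the argument is independent of
   the gluing relation. *)
have Qfull rel (f : R2 -> X) :
    foliated_quotient_onto closed_band rel closed_band_foliation f Q0 (induced_fol Delta Q0) ->
    Q0 = [set: X].
  move=> h; have clQ : closed Q0.
    apply: (band_closed CF _ satQ h) => p Qp w sw wp.
    by apply: (QG p Qp); left; exists w.
  apply: cX; first by exists x0.
    by exists Q0; [exact: rg_open rg | rewrite setTI].
  by exists Q0; rewrite ?setTI.
split; first split.
- have [||[F [t c]]|[P0 [M [F0 [t0 [G [t [eps cd]]]]]]]] := regular_structure rg _ _ scX.
  + exact: component_connected.
  + by exists x0.
  + by right; right; apply: (line_model CF satQ c); exists x0.
  have [f hf] := circle_model CF satQ (rg_open rg) cd (ex_intro _ x0 Q0x).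
  have [e|e] := cd_eps cd; [left | right; left]; exists f; rewrite e in hf.
    by apply: quotient_onto_iff hf => a b; exact: twisted_cylinder.
  by apply: quotient_onto_iff hf => a b; exact: twisted_moebius.
- by move=> [[f h]|[f h]]; exact: Qfull h.
move=> phi [hm [leaf _]] Qm Qp.
(* Part (2) concerns an arbitrary given phi, which is turned into a chart whose t is the second
   component of its inverse. *)
have leaf' s : Iab (-1) 1 s -> Delta (phi @` hline s).
  by move=> hs; have [|] := leaf (hline s) => //; exists s.
have [a [t [c ak gk]]] := homeo_fchart CF (rg_open rg) hm leaf'.
have im (J : set R) : J `<=` Iab (-1) 1 -> phi @` [set p : R2 | J p.2] = Q0 `&` [set x | J (t x)].
  move=> JJ; apply/seteqP; split=> [_ [p Jp <-]|x [Qx Jx]].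
    have [_ tp] := ak p (JJ _ Jp); split; last by rewrite /= tp.
    by have [e _] := hm; rewrite -e; exists p => //; exact: JJ.
  by exists (a x, t x) => //; exact: gk.
split.
  have -> : Qm = Q0 `&` [set x | t x <= 0].
    rewrite /Qm (im [set s | -1 < s <= 0]) => [|s]; last by rewrite /Iab /=; lra.
    by apply/seteqP; split=> x [Qx h]; split => //=; move: h (fchart_J c Qx); rewrite /Iab /=; lra.
  by apply: (half_model CF LF rg QG Qmax c hX scX); exists x0.
(* Reversing t turns Q_+ into a lower half, so one lemma serves both closures. *)
have c' := fchart_neg c; rewrite opprK in c'.
have -> : Qp = Q0 `&` [set x | - t x <= 0].
  rewrite /Qp (im [set s | 0 <= s < 1]) => [|s]; last by rewrite /Iab /=; lra.
  by apply/seteqP; split=> x [Qx h]; split => //=; move: h (fchart_J c Qx); rewrite /Iab /=; lra.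
by apply: (half_model CF LF rg QG Qmax c' hX scX); exists x0.
Qed.
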